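(* (General local Birch lemma.) Let $m\ge n\ge 0$ be integers. Let $w$ be an Iwahori invariant $\psi$-Whittaker function on $\mathrm{GL}_m(F)$ and let $v$ be an Iwahori invariant $\psi^{-1}$-Whittaker function on $\mathrm{GL}_n(F)$. Then for every quasi-character $\chi:F^\times\to\mathbf{C}^\times$ with nontrivial conductor $\mathfrak f=f\mathcal O_F$ and every $s\in\mathbf C$, $$ \int_{U_n(F)\backslash \mathrm{GL}_n(F)}\psi(\lambda_n(g))\,w\bigl(j(gD_nw_n)\bigr)\,v(g)\,\chi(\det g)\,|\det g|^{s-\frac{m-n}{2}}\,dg $$ $$ =\prod_{\nu=1}^n\bigl(1-\mathfrak N(\mathfrak p)^{-\nu}\bigr)^{-1}\cdot\mathfrak N(\mathfrak f)^{-\sum_{k=1}^n k(n+1-k)}\cdot G(\chi)^{\frac{n(n+1)}2}\cdot w(\mathbf 1_m)\cdot v(\mathbf 1_n). $$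
   Context: $F$ is a nonarchimedean local field with ring of integers $\mathcal O_F$, maximal ideal $\mathfrak p$, prime element $\varpi$; $\mathfrak N(\mathfrak a)$ is the absolute norm of a fractional ideal, and $|\cdot|$ is normalized by $|\varpi|=\mathfrak N(\mathfrak p)^{-1}$. $\psi:F\to\mathbf C^\times$ is an additive character with conductor $\mathcal O_F$ (trivial on $\mathcal O_F$, not on $\mathfrak p^{-1}$). $U_n$ is the group of upper triangular unipotent matrices in $\mathrm{GL}_n$, and $\psi(u)=\prod_{i=1}^{n-1}\psi(u_{i,i+1})$ for $u\in U_n(F)$. The Iwahori subgroup $I_n$ consists of the matrices in $\mathrm{GL}_n(\mathcal O_F)$ that are upper triangular modulo $\mathfrak p$. A $\psi^{\pm1}$-Whittaker function on $\mathrm{GL}_n(F)$ is a function $w:\mathrm{GL}_n(F)\to\mathbf C$ with $w(ug)=\psi(u)^{\pm1}w(g)$ for $u\in U_n(F)$; it is Iwahori invariant if $w(gr)=w(g)$ for $r\in I_n$. $j:\mathrm{GL}_n\to\mathrm{GL}_m$ is $g\mapsto \mathrm{diag}(g,\mathbf 1_{m-n})$. $w_n$ is the $n\times n$ antidiagonal permutation matrix. For the fixed generator $f$ of $\mathfrak f$ (so $0\neq f\in\mathcal O_F\setminus\mathcal O_F^\times$): $D_n=\mathrm{diag}(f^{-(n-1)},f^{-(n-3)},\dots,f^{n-3},f^{n-1})$, and $\lambda_n:F^{n\times n}\to F$, $\lambda_n(g)=b_n^t\,g\,\phi_n$, where $b_n$ is the $n$-th standard basis (column) vector and $\phi_n=(f^{-n},f^{-(n-1)},\dots,f^{-1})^t$.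 The conductor of $\chi$ is the largest ideal $\mathfrak f$ such that $\chi$ is trivial on $1+\mathfrak f$ (on $\mathcal O_F^\times$ if $\mathfrak f=\mathcal O_F$); nontrivial means $\mathfrak f\ne\mathcal O_F$. The Gauss sum is $G(\chi)=\sum_{x+\mathfrak f\in(\mathcal O_F/\mathfrak f)^\times}\chi(x)\psi(x/f)$. $dg$ is the measure on $U_n(F)\backslash\mathrm{GL}_n(F)$ induced by the Haar measure on $\mathrm{GL}_n(F)$ giving $\mathrm{GL}_n(\mathcal O_F)$ volume $1$ and the Haar measure on $U_n(F)$ giving $U_n(\mathcal O_F)$ volume $1$. The integral is understood as the sum of the integrals over the cells $U_n(F)\backslash U_n(F)\varpi^e\omega I_n$ (each compact modulo $U_n(F)$), $e\in\mathbf Z^n$, $\omega$ a permutation matrix, $\varpi^e=\mathrm{diag}(\varpi^{e_1},\dots,\varpi^{e_n})$, which form a disjoint decomposition of $U_n(F)\backslash\mathrm{GL}_n(F)$; when the integral converges absolutely this is the ordinary integral. *)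

(* Defs.v *)
From HB Require Import structures.
From mathcomp Require Import all_boot all_order all_algebra.
From mathcomp Require Import generic_quotient perm finmap complex.
From mathcomp Require Import all_classical all_reals all_analysis.

Set Implicit Arguments.
Unset Strict Implicit.
Unset Printing Implicit Defensive.

Import Order.TTheory GRing.Theory Num.Theory.
Local Open Scope classical_set_scope.
Local Open Scope ring_scope.

(* [v] is only meaningful at nonzero arguments; v(0) plays the role of +oo.  *)
Definition val_ideal (F : fieldType) (v : F -> int) (k : int) : set F :=
  [set x | x = 0 \/ k <= v x].

Definition cosets (F : fieldType) (I J : set F) : set (set F) :=
  [set [set x + y | y in J] | x in I].

Definition val_complete (F : fieldType) (v : F -> int) : Prop :=
  forall u : nat -> F,
    (forall k : int, exists N : nat, forall i j : nat,
       (N <= i)%N -> (N <= j)%N -> val_ideal v k (u i - u j)) ->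
    exists l : F, forall k : int, exists N : nat, forall i : nat,
      (N <= i)%N -> val_ideal v k (u i - l).

(* A field that is complete for a normalized discrete valuation with finite  *)
(* residue field.                                                            *)
Record localField := LocalField {
  lf_sort :> fieldType;
  val_ : lf_sort -> int;
  val_M : forall x y : lf_sort, x != 0 -> y != 0 ->
    val_ (x * y) = val_ x + val_ y;
  val_D : forall x y : lf_sort, x != 0 -> y != 0 -> x + y != 0 ->
    Order.min (val_ x) (val_ y) <= val_ (x + y);
  val_onto : exists2 x : lf_sort, x != 0 & val_ x = 1;
  val_cauchy : val_complete val_;
  val_residue : finite_set (cosets (val_ideal val_ 0) (val_ideal val_ 1))
}.

Section LocalField.
Variable F : localField.

Definition pideal (k : int) : set F := val_ideal (@val_ F) k.
Definition Oint : set F := pideal 0.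
Definition Ounit : set F := [set x | x != 0 /\ val_ x = 0].
Definition prime_elt (x : F) : Prop := x != 0 /\ val_ x = 1.
Definition principal (a : F) : set F := [set a * y | y in Oint].

Definition is_ideal (J : set F) : Prop :=
  [/\ J `<=` Oint, J 0, (forall x y, J x -> J y -> J (x + y)) &
      (forall a x, Oint a -> J x -> J (a * x))].

(* The absolute norm #(O/J) of a nonzero integral ideal J. *)
Definition absnorm (J : set F) : nat := #|` fset_set (cosets Oint J)|.

Definition absF (R : realType) (x : F) : R :=
  if x == 0 then 0 else (absnorm (pideal 1))%:R ^ (- val_ x).

End LocalField.
Arguments Oint {F}.
Arguments Ounit {F}.
Arguments pideal {F} k.

Section Complex.
Variable R : realType.
Local Notation C := R[i].

Definition cpow (x : R) (z : C) : C :=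
  real_complex R (expR (complex.Re z * ln x)) *
  Complex (cos (complex.Im z * ln x)) (sin (complex.Im z * ln x)).

(* Unconditional convergence of a family of complex numbers. *)
Definition has_sum (I : choiceType) (a : I -> C) (S : C) : Prop :=
  forall e : C, 0 < e -> exists J0 : {fset I}, forall J : {fset I},
    (J0 `<=` J)%fset -> `|\sum_(i <- J) a i - S| < e.

Section Integral.
Variables (d : measure_display) (T : measurableType d).
Variable mu : {measure set T -> \bar R}.

Definition cintegrable (D : set T) (h : T -> C) : Prop :=
  mu.-integrable D (fun x => (complex.Re (h x))%:E) /\
  mu.-integrable D (fun x => (complex.Im (h x))%:E).

Definition cintegral (D : set T) (h : T -> C) : C :=
  Complex (Rintegral mu D (fun x => complex.Re (h x)))
          (Rintegral mu D (fun x => complex.Im (h x))).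

End Integral.
End Complex.

Section Characters.
Variables (R : realType) (F : localField).
Local Notation C := R[i].

Definition additive_character (psi : F -> C) : Prop :=
  (forall x, psi x != 0) /\ (forall x y, psi (x + y) = psi x * psi y).

Definition has_conductor_O (psi : F -> C) : Prop :=
  (forall x, Oint x -> psi x = 1) /\ ~ (forall x, pideal (-1) x -> psi x = 1).

(* A continuous homomorphism F^* -> C^*, its value at 0 being irrelevant. *)
Definition quasi_character (chi : F -> C) : Prop :=
  [/\ (forall x, x != 0 -> chi x != 0),
      (forall x y, x != 0 -> y != 0 -> chi (x * y) = chi x * chi y) &
      (forall x, x != 0 -> forall e : C, 0 < e -> exists k : int,
         forall y, y != 0 -> pideal k (y - x) -> `|chi y - chi x| < e)].

(* The condition [Ounit x] is automatic if J is a proper ideal and makes the *)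
(* case J = O read as triviality on O^*.                                     *)
Definition trivial_mod (chi : F -> C) (J : set F) : Prop :=
  forall x, Ounit x -> J (x - 1) -> chi x = 1.

Definition is_conductor (chi : F -> C) (J : set F) : Prop :=
  [/\ is_ideal J, trivial_mod chi J &
      forall J', is_ideal J' -> trivial_mod chi J' -> J' `<=` J].

(* The units of O/f are the cosets of the units of O, O being local. *)
Definition gauss_sum (psi chi : F -> C) (f : F) : C :=
  \sum_(X \in cosets Ounit (principal f))
     chi (xget 0 X) * psi (xget 0 X / f).

End Characters.

HB.structure Definition PointedGroup := { G of Group G & Pointed G }.

Section Groups.
Variables (F : fieldType) (n : nat).
Implicit Types u v : 'M[F]_n.

Definition unipotent : {pred 'M[F]_n} :=
  fun u => [forall i : 'I_n, forall j : 'I_n, (j <= i)%N ==> (u i j == (i == j)%:R)].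

Lemma unipotentP u :
  reflect (forall i j : 'I_n, (j <= i)%N -> u i j = (i == j)%:R)
          (u \in unipotent).
Proof.
apply: (iffP forallP) => [H i j ij|H i].
  by have /forallP/(_ j)/implyP/(_ ij)/eqP := H i.
by apply/forallP => j; apply/implyP => ij; apply/eqP/H.
Qed.

Lemma unipotent1 : (1%:M : 'M[F]_n) \in unipotent.
Proof. by apply/unipotentP => i j _; rewrite mxE. Qed.

Lemma unipotentM u v :
  u \in unipotent -> v \in unipotent -> u *m v \in unipotent.
Proof.
move=> /unipotentP Hu /unipotentP Hv; apply/unipotentP => i j ji.
rewrite mxE (bigD1 i) //= Hu // eqxx mul1r Hv // big1 ?addr0 // => k ki.
case: (leqP k i) => [le_ki|lt_ik].
  by rewrite Hu // eq_sym (negbTE ki) mul0r.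
rewrite Hv; last by rewrite (leq_trans ji) // ltnW.
have -> : (k == j) = false by apply/eqP => kj; move: lt_ik; rewrite kj ltnNge ji.
by rewrite mulr0.
Qed.

Lemma unipotent_unit u : u \in unipotent -> u \in unitmx.
Proof.
move=> /unipotentP Hu; rewrite -unitmx_tr unitmxE det_trig.
  by rewrite big1 ?unitr1 // => i _; rewrite mxE Hu // eqxx.
apply/is_trig_mxP => i j ij; rewrite mxE Hu; last exact: ltnW.
by have -> : (j == i) = false by apply/eqP => e; move: ij; rewrite e ltnn.
Qed.

Lemma unipotentV u : u \in unipotent -> invmx u \in unipotent.
Proof.
move=> uU; have uu := unipotent_unit uU; move/unipotentP: uU => Hu.
apply/unipotentP => i j; have [d] := ubnP (n - i).
elim: d i => // d IH i; rewrite ltnS => le_d ji.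
have /matrixP/(_ i j) := mulmxV uu.
rewrite !mxE (bigD1 i) //= Hu // eqxx mul1r big1 ?addr0 // => k ki.
case: (leqP k i) => [le_ki|lt_ik].
  by rewrite Hu // eq_sym (negbTE ki) mul0r.
rewrite IH.
- have -> : (k == j) = false.
    by apply/eqP => kj; move: lt_ik; rewrite kj ltnNge ji.
  by rewrite mulr0.
- by apply: leq_trans le_d; apply: ltn_sub2l.
- by rewrite (leq_trans ji) // ltnW.
Qed.

Record GL := MkGL { GL_mx :> 'M[F]_n; GL_unit : GL_mx \in unitmx }.
HB.instance Definition _ := [isSub for GL_mx].
HB.instance Definition _ := [Choice of GL by <:].

Definition GL_one := MkGL (unitmx1 F n).
Definition GL_mul (g h : GL) : GL.
Proof. by exists (g *m h); rewrite unitmx_mul !GL_unit. Defined.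
Definition GL_inv (g : GL) : GL.
Proof. by exists (invmx g); rewrite unitmx_inv GL_unit. Defined.

Lemma GL_mulA : associative GL_mul.
Proof. by move=> x y z; apply: val_inj; rewrite /= mulmxA. Qed.
Lemma GL_1mul : left_id GL_one GL_mul.
Proof. by move=> x; apply: val_inj; rewrite /= mul1mx. Qed.
Lemma GL_mul1 : right_id GL_one GL_mul.
Proof. by move=> x; apply: val_inj; rewrite /= mulmx1. Qed.
Lemma GL_mulV : left_inverse GL_one GL_inv GL_mul.
Proof. by move=> x; apply: val_inj; rewrite /= mulVmx // GL_unit. Qed.
Lemma GL_Vmul : right_inverse GL_one GL_inv GL_mul.
Proof. by move=> x; apply: val_inj; rewrite /= mulmxV // GL_unit. Qed.

HB.instance Definition _ :=
  isGroup.Build GL GL_mulA GL_1mul GL_mul1 GL_mulV GL_Vmul.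
HB.instance Definition _ := isPointed.Build GL GL_one.

Record Uni := MkUni { Uni_mx :> 'M[F]_n; Uni_prop : Uni_mx \in unipotent }.
HB.instance Definition _ := [isSub for Uni_mx].
HB.instance Definition _ := [Choice of Uni by <:].

Definition Uni_one := MkUni unipotent1.
Definition Uni_mul (u v : Uni) : Uni := MkUni (unipotentM (Uni_prop u) (Uni_prop v)).
Definition Uni_inv (u : Uni) : Uni := MkUni (unipotentV (Uni_prop u)).

Lemma Uni_mulA : associative Uni_mul.
Proof. by move=> x y z; apply: val_inj; rewrite /= mulmxA. Qed.
Lemma Uni_1mul : left_id Uni_one Uni_mul.
Proof. by move=> x; apply: val_inj; rewrite /= mul1mx. Qed.
Lemma Uni_mul1 : right_id Uni_one Uni_mul.
Proof. by move=> x; apply: val_inj; rewrite /= mulmx1. Qed.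
Lemma Uni_mulV : left_inverse Uni_one Uni_inv Uni_mul.
Proof.
by move=> x; apply: val_inj; rewrite /= mulVmx // unipotent_unit ?Uni_prop.
Qed.
Lemma Uni_Vmul : right_inverse Uni_one Uni_inv Uni_mul.
Proof.
by move=> x; apply: val_inj; rewrite /= mulmxV // unipotent_unit ?Uni_prop.
Qed.

HB.instance Definition _ :=
  isGroup.Build Uni Uni_mulA Uni_1mul Uni_mul1 Uni_mulV Uni_Vmul.
HB.instance Definition _ := isPointed.Build Uni Uni_one.

Definition GL_of_Uni (u : Uni) : GL := MkGL (unipotent_unit (Uni_prop u)).

Definition Uorbit (g h : GL) : bool :=
  `[< exists u : Uni, h = (GL_of_Uni u * g)%g >].

Lemma Uorbit_refl : reflexive Uorbit.
Proof.
move=> g; apply/asboolP; exists 1%g.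
by apply: val_inj; rewrite /= mul1mx.
Qed.

Lemma Uorbit_sym : symmetric Uorbit.
Proof.
have H g h : Uorbit g h -> Uorbit h g.
  move=> /asboolP[u ->]; apply/asboolP; exists (u^-1)%g.
  by apply: val_inj; rewrite /= mulmxA mulVmx ?mul1mx // unipotent_unit ?Uni_prop.
by move=> g h; apply/idP/idP; exact: H.
Qed.

Lemma Uorbit_trans : transitive Uorbit.
Proof.
move=> h g k /asboolP[u ->] /asboolP[v ->]; apply/asboolP.
by exists (v * u)%g; apply: val_inj; rewrite /= mulmxA.
Qed.

Canonical Uorbit_equiv := EquivRel Uorbit Uorbit_refl Uorbit_sym Uorbit_trans.

Definition UGL := {eq_quot Uorbit}%qT.
HB.instance Definition _ := Choice.on UGL.
HB.instance Definition _ := EqQuotient.on UGL.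
HB.instance Definition _ := isPointed.Build UGL (\pi_UGL GL_one)%qT.

End Groups.

(* The topology on T induced by i : T -> F^{n x n}. *)
Definition mx_open (F : localField) (n : nat) (T : Type) (i : T -> 'M[F]_n) :
    set (set T) :=
  [set A | forall g, A g -> exists k : int, forall h,
     (forall a b, pideal k (i h a b - i g a b)) -> A h].

Section Borel.
Variables (F : localField) (n : nat).

Definition GL_open : set (set (GL F n)) := mx_open (@GL_mx F n).
Definition Uni_open : set (set (Uni F n)) := mx_open (@Uni_mx F n).
Definition UGL_open : set (set (UGL F n)) :=
  [set A | GL_open [set g | A (\pi_(UGL F n) g)%qT]].

Definition GL_borel := g_sigma_algebraType GL_open.
Definition Uni_borel := g_sigma_algebraType Uni_open.
Definition UGL_borel := g_sigma_algebraType UGL_open.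

HB.instance Definition _ := Measurable.on GL_borel.
HB.instance Definition _ := Measurable.on Uni_borel.
HB.instance Definition _ := Measurable.on UGL_borel.

Definition GL_O : set (GL F n) :=
  [set g : GL F n | (forall i j, Oint (g i j)) /\ Ounit (\det g)].
Definition Uni_O : set (Uni F n) := [set u : Uni F n | forall i j, Oint (u i j)].

End Borel.

(* The Haar measure of a unimodular group (as GL_n(F) and U_n(F) are), which *)
(* is both left and right invariant, normalized by mu(K) = 1; here K is open *)
(* and compact, so that mu is finite on compact sets.                        *)
Definition haar_measure (R : realType) (G : PointedGroup.type)
    (opens : set (set G)) (K : set G)
    (mu : {measure set (g_sigma_algebraType opens) -> \bar R}) : Prop :=
  [/\ (forall (a : G) (A : set G), opens.-sigma.-measurable A ->
         mu [set x | A (a * x)%g] = mu A),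
      (forall (a : G) (A : set G), opens.-sigma.-measurable A ->
         mu [set x | A (x * a)%g] = mu A) &
      mu K = 1%E].

(* Weil's formula int_G 1_A = int_{U\G} int_U 1_A(u g) du dg. *)
Definition quotient_measure (R : realType) (F : localField) (n : nat)
    (muG : {measure set (GL_borel F n) -> \bar R})
    (muU : {measure set (Uni_borel F n) -> \bar R})
    (mu : {measure set (UGL_borel F n) -> \bar R}) : Prop :=
  forall A : set (GL F n), (@GL_open F n).-sigma.-measurable A ->
    muG A =
    (\int[mu]_(x in setT) muU [set u | A (GL_of_Uni u * repr (x : UGL F n))%g])%E.

(* A function on GL_n(F) is represented by a function on matrices whose      *)
(* values at singular matrices are irrelevant.                               *)

Section Whittaker.
Variables (R : realType) (F : localField) (n : nat).
Local Notation C := R[i].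

Definition psiU (psi : F -> C) (u : 'M[F]_n) : C :=
  \prod_(i < n) \prod_(j < n | j == i.+1 :> nat) psi (u i j).

Definition iwahori (r : 'M[F]_n) : Prop :=
  [/\ forall i j, Oint (r i j), Ounit (\det r) &
      forall i j : 'I_n, (j < i)%N -> pideal 1 (r i j)].

Definition whittaker (psi : F -> C) (w : 'M[F]_n -> C) : Prop :=
  forall u g : 'M[F]_n, u \in @unipotent F n -> g \in unitmx ->
    w (u *m g) = psiU psi u * w g.

Definition whittaker_inv (psi : F -> C) (w : 'M[F]_n -> C) : Prop :=
  forall u g : 'M[F]_n, u \in @unipotent F n -> g \in unitmx ->
    w (u *m g) = (psiU psi u)^-1 * w g.

Definition iwahori_invariant (w : 'M[F]_n -> C) : Prop :=
  forall g r : 'M[F]_n, g \in unitmx -> iwahori r -> w (g *m r) = w g.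

End Whittaker.

Section Birch.
Variables (R : realType) (F : localField).
Local Notation C := R[i].

Definition jmx (n m : nat) (le_nm : (n <= m)%N) (g : 'M[F]_n) : 'M[F]_m :=
  castmx (subnKC le_nm, subnKC le_nm) (block_mx g 0 0 (1%:M : 'M[F]_(m - n))).

Definition wmx (n : nat) : 'M[F]_n :=
  \matrix_(i < n, j < n) ((i + j).+1 == n)%:R.

(* Rows and columns are numbered from 0, so that the i-th exponent of D_n is *)
(* 2i + 1 - n and the i-th entry of phi_n is f^-(n - i).                     *)
Definition Dmx (n : nat) (f : F) : 'M[F]_n :=
  diag_mx (\row_(i < n) f ^ ((i.*2.+1)%:Z - n%:Z)).

Definition bvec (n : nat) : 'cV[F]_n := \col_(i < n) (i.+1 == n)%:R.
Definition phivec (n : nat) (f : F) : 'cV[F]_n := \col_(i < n) f ^- (n - i).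
Definition lambda (n : nat) (f : F) (g : 'M[F]_n) : F :=
  ((bvec n)^T *m g *m phivec n f) 0 0.

Definition birch_integrand (psi chi : F -> C) (f : F) (s : C)
    (n m : nat) (le_nm : (n <= m)%N)
    (w : 'M[F]_m -> C) (v : 'M[F]_n -> C) (g : 'M[F]_n) : C :=
  psi (lambda f g) * w (jmx le_nm (g *m Dmx n f *m wmx n)) * v g *
  chi (\det g) * cpow (absF R (\det g)) (s - (m - n)%:R / 2%:R).

Definition cell (n : nat) (varpi : F) (e : {ffun 'I_n -> int}) (o : 'S_n) :
    set (UGL_borel F n) :=
  [set x | exists2 g : GL F n, (x : UGL F n) = (\pi_(UGL F n) g)%qT &
     exists2 r : 'M[F]_n, iwahori r &
       (g : 'M[F]_n) =
         diag_mx (\row_i varpi ^ e i) *m perm_mx o *m r].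

(* h is a left U_n(F)-invariant function on GL_n(F), seen as a function on   *)
(* U_n(F)\GL_n(F) through representatives; its integral is the sum of its    *)
(* integrals over the cells.                                                 *)
Definition has_cellwise_integral (n : nat)
    (mu : {measure set (UGL_borel F n) -> \bar R}) (varpi : F)
    (h : 'M[F]_n -> C) (S : C) : Prop :=
  let h' := fun x : UGL_borel F n => h (repr (x : UGL F n) : GL F n) in
  (forall e o, cintegrable mu (cell varpi e o) h') /\
  has_sum (fun eo : {ffun 'I_n -> int} * 'S_n =>
             cintegral mu (cell varpi eo.1 eo.2) h') S.

End Birch.

(* Main.v *)
Require Import Defs.
From HB Require Import structures.
From mathcomp Require Import all_boot all_order all_algebra.
From mathcomp Require Import generic_quotient perm finmap complex.
From mathcomp Require Import all_classical all_reals all_analysis.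
From mathcomp Require Import measurable_realfun.
From mathcomp Require Import zify ring lra.

(** On the cell of a monomial matrix [g0], the integrand [h] is right invariant
    under the principal congruence subgroup of some level [l].  Weil's formula,
    applied to subsets of [g0 I], where [I] is the Iwahori subgroup, turns the
    integral over that cell into a positive constant times the sum of the values
    [h (g0 r)], where [r] runs over [I] modulo [p^l] ([cell_integral]).  The
    constant has to be known only for [g0 = 1], where it is the inverse of the
    number of invertible matrices modulo [p^l] ([gl_countE]).

    It remains to evaluate a finite sum, which is done by induction on [n]
    ([birch_fun_sum]).  Translating [r] on the right by a diagonal matrix [t] of
    units does not change the Whittaker functions, because [D_n w_n] normalizes
    the diagonal matrices.  It multiplies [chi (det g)] by the product of the
    [chi (t_i)] and otherwise only affects [lambda_n], which is linear in the last
    row.  Averaging over [t] hence produces a product of sums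
    [sum_t chi (t) psi (y_i t / f)], where [y_i] is the [i]-th entry of the last
    row of [g], counted from 0, divided by [f^(n-1-i)].  Such a sum vanishes
    unless [y_i] is a unit, and then it is [chi (y_i)^-1] times a multiple of the
    Gauss sum ([gauss_term_sum0], [gauss_term_sum_unit]).  So only those [g]
    contribute whose last row is [(f^(n-1) y_0, ..., f y_(n-2), y_(n-1))] with
    units [y_i].  A cell contains such a [g] only if [g0] fixes the last basis
    vector ([monomial_lastrow]), so that [g0 = diag (g0', 1)]; repeating this
    excludes all cells except the one with [g0 = 1].

    An [r] with such a last row can be written in a unique way as
    [(A x; 0 1) K_n diag (y)], where [K_n] is the lower triangular matrix with
    entries [f^(i-j)].  The identity [Kmx_DW],
    [K_n D_n w_n =
     (1 phi_(n-1); 0 1) diag (- D_(n-1) w_(n-1) K_(n-1), 1) (1 0; rho 1)],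
    in which [K_(n-1)] and [(1 0; rho 1)] lie in the Iwahori subgroup, shows that
    the integrand at [g0 r] is the product of the [chi (y_i)] and of the
    integrand for [n - 1] at [g0' A]: the additive factor
    [psi (lambda_(n-1) (g0' A))] is what the Whittaker property of [w] gives for
    the column [phi_(n-1)], while the contributions of [x] to [w] and [v] cancel
    ([whittaker_part_step]).  Each step contributes [n] Gauss sums, and the powers
    of the residue cardinality are collected in [constantE]. *)

Set Implicit Arguments.
Unset Strict Implicit.
Unset Printing Implicit Defensive.

Import Order.TTheory GRing.Theory Num.Theory.
Local Open Scope classical_set_scope.
Local Open Scope ring_scope.

(** * The valuation *)

Section Valuation.
Context {F : localField}.
Implicit Types (x y z : F) (k l : int).

Lemma val_1 : val_ (1 : F) = 0.
Proof. have := @val_M F 1 1 (oner_neq0 _) (oner_neq0 _); rewrite mulr1; lia. Qed.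

Lemma valV x : x != 0 -> val_ x^-1 = - val_ x.
Proof.
move=> x0; have := val_M x0 (invr_neq0 x0).
by rewrite divff // val_1; lia.
Qed.

Lemma valN x : val_ (- x) = val_ x.
Proof.
have [->|x0] := eqVneq x 0; first by rewrite oppr0.
have m1 : (-1 : F) != 0 by rewrite oppr_eq0 oner_neq0.
have := val_M m1 m1; rewrite mulrNN mulr1 val_1 => h.
by rewrite -mulN1r val_M //; lia.
Qed.

Lemma valX x k : x != 0 -> val_ (x ^ k) = k * val_ x.
Proof.
move=> x0.
have H (j : nat) : val_ (x ^+ j) = j%:Z * val_ x.
  elim: j => [|j IH]; first by rewrite expr0 val_1 mul0r.
  by rewrite exprS val_M ?expf_neq0 // IH; lia.
case: k => j; first by rewrite -exprnP H.
by rewrite NegzE -exprnN valV ?expf_neq0 // H; lia.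
Qed.

Lemma pideal0 k : pideal k (0 : F).
Proof. by left. Qed.

Lemma pidealE k x : x != 0 -> pideal k x -> k <= val_ x.
Proof. by move=> x0 [xe|//]; rewrite xe eqxx in x0. Qed.

Lemma le_pideal k l x : k <= l -> pideal l x -> pideal k x.
Proof. by move=> kl [->|h]; [left|right; apply: le_trans h]. Qed.

Lemma pidealD k x y : pideal k x -> pideal k y -> pideal k (x + y).
Proof.
move=> hx hy; have [xy0|xy0] := eqVneq (x + y) 0; first by left.
have [x0|x0] := eqVneq x 0; first by rewrite x0 add0r.
have [y0|y0] := eqVneq y 0; first by rewrite y0 addr0.
right; apply: le_trans (val_D x0 y0 xy0).
by rewrite le_min (pidealE x0 hx) (pidealE y0 hy).
Qed.

Lemma pidealN k x : pideal k (- x) <-> pideal k x.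
Proof.
suff H y : pideal k y -> pideal k (- y) by split => /H; rewrite ?opprK.
by move=> [->|h]; [left; rewrite oppr0|right; rewrite valN].
Qed.

Lemma pidealB k x y : pideal k x -> pideal k y -> pideal k (x - y).
Proof. by move=> hx hy; apply: pidealD => //; apply/pidealN. Qed.

Lemma pidealBC k x y : pideal k (x - y) <-> pideal k (y - x).
Proof. by rewrite -opprB pidealN. Qed.

Lemma pidealM k l x y : pideal k x -> pideal l y -> pideal (k + l) (x * y).
Proof.
move=> hx hy.
have [x0|x0] := eqVneq x 0; first by left; rewrite x0 mul0r.
have [y0|y0] := eqVneq y 0; first by left; rewrite y0 mulr0.
by right; rewrite val_M // lerD // (pidealE x0, pidealE y0).
Qed.

Lemma pidealM_eq k x y : x != 0 -> pideal (k + val_ x) (x * y) <-> pideal k y.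
Proof.
move=> x0; have hx (l : int) : val_ x = l -> pideal l x by move=> <-; right.
split=> [h|h]; last by rewrite addrC; apply: pidealM => //; apply: hx.
have -> : y = x^-1 * (x * y) by rewrite mulrA mulVf // mul1r.
have -> : k = - val_ x + (k + val_ x) by lia.
by apply: pidealM => //; right; rewrite valV.
Qed.

Lemma pideal_sum k (I : Type) (s : seq I) (P : pred I) (h : I -> F) :
  (forall i, P i -> pideal k (h i)) -> pideal k (\sum_(i <- s | P i) h i).
Proof. by move=> H; apply: big_ind => //; [exact: pideal0|exact: pidealD]. Qed.

Lemma Oint1 : Oint (1 : F). Proof. by right; rewrite val_1. Qed.

Lemma OintM x y : Oint x -> Oint y -> Oint (x * y).
Proof. by move=> hx hy; have := pidealM hx hy; rewrite addr0. Qed.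

Lemma Oint_prod (I : Type) (s : seq I) (P : pred I) (h : I -> F) :
  (forall i, P i -> Oint (h i)) -> Oint (\prod_(i <- s | P i) h i).
Proof. by move=> H; apply: big_ind => //; [exact: Oint1|exact: OintM]. Qed.

Lemma OintX x n : Oint x -> Oint (x ^+ n).
Proof.
by move=> hx; elim: n => [|n IH]; [exact: Oint1|rewrite exprS; apply: OintM].
Qed.

Lemma pidealMr k x y : pideal k x -> Oint y -> pideal k (x * y).
Proof. by move=> hx hy; rewrite -[k]addr0; apply: pidealM. Qed.

Lemma pidealMl k x y : Oint x -> pideal k y -> pideal k (x * y).
Proof. by move=> hx hy; rewrite mulrC; apply: pidealMr. Qed.

Lemma Ounit_Oint x : Ounit x -> Oint x.
Proof. by move=> [_ e]; right; rewrite e. Qed.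

Lemma Ounit_neq0 x : Ounit x -> x != 0. Proof. by case. Qed.

Lemma Ounit1 : Ounit (1 : F). Proof. by split; [exact: oner_neq0|exact: val_1]. Qed.

Lemma OunitN x : Ounit x -> Ounit (- x).
Proof. by move=> [x0 e]; split; rewrite ?oppr_eq0 ?valN. Qed.

Lemma OunitV x : Ounit x -> Ounit x^-1.
Proof. by move=> [x0 e]; split; rewrite ?invr_eq0 // valV // e oppr0. Qed.

Lemma OunitM x y : Ounit x -> Ounit y -> Ounit (x * y).
Proof.
by move=> [x0 ex] [y0 ey]; split; rewrite ?mulf_neq0 // val_M // ex ey addr0.
Qed.

Lemma Ounit_prod (I : Type) (s : seq I) (P : pred I) (h : I -> F) :
  (forall i, P i -> Ounit (h i)) -> Ounit (\prod_(i <- s | P i) h i).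
Proof. by move=> H; apply: big_ind => //; [exact: Ounit1|exact: OunitM]. Qed.

Lemma OunitP x : Ounit x <-> Oint x /\ ~ pideal 1 x.
Proof.
split=> [[x0 e]|[hx hn]].
  by split; [right; rewrite e|move=> /(pidealE x0); rewrite e].
have x0 : x != 0 by apply/eqP => e; apply: hn; left.
split=> //; apply/eqP; rewrite eq_le (pidealE x0 hx) andbT.
by rewrite leNgt; apply/negP => h; apply: hn; right; lia.
Qed.

Lemma OunitMP x y : Oint x -> Oint y -> Ounit (x * y) -> Ounit x /\ Ounit y.
Proof.
move=> hx hy hxy.
have := Ounit_neq0 hxy; rewrite mulf_eq0 negb_or => /andP[x0 y0].
case: hxy => _; rewrite val_M // => e.
by have := pidealE x0 hx; have := pidealE y0 hy; split; split => //; lia.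
Qed.

Lemma Ounit_congr x y : pideal 1 (x - y) -> Ounit x <-> Ounit y.
Proof.
suff H z t : pideal 1 (z - t) -> Ounit z -> Ounit t.
  by move=> h; split; apply: H => //; apply/pidealBC.
move=> h /OunitP[hz nz]; apply/OunitP; split.
  have -> : t = z - (z - t) by ring.
  by apply: pidealB => //; apply: le_pideal h.
move=> ht; apply: nz; have -> : z = (z - t) + t by ring.
exact: pidealD.
Qed.

Lemma principalE (f : F) : f != 0 -> principal f = pideal (val_ f).
Proof.
move=> f0; apply/seteqP; split=> x.
  by move=> [y hy <-]; have := (pidealM_eq 0 y f0).2 hy; rewrite add0r.
move=> h; exists (f^-1 * x); last by rewrite mulrA divff // mul1r.
by apply/(pidealM_eq _ _ f0); rewrite add0r mulrA divff // mul1r.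
Qed.

End Valuation.

(** * Finite systems of residues *)

(** A finite set of representatives for the integral elements of [E] up to a
    congruence.  It carries no algebraic structure: all changes of variables are
    carried out on the representatives, in [F] or in matrices over [F], and then
    reduced, so that the residue ring itself is never needed. *)
Record approx (E : Type) (int : E -> Prop) (cong : E -> E -> Prop) := Approx {
  res :> finType;
  rlift : res -> E;
  red : E -> res;
  rlift_int : forall t, int (rlift t);
  redK : forall x, int x -> cong (rlift (red x)) x;
  rlift_inj : forall s t, cong (rlift s) (rlift t) -> s = t }.
Arguments rlift {E int cong} _ _.
Arguments red {E int cong} _ _.

Definition respects (E V : Type) (int : E -> Prop) (cong : E -> E -> Prop)
  (phi : E -> V) := forall x y, int x -> int y -> cong x y -> phi x = phi y.

(** A map that is injective modulo the congruence permutes the residues, since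
    these are finite in number; so no inverse of [h] has to be exhibited. *)
Lemma sum_reindex (E : Type) (int : E -> Prop) (cong : E -> E -> Prop)
    (V : nmodType) (T : approx int cong) (h : E -> E) (phi : E -> V) :
  (forall x y, cong x y -> cong y x) ->
  (forall x y z, cong x y -> cong y z -> cong x z) ->
  (forall x, int x -> int (h x)) ->
  (forall x y, int x -> int y -> cong (h x) (h y) -> cong x y) ->
  respects int cong phi ->
  \sum_(t : T) phi (h (rlift T t)) = \sum_(t : T) phi (rlift T t).
Proof.
move=> csym ctrans hint hinj per.
have inj : injective (fun t => red T (h (rlift T t))).
  move=> s t /= e; apply: (@rlift_inj _ _ _ T); apply: hinj; try exact: rlift_int.
  apply: ctrans (redK T (hint _ (rlift_int t))).
  rewrite -e; apply: csym; apply: redK; apply: hint; exact: rlift_int.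
rewrite [RHS](reindex_inj inj) /=; apply: eq_bigr => t _; apply: per.
- apply: hint; exact: rlift_int.
- exact: rlift_int.
- apply: csym; apply: redK; apply: hint; exact: rlift_int.
Qed.

Section Residues.
Context {F : localField}.
Implicit Types (x y z : F) (l k : nat).

Definition congr_mod (l : int) (x y : F) : Prop := pideal l (x - y).

Lemma congr_sym (l : int) x y : congr_mod l x y -> congr_mod l y x.
Proof. by move=> /pidealBC. Qed.

Lemma congr_trans (l : int) x y z :
  congr_mod l x y -> congr_mod l y z -> congr_mod l x z.
Proof.
move=> h1 h2; rewrite /congr_mod.
have -> : x - z = (x - y) + (y - z) by ring.
exact: pidealD.
Qed.

Notation residues F l := (approx (@Oint F) (congr_mod (Posz l))) (only parsing).
Definition resnorm : nat := absnorm (pideal 1 : set F).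

Lemma residues1 : exists T : residues F 1, #|T| = resnorm.
Proof.
set S := cosets (Oint : set F) (pideal 1).
have finS : finite_set S by exact: val_residue.
have cosS x : Oint x -> S [set x + y | y in pideal 1] by move=> hx; exists x.
have S0 : [set (0 : F) + y | y in pideal 1] \in fset_set S.
  by rewrite in_fset_set // inE; apply: cosS; exact: pideal0.
pose d : fset_set S := [` S0 ]%fset.
pose lf (X : fset_set S) : F := xget 0 (val X).
pose rd (x : F) : fset_set S := insubd d [set x + y | y in pideal 1].
have lfP (X : fset_set S) : (val X) (lf X) /\
    val X = [set lf X + y | y in pideal 1] /\ Oint (lf X).
  have : val X \in fset_set S by exact: valP.
  rewrite in_fset_set // inE => -[x hx eX].
  have hX : val X (lf X).
    by rewrite /lf; apply: (xgetPex 0); rewrite -eX; exists (x + 0);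
      exists 0 => //; exact: pideal0.
  have [y hy ey] : [set x + y | y in pideal 1] (lf X) by rewrite eX.
  split=> //; split.
    rewrite -eX -ey; apply/seteqP; split=> t [z hz <-].
      exists (z - y); first exact: pidealB.
      by ring.
    exists (y + z); first exact: pidealD.
    by ring.
  by rewrite -ey; apply: pidealD => //; apply: le_pideal hy.
have h1 t : Oint (lf t) by have [_ []] := lfP t.
have h2 x : Oint x -> congr_mod 1 (lf (rd x)) x.
  move=> hx; have [hv [_ _]] := lfP (rd x).
  rewrite /rd val_insubd in_fset_set // mem_set in hv; last exact: cosS.
  case: hv => y hy e; rewrite /congr_mod /rd -e.
  by have -> : x + y - x = y by ring.
have h3 s t : congr_mod 1 (lf s) (lf t) -> s = t.
  move=> h; apply: val_inj; have [_ [-> _]] := lfP s; have [_ [-> _]] := lfP t.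
  apply/seteqP; split=> z [y hy <-].
    exists (lf s - lf t + y); first exact: pidealD.
    by ring.
  exists (lf t - lf s + y); first by apply: pidealD => //; apply: congr_sym.
  by ring.
by exists (Approx h1 h2 h3); rewrite /= -cardfE.
Qed.

Variable varpi : F.
Hypothesis varpi_prime : prime_elt varpi.
Let varpi0 : varpi != 0. Proof. by case: varpi_prime. Qed.
Let val_varpi : val_ varpi = 1. Proof. by case: varpi_prime. Qed.

Lemma val_varpiX k : val_ (varpi ^+ k) = k.
Proof. by rewrite exprnP valX // val_varpi mulr1. Qed.

(** One more digit at a time: [x = s + varpi y] with [s] modulo [p]. *)
Lemma residues_exist l : exists T : residues F l, #|T| = (resnorm ^ l)%N.
Proof.
elim: l => [|l [T cT]].
  have h1 (t : unit) : Oint (0 : F) by exact: pideal0.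
  have h2 x : Oint x -> congr_mod 0%:Z 0 x.
    by move=> hx; rewrite /congr_mod sub0r; apply/pidealN.
  have h3 (s t : unit) : congr_mod 0%:Z (0 : F) 0 -> s = t by case: s; case: t.
  exists (@Approx _ _ _ unit (fun=> 0) (fun=> tt) h1 h2 h3).
  by rewrite /= card_unit expn0.
have [S cS] := residues1.
pose lf (st : S * T) := rlift S st.1 + varpi * rlift T st.2.
pose rd x := let s := red S x in (s, red T ((x - rlift S s) / varpi)).
have iv : Oint varpi by right; rewrite val_varpi.
have h1 t : Oint (lf t).
  apply: pidealD; first exact: rlift_int.
  by apply: OintM => //; apply: rlift_int.
have h2 x : Oint x -> congr_mod l.+1 (lf (rd x)) x.
  move=> hx; rewrite /rd /lf /=; set s := red S x.
  have hs : congr_mod 1 (rlift S s) x by exact: redK.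
  set y := (x - rlift S s) / varpi.
  have ey : x = rlift S s + varpi * y.
    by rewrite /y mulrCA divff // mulr1 addrC subrK.
  have hy : Oint y.
    apply/(pidealM_eq 0 _ varpi0); rewrite val_varpi add0r.
    have -> : varpi * y = x - rlift S s by rewrite ey; ring.
    exact: congr_sym.
  rewrite /congr_mod ey.
  have -> : rlift S s + varpi * rlift T (red T y) - (rlift S s + varpi * y) =
     varpi * (rlift T (red T y) - y) by ring.
  have -> : (l.+1 : int) = l%:Z + val_ varpi by rewrite val_varpi; lia.
  apply/(pidealM_eq _ _ varpi0); exact: (redK T).
have h3 s t : congr_mod l.+1 (lf s) (lf t) -> s = t.
  case: s t => s1 s2 [t1 t2]; rewrite /lf /congr_mod /= => h.
  have e1 : s1 = t1.
    apply: (@rlift_inj _ _ _ S); rewrite /congr_mod.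
    have -> : rlift S s1 - rlift S t1 =
      (rlift S s1 + varpi * rlift T s2 - (rlift S t1 + varpi * rlift T t2))
      - varpi * (rlift T s2 - rlift T t2) by ring.
    apply: pidealB; first by apply: le_pideal h; lia.
    apply: pidealMr; first by right; rewrite val_varpi.
    by apply: pidealB; exact: rlift_int.
  rewrite e1 in h *; congr (_, _); apply: (@rlift_inj _ _ _ T).
  rewrite /congr_mod; apply/(pidealM_eq _ _ varpi0); rewrite val_varpi.
  have -> : varpi * (rlift T s2 - rlift T t2) =
      (rlift S t1 + varpi * rlift T s2 - (rlift S t1 + varpi * rlift T t2)) by ring.
  by apply: le_pideal h; lia.
by exists (Approx h1 h2 h3); rewrite /= card_prod cS cT expnS.
Qed.

Lemma card_residues l (T : residues F l) : #|T| = (resnorm ^ l)%N.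
Proof.
have [S <-] := residues_exist l.
have H (A B : residues F l) : (#|A| <= #|B|)%N.
  pose h a := red B (rlift A a).
  apply: (@leq_card _ _ h) => s t e; apply: (@rlift_inj _ _ _ A).
  apply: congr_trans (redK B (rlift_int t)).
  rewrite -[red _ _]e; apply: congr_sym; apply: redK; exact: rlift_int.
by apply/eqP; rewrite eqn_leq !H.
Qed.

Lemma resnorm_gt1 : (1 < resnorm)%N.
Proof.
have [T <-] := residues1.
have ne : red T 0 != red T 1.
  apply/eqP => e.
  have h : congr_mod 1 0 (1 : F).
    apply: congr_trans (redK T Oint1).
    rewrite -e; apply: congr_sym; apply: redK; exact: pideal0.
  move: h; rewrite /congr_mod sub0r => /pidealN /(pidealE (oner_neq0 _)).
  by rewrite val_1.
apply: (@leq_trans #|[set red T 0; red T 1]%SET|); first by rewrite cards2 ne.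
exact: max_card.
Qed.

(** The residues modulo [p^l] in the class of [z] modulo [p^b] are the
    [z + varpi^b s] with [s] modulo [p^(l - b)]. *)
Lemma card_congr l b (T : residues F l) z : (b <= l)%N -> Oint z ->
  #|[pred t : T | `[< congr_mod b%:Z (rlift T t) z >]]| = (resnorm ^ (l - b))%N.
Proof.
move=> bl hz; have [S <-] := residues_exist (l - b).
pose h (s : S) := red T (z + varpi ^+ b * rlift S s).
have vb0 : varpi ^+ b != 0 by rewrite expf_neq0.
have hint s : Oint (z + varpi ^+ b * rlift S s).
  apply: pidealD => //; apply: OintM (rlift_int s).
  by right; rewrite val_varpiX.
have hinj : injective h.
  move=> s t e; apply: (@rlift_inj _ _ _ S).
  apply/(pidealM_eq _ _ vb0); rewrite val_varpiX.
  have -> : (l - b)%N%:Z + b = l by lia.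
  have -> : varpi ^+ b * (rlift S s - rlift S t) =
    (z + varpi ^+ b * rlift S s) - (z + varpi ^+ b * rlift S t) by ring.
  apply: congr_trans (redK T (hint t)).
  rewrite -[red _ _]e; apply: congr_sym; apply: redK; exact: hint.
rewrite -(card_codom hinj); apply: eq_card => t; rewrite inE.
apply/asboolP/codomP => [ht|[s ->]].
  set y := (rlift T t - z) / varpi ^+ b.
  have ey : rlift T t = z + varpi ^+ b * y.
    by rewrite /y mulrCA divff // mulr1 addrC subrK.
  have hy : Oint y.
    apply/(pidealM_eq 0 _ vb0); rewrite val_varpiX add0r.
    by have -> : varpi ^+ b * y = rlift T t - z by rewrite ey; ring.
  exists (red S y); apply: (@rlift_inj _ _ _ T); apply: congr_sym.
  apply: congr_trans (redK T (hint _)) _.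
  rewrite ey /congr_mod.
  have -> : z + varpi ^+ b * rlift S (red S y) - (z + varpi ^+ b * y)
     = varpi ^+ b * (rlift S (red S y) - y) by ring.
  have -> : (l : int) = (l - b)%N%:Z + val_ (varpi ^+ b).
    by rewrite val_varpiX; lia.
  apply/(pidealM_eq _ _ vb0); exact: (redK S).
rewrite /congr_mod.
have -> : rlift T (h s) - z =
   (rlift T (h s) - (z + varpi ^+ b * rlift S s)) + varpi ^+ b * rlift S s by ring.
apply: pidealD; first by apply: (le_pideal (l := l)); [lia|apply: (redK T); exact: hint].
by apply: pidealMr (rlift_int s); right; rewrite val_varpiX.
Qed.

(** The substitution [t = c s].  Dividing by [c] maps the multiples of [c] modulo
    [p^l] onto the residues modulo [p^a], and all fibres have the same size by
    [card_congr]. *)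
Lemma sum_dilate (V : nmodType) l a k (T : residues F l) (S : residues F a)
    (c : F) (phi : F -> V) :
  c != 0 -> val_ c = k -> (k + a <= l)%N ->
  respects Oint (congr_mod a%:Z) phi ->
  \sum_(t : T | `[< pideal k (rlift T t) >]) phi (rlift T t / c) =
  (\sum_(s : S) phi (rlift S s)) *+ (resnorm ^ (l - (k + a))).
Proof.
move=> c0 vc kal per.
have ci x : pideal k x -> Oint (x / c).
  move=> hx; apply/(pidealM_eq 0 _ c0).
  by rewrite vc add0r mulrCA divff // mulr1.
have cI : Oint c by right; rewrite vc.
rewrite (partition_big (fun t => red S (rlift T t / c)) xpredT) //= -sumrMnl.
apply: eq_bigr => s _.
rewrite -(card_congr T (b := k + a) (z := c * rlift S s)) //; last first.
  by apply: OintM => //; apply: rlift_int.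
rewrite -sumr_const.
apply: eq_big => [t|t /andP[/asboolP ht /eqP <-]]; last first.
  apply: per; [exact: ci|exact: rlift_int|apply: congr_sym; apply: redK; exact: ci].
rewrite !inE; apply/andP/asboolP => [[/asboolP h /eqP <-]|h].
  rewrite /congr_mod.
  have -> : rlift T t - c * rlift S (red S (rlift T t / c)) =
     c * (rlift T t / c - rlift S (red S (rlift T t / c))).
    by rewrite mulrBr mulrCA divff // mulr1.
  have -> : (k + a)%N%:Z = a%:Z + val_ c by rewrite vc; lia.
  apply/(pidealM_eq _ _ c0); apply: congr_sym; apply: (redK S); exact: ci.
have hk : pideal k (rlift T t).
  rewrite -(subrK (c * rlift S s) (rlift T t)); apply: pidealD.
    by apply: le_pideal h; lia.
  by apply: pidealMr (rlift_int s); right; rewrite vc.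
split; first exact/asboolP.
apply/eqP/(@rlift_inj _ _ _ S); apply: congr_trans (redK S (ci _ hk)) _.
apply/(pidealM_eq _ _ c0); rewrite vc mulrBr mulrCA divff // mulr1.
by apply: le_pideal h; lia.
Qed.

End Residues.
Notation residues F l := (approx (@Oint F) (@congr_mod F (Posz l))).
Arguments resnorm F : clear implicits.

(** * Gauss sums *)

Section Cosets.
Context {F : localField}.
Variables (a : nat) (f : F).
Hypotheses (f0 : f != 0) (vf : val_ f = a).

Definition coset_mod (x : F) : set F := [set x + y | y in principal f].

Lemma coset_modP x y : coset_mod x = coset_mod y <-> congr_mod a x y.
Proof.
rewrite /coset_mod principalE // vf; split=> [e|h].
  have [z hz ez] : [set y + z | z in pideal a] x.
    by rewrite -e; exists 0; [exact: pideal0|rewrite addr0].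
  by rewrite /congr_mod -ez; have -> : y + z - y = z by ring.
apply/seteqP; split=> t [z hz <-].
  by exists (x - y + z); [exact: pidealD|ring].
by exists (y - x + z); [apply: pidealD => //; exact: congr_sym|ring].
Qed.

Lemma xget_coset x : congr_mod a (xget 0 (coset_mod x)) x.
Proof.
have [z] : coset_mod x (xget 0 (coset_mod x)).
  apply: (xgetPex 0); exists (x + 0); exists 0 => //.
  by rewrite principalE //; exact: pideal0.
rewrite principalE // vf /congr_mod => hz <-.
by have -> : x + z - x = z by ring.
Qed.

Lemma absnorm_principal (S : residues F a) : absnorm (principal f) = #|S|.
Proof.
rewrite /absnorm.
have -> : cosets (@Oint F) (principal f) =
    [set` seq_fset tt [seq coset_mod (rlift S s) | s <- enum (res S)]].
  have hE Y : [set` seq_fset tt [seq coset_mod (rlift S s) | s <- enum (res S)]] Y =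
      (Y \in [seq coset_mod (rlift S s) | s <- enum (res S)]).
    by rewrite /mkset seq_fsetE.
  apply/seteqP; split=> Y; rewrite hE.
    move=> [x hx <-]; apply/mapP; exists (red S x); first by rewrite mem_enum.
    by apply/coset_modP; apply: congr_sym; apply: (redK S).
  by move=> /mapP[s _ ->]; exists (rlift S s) => //; exact: (rlift_int s).
rewrite set_fsetK size_seq_fset undup_id; first by rewrite size_map -cardE.
rewrite map_inj_uniq ?enum_uniq // => s t /coset_modP; exact: rlift_inj.
Qed.

Lemma sum_coset_units (V : nmodType) (S : residues F a) (h : F -> V) :
  (0 < a)%N ->
  (forall x y, Ounit x -> Ounit y -> congr_mod a x y -> h x = h y) ->
  \sum_(X \in cosets (@Ounit F) (principal f)) h (xget 0 X) =
  \sum_(s : S | `[< Ounit (rlift S s) >]) h (rlift S s).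
Proof.
move=> a0 hper; pose P := [set s : S | Ounit (rlift S s)].
have un (x y : F) : congr_mod a x y -> Ounit x -> Ounit y.
  move=> e hx; have e1 : congr_mod 1 y x.
    by apply: congr_sym; apply: le_pideal e; lia.
  exact/(Ounit_congr e1).
have bij : set_bij P (cosets (@Ounit F) (principal f)) (fun s => coset_mod (rlift S s)).
  split=> [s hs|s t _ _ /coset_modP|X [x hx <-]] /=.
  - by exists (rlift S s).
  - exact: rlift_inj.
  - have e : congr_mod a (rlift S (red S x)) x by apply: redK; exact: Ounit_Oint.
    exists (red S x); last by apply/coset_modP.
    exact: (un x _ (congr_sym e) hx).
rewrite (reindex_fsbig _ _ _ _ bij) [RHS]big_mkcond /= -[RHS]big_enum.
rewrite -[RHS]big_mkcond -[RHS]big_filter.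
rewrite [RHS]fsbig_seq; last by apply: filter_uniq; exact: enum_uniq.
have -> : [set` [seq i <- enum (res S) | `[< Ounit (rlift S i) >]]] = P.
  apply/seteqP; split=> s /=; rewrite mem_filter mem_enum inE andbT.
    by move=> /asboolP.
  by move=> hs; apply/asboolP.
apply: eq_fsbigr => s /set_mem hs; apply: hper => //; last exact: xget_coset.
apply: un hs; apply: congr_sym; exact: xget_coset.
Qed.

End Cosets.

Lemma sum_reindex_res (F : localField) (l : nat) (V : nmodType) (T : residues F l)
    (h : F -> F) (phi : F -> V) :
  (forall x, Oint x -> Oint (h x)) ->
  (forall x y, congr_mod l (h x) (h y) -> congr_mod l x y) ->
  respects Oint (congr_mod l) phi ->
  \sum_(t : T) phi (h (rlift T t)) = \sum_(t : T) phi (rlift T t).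
Proof.
move=> h1 h2; apply: sum_reindex => // *; first exact: congr_sym.
  apply: congr_trans; eassumption.
exact: h2.
Qed.

Section GaussSums.
Context {R : realType} {F : localField}.
Local Notation C := R[i].
Variables (psi X : F -> C) (f : F) (a : nat).
Hypotheses (psi_add : additive_character psi) (psiO : has_conductor_O psi).
Hypotheses (f0 : f != 0) (vf : val_ f = a) (a_gt0 : (0 < a)%N).
Hypotheses (Xneq0 : forall x : F, x != 0 -> X x != 0)
  (XM : forall x y : F, x != 0 -> y != 0 -> X (x * y) = X x * X y)
  (Xcond : is_conductor X (principal f)).

Lemma psiD x y : psi (x + y) = psi x * psi y.
Proof. by case: psi_add. Qed.

Lemma psi_neq0 x : psi x != 0. Proof. by case: psi_add. Qed.

Lemma psi_Oint x : Oint x -> psi x = 1. Proof. by case: psiO => + _; apply. Qed.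

Lemma psi_congr x y : congr_mod 0 x y -> psi x = psi y.
Proof.
by move=> h; rewrite -(subrK y x) psiD psi_Oint // mul1r.
Qed.

Lemma psi_pole : exists2 z, pideal (-1) z & psi z != 1.
Proof.
case: psiO => _ /existsNP[z] /not_implyP[h1 h2].
by exists z => //; apply/eqP.
Qed.

Lemma X_congr x y : Ounit x -> Ounit y -> congr_mod a x y -> X x = X y.
Proof.
move=> hx hy h; have y0 := Ounit_neq0 hy; have x0 := Ounit_neq0 hx.
have hq : Ounit (x / y) by apply: OunitM => //; exact: OunitV.
have -> : X x = X (x / y) * X y by rewrite -XM ?divfK // Ounit_neq0.
case: Xcond => _ /(_ (x / y) hq) -> //; first by rewrite mul1r.
rewrite principalE // vf.
have -> : x / y - 1 = (x - y) * y^-1 by rewrite mulrBl divff.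
by apply: pidealMr => //; apply: Ounit_Oint; exact: OunitV.
Qed.

(** Otherwise [X] would be trivial modulo [p^(a-1)], which is not contained in
    the conductor. *)
Lemma X_nontrivial : exists u, [/\ Ounit u, pideal (a%:Z - 1) (u - 1) & X u != 1].
Proof.
apply: contrapT => hn.
have tr : trivial_mod X (pideal (a%:Z - 1)).
  move=> u hu h; apply: contrapT => hX; apply: hn; exists u; split => //.
  exact/eqP.
have id : is_ideal (pideal (a%:Z - 1) : set F).
  split; [move=> x h|exact: pideal0|exact: pidealD|exact: pidealMl].
  by apply: le_pideal h; lia.
case: Xcond => _ _ /(_ _ id tr); rewrite principalE // vf => sub.
have [p p0 vp] := val_onto F.
have vfp : val_ (f / p) = a%:Z - 1 by rewrite val_M ?invr_eq0 // valV // vf vp.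
have fp0 : f / p != 0 by rewrite mulf_neq0 // invr_eq0.
have /sub /(pidealE fp0) : pideal (a%:Z - 1) (f / p) by right; rewrite vfp.
by rewrite vfp; lia.
Qed.

Variables (l : nat) (T : residues F l) (S : residues F a).
Hypothesis al : (a <= l)%N.

(** Non-units are sent to 0, so that the sums run over all residues and products
    of such sums in several variables expand without side conditions. *)
Definition gauss_term (y t : F) : C :=
  if `[< Ounit t >] then X t * psi (y * t / f) else 0.

Lemma gauss_sumE :
  gauss_sum psi X f = \sum_(s : S) gauss_term 1 (rlift S s).
Proof.
rewrite /gauss_sum (sum_coset_units f0 vf S (h := fun x => X x * psi (x / f))) //.
  by rewrite big_mkcond; apply: eq_bigr => s _; rewrite /gauss_term mul1r.
move=> x y hx hy h; rewrite (X_congr hx hy h); congr (_ * _); apply: psi_congr.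
by rewrite /congr_mod -mulrBl; apply/(pidealM_eq _ _ f0); rewrite mulrCA divff // mulr1 vf add0r.
Qed.

Lemma gauss_term_per y b : (0 < b)%N -> (a <= b)%N -> pideal (a%:Z - b%:Z) y ->
  respects Oint (congr_mod b) (gauss_term y).
Proof.
move=> b0 ab hy s t hs ht st.
have st1 : congr_mod 1 s t by apply: le_pideal st; lia.
have sta : congr_mod a s t by apply: le_pideal st; lia.
rewrite /gauss_term; case: asboolP => us; case: asboolP => ut //; last 2 first.
- by case: ut; apply/(Ounit_congr st1).
- by case: us; apply/(Ounit_congr st1).
rewrite (X_congr us ut sta); congr (_ * _); apply: psi_congr.
rewrite /congr_mod -mulrBl -mulrBr; apply/(pidealM_eq _ _ f0).
rewrite mulrCA divff // mulr1 vf.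
by rewrite (_ : 0 + a%:Z = (a%:Z - b%:Z) + b); [exact: pidealM|lia].
Qed.

(** Substitute [y^-1 t] for [t], then pass from level [l] to level [a]. *)
Lemma gauss_term_sum_unit y : Ounit y ->
  \sum_(t : T) gauss_term y (rlift T t) =
  (X y)^-1 * ((resnorm F ^ (l - a))%:R * gauss_sum psi X f).
Proof.
move=> uy; have y0 := Ounit_neq0 uy.
have per1 b : (0 < b)%N -> (a <= b)%N -> respects Oint (congr_mod b) (gauss_term 1).
  by move=> *; apply: gauss_term_per => //; right; rewrite val_1; lia.
have [p p0 vp] := val_onto F.
have := @sum_dilate _ p (conj p0 vp) _ l a 0 T S 1 (gauss_term 1) (oner_neq0 _).
rewrite val_1 => /(_ erefl al (per1 a a_gt0 (leqnn a))).
rewrite add0n -gauss_sumE => e; rewrite mulr_natl -e {e}.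
rewrite mulr_sumr.
have e1 : \sum_(t : T) gauss_term 1 (y * rlift T t) = \sum_(t : T) gauss_term 1 (rlift T t).
  apply: (sum_reindex_res T (h := *%R y)); last by apply: per1; lia.
    by move=> x hx; apply: OintM => //; exact: Ounit_Oint.
  by move=> x z; rewrite /congr_mod -mulrBr => h;
    apply/(pidealM_eq _ _ y0); case: uy => _ ->; rewrite addr0.
rewrite [RHS](eq_bigl xpredT) => [|t]; last by apply/asboolP; exact: (rlift_int t).
under [RHS]eq_bigr => t _ do rewrite divr1.
rewrite -mulr_sumr -e1 mulr_sumr; apply: eq_bigr => t _; rewrite /gauss_term.
have ut : Ounit (y * rlift T t) <-> Ounit (rlift T t).
  split=> [h|h]; last exact: OunitM.
  by have [] := OunitMP (Ounit_Oint uy) (rlift_int t) h.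
case: asboolP => h1; case: asboolP => h2; rewrite ?mulr0 //.
- by rewrite mul1r XM ?Ounit_neq0 // !mulrA mulVf ?mul1r // Xneq0.
- by case: h2; apply/ut.
- by case: h1; apply/ut.
Qed.

(** In both cases a substitution multiplies the sum by a constant other than 1.
    If [y] lies in [p], then [psi (y t / f)] does not change when [t] is multiplied
    by a unit congruent to 1 modulo [p^(a-1)], and [X] is not trivial on these.  If
    [y] is not integral, then [X] does not change when [t] is translated by a
    suitable multiple of [f], which multiplies [psi (y t / f)] by a value of [psi]
    on [p^-1]. *)
Lemma gauss_term_sum0 y : pideal (a%:Z - l%:Z) y -> ~ Ounit y ->
  \sum_(t : T) gauss_term y (rlift T t) = 0.
Proof.
move=> hy nuy; have l0 : (0 < l)%N by lia.
have per := gauss_term_per l0 al hy.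
have fix0 (c : C) : c != 1 -> forall s : C, s = c * s -> s = 0.
  move=> c1 s /eqP; rewrite -subr_eq0 -{1}(mul1r s) -mulrBl mulf_eq0.
  by rewrite subr_eq0 eq_sym (negbTE c1) => /eqP.
have [y1|y1] := pselect (pideal 1 y).
  have [u [uu hu Xu]] := X_nontrivial; apply: (fix0 (X u)) => //.
  rewrite mulr_sumr -(sum_reindex_res (h := *%R u) T _ _ per); last 2 first.
  - by move=> t ht; apply: OintM => //; exact: Ounit_Oint.
  - move=> s t; rewrite /congr_mod -mulrBr => h.
    by apply/(pidealM_eq _ _ (Ounit_neq0 uu)); case: uu => _ ->; rewrite addr0.
  apply: eq_bigr => t _; rewrite /gauss_term.
  have ht := rlift_int t; set x := rlift T t in ht *.
  have [ux|nx] := pselect (Ounit x); last first.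
    rewrite !asboolF ?mulr0 // => h; apply: nx.
    by have [] := OunitMP (Ounit_Oint uu) ht h.
  rewrite !asboolT //; last exact: OunitM.
  rewrite XM ?Ounit_neq0 // -mulrA; congr (_ * (_ * _)); apply: psi_congr.
  rewrite /congr_mod -mulrBl; apply/(pidealM_eq _ _ f0).
  rewrite mulrCA divff // mulr1 vf.
  have -> : y * (u * x) - y * x = y * (u - 1) * x by ring.
  apply: pidealMr => //.
  by rewrite (_ : 0 + a%:Z = 1 + (a%:Z - 1)); [exact: pidealM|lia].
have y0 : y != 0 by apply/eqP => e; apply: y1; left.
have vy : val_ y < 0.
  rewrite ltNge; apply/negP => h; apply: nuy; split=> //.
  apply/eqP; rewrite eq_le h andbT leNgt; apply/negP => h'; apply: y1.
  by right; lia.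
have [z hz psiz] := psi_pole; apply: (fix0 (psi z)) => //.
(* Translating [t] by [d] multiplies [psi (y t / f)] by [psi z]. *)
pose d := z * f / y.
have hd : pideal a d.
  rewrite (_ : a%:Z = -1 + a%:Z + 1); last by lia.
  apply: pidealM; first by apply: pidealM => //; right; rewrite vf.
  by right; rewrite valV //; lia.
rewrite mulr_sumr -(sum_reindex_res (h := fun t => t + d) T _ _ per); last 2 first.
- by move=> t ht; apply: pidealD => //; apply: le_pideal hd.
- by move=> s t; rewrite /congr_mod (_ : s + d - (t + d) = s - t) //; ring.
apply: eq_bigr => t _; rewrite /gauss_term; set x := rlift T t.
have xd : congr_mod a (x + d) x by rewrite /congr_mod addrAC subrr add0r.
have xd1 : congr_mod 1 (x + d) x by apply: le_pideal xd; lia.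
have [ux|nx] := pselect (Ounit x); last first.
  by rewrite !asboolF ?mulr0 // => h; apply: nx; apply/(Ounit_congr xd1).
have uxd : Ounit (x + d) by apply/(Ounit_congr xd1).
rewrite !asboolT // (X_congr uxd ux xd).
have -> : y * (x + d) / f = z + y * x / f by rewrite /d; field; rewrite y0 f0.
by rewrite psiD mulrCA.
Qed.

End GaussSums.

(** * Integral matrices and the Iwahori subgroup *)

Section IntegralMatrices.
Context {F : localField}.
Implicit Types (m n p : nat).

Definition Mint m n (A : 'M[F]_(m, n)) : Prop := forall i j, Oint (A i j).
Definition Mcongr (l : int) m n (A B : 'M[F]_(m, n)) : Prop :=
  forall i j, congr_mod l (A i j) (B i j).
Definition GLO n (A : 'M[F]_n) : Prop := Mint A /\ Ounit (\det A).

Lemma MintM m n p (A : 'M[F]_(m, n)) (B : 'M[F]_(n, p)) :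
  Mint A -> Mint B -> Mint (A *m B).
Proof. by move=> hA hB i j; rewrite mxE; apply: pideal_sum => k _; exact: OintM. Qed.

Lemma Mint1 n : Mint (1%:M : 'M[F]_n).
Proof.
by move=> i j; rewrite mxE; case: eqP => _; [exact: Oint1|exact: pideal0].
Qed.

Lemma Mint_det n (A : 'M[F]_n) : Mint A -> Oint (\det A).
Proof.
move=> hA; apply: pideal_sum => s _; apply: OintM; last exact: Oint_prod.
by apply: OintX; apply/pidealN; exact: Oint1.
Qed.

Lemma Mcongr_sym l m n (A B : 'M[F]_(m, n)) : Mcongr l A B -> Mcongr l B A.
Proof. by move=> h i j; exact: congr_sym. Qed.

Lemma Mcongr_trans l m n (A B D : 'M[F]_(m, n)) :
  Mcongr l A B -> Mcongr l B D -> Mcongr l A D.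
Proof. by move=> h1 h2 i j; exact: congr_trans (h1 i j) (h2 i j). Qed.

Lemma le_Mcongr (k l : int) m n (A B : 'M[F]_(m, n)) :
  k <= l -> Mcongr l A B -> Mcongr k A B.
Proof. by move=> kl h i j; apply: le_pideal (h i j). Qed.

Lemma Mint_congr m n (A B : 'M[F]_(m, n)) : Mcongr 0 A B -> Mint A -> Mint B.
Proof.
move=> h hA i j; rewrite -(subKr (A i j) (B i j)).
exact: pidealB (hA i j) (h i j).
Qed.

Lemma Mcongr_mulr l m n p (A B : 'M[F]_(m, n)) (g : 'M[F]_(n, p)) :
  Mint g -> Mcongr l A B -> Mcongr l (A *m g) (B *m g).
Proof.
move=> hg h i j; rewrite !mxE /congr_mod -sumrB; apply: pideal_sum => k _.
by rewrite -mulrBl; exact: pidealMr (h i k) (hg k j).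
Qed.

Lemma Mcongr_mull l m n p (A B : 'M[F]_(n, p)) (g : 'M[F]_(m, n)) :
  Mint g -> Mcongr l A B -> Mcongr l (g *m A) (g *m B).
Proof.
move=> hg h i j; rewrite !mxE /congr_mod -sumrB; apply: pideal_sum => k _.
by rewrite -mulrBr; exact: pidealMl (hg i k) (h k j).
Qed.

Lemma congr_modM l (x y z t : F) : Oint y -> Oint z ->
  congr_mod l x y -> congr_mod l z t -> congr_mod l (x * z) (y * t).
Proof.
move=> hy hz h1 h2; rewrite /congr_mod.
have -> : x * z - y * t = (x - y) * z + y * (z - t) by ring.
by apply: pidealD; [exact: pidealMr|exact: pidealMl].
Qed.

Lemma congr_mod_refl l (x : F) : congr_mod l x x.
Proof. by rewrite /congr_mod subrr; exact: pideal0. Qed.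

Lemma Mcongr_det l n (A B : 'M[F]_n) : Mint A -> Mint B ->
  Mcongr l A B -> congr_mod l (\det A) (\det B).
Proof.
move=> hA hB h; rewrite /congr_mod -sumrB; apply: pideal_sum => s _.
rewrite -mulrBr; apply: pidealMl.
  by apply: OintX; apply/pidealN; exact: Oint1.
suff [] : [/\ Oint (\prod_i A i (s i)), Oint (\prod_i B i (s i)) &
  congr_mod l (\prod_i A i (s i)) (\prod_i B i (s i))] by [].
apply: (big_ind2 (fun x y => [/\ Oint x, Oint y & congr_mod l x y])).
- by split; [exact: Oint1|exact: Oint1|exact: congr_mod_refl].
- by move=> x y z t [? ? ?] [? ? ?]; split; [exact: OintM|exact: OintM|exact: congr_modM].
- by move=> i _; split; [exact: hA|exact: hB|exact: (h i (s i))].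
Qed.

Lemma GLO_unitmx n (A : 'M[F]_n) : GLO A -> A \in unitmx.
Proof. by move=> [_ [d0 _]]; rewrite unitmxE unitfE. Qed.

Lemma GLO1 n : GLO (1%:M : 'M[F]_n).
Proof. by split; [exact: Mint1|rewrite det1; exact: Ounit1]. Qed.

Lemma GLOM n (A B : 'M[F]_n) : GLO A -> GLO B -> GLO (A *m B).
Proof.
move=> [hA dA] [hB dB]; split; first exact: MintM.
by rewrite det_mulmx; exact: OunitM.
Qed.

Lemma GLOV n (A : 'M[F]_n) : GLO A -> GLO (invmx A).
Proof.
move=> hA; have uA := GLO_unitmx hA; case: hA => hA dA.
split; last by rewrite det_inv; exact: OunitV.
move=> i j; rewrite /invmx uA !mxE.
apply: OintM; first exact/Ounit_Oint/OunitV.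
rewrite /cofactor; apply: OintM; first by apply: OintX; apply/pidealN; exact: Oint1.
by apply: Mint_det => k q; rewrite !mxE.
Qed.

Lemma GLO_congr n (A B : 'M[F]_n) : Mcongr 1 A B -> GLO A -> GLO B.
Proof.
move=> h [hA dA]; have hB : Mint B by apply: Mint_congr hA; exact: le_Mcongr h.
by split=> //; apply/(Ounit_congr (Mcongr_det hB hA (Mcongr_sym h))).
Qed.

Lemma iwahori_GLO n (r : 'M[F]_n) : iwahori r -> GLO r.
Proof. by case. Qed.

(** Modulo [p] the matrix is upper triangular, so the product of its diagonal
    entries is congruent to its determinant. *)
Lemma iwahori_diag n (r : 'M[F]_n) i : iwahori r -> Ounit (r i i).
Proof.
move=> [hr dr lr].
pose t : 'M[F]_n := \matrix_(i, j) if (j < i)%N then 0 else r i j.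
have ht : Mint t by move=> a b; rewrite mxE; case: ifP => _ //; exact: pideal0.
have rt : Mcongr 1 r t.
  move=> a b; rewrite mxE; case: ifP => h; last exact: congr_mod_refl.
  by rewrite /congr_mod subr0; exact: lr.
have := (Ounit_congr (Mcongr_det hr ht rt)).1 dr.
rewrite -det_tr det_trig; last first.
  by apply/is_trig_mxP => a b ab; rewrite !mxE ab.
rewrite (bigD1 i) //= !mxE ltnn => h.
have [] := OunitMP _ _ h => //; apply: Oint_prod => j _.
by rewrite mxE; exact: ht.
Qed.

Lemma iwahoriM n (r s : 'M[F]_n) : iwahori r -> iwahori s -> iwahori (r *m s).
Proof.
move=> ir is_; have [h1 h2] := GLOM (iwahori_GLO ir) (iwahori_GLO is_).
split=> // i j ji; case: ir => hr _ lr; case: is_ => hs _ ls.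
rewrite mxE; apply: pideal_sum => k _; have [ki|ik] := ltnP k i.
  by apply: pidealMr => //; exact: lr.
by apply: pidealMl => //; apply: ls; exact: leq_trans ik.
Qed.

(** The entries below the diagonal of the inverse [s] are treated column by column:
    in the vanishing entry [(i, j)] of [s r], all terms except [s_ij r_jj] lie in
    [p] by induction on [j], and [r_jj] is a unit. *)
Lemma iwahoriV n (r : 'M[F]_n) : iwahori r -> iwahori (invmx r).
Proof.
move=> ir; have [h1 h2] := GLOV (iwahori_GLO ir); split=> //.
have ur := GLO_unitmx (iwahori_GLO ir); have dg i := iwahori_diag i ir.
case: ir => hr _ lr i j; move: {2}(val j) (leqnn (val j)) => d.
elim: d j => [|d IH] j jd ji.
all: have /matrixP/(_ i j) := mulVmx ur; rewrite !mxE (bigD1 j) //= => e.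
all: have ij : (i == j) = false by apply/eqP => ij; rewrite ij ltnn in ji.
all: move: e; rewrite ij => /eqP; rewrite addr_eq0 => /eqP e.
all: have -> : invmx r i j = (invmx r i j * r j j) * (r j j)^-1
  by rewrite mulfK // Ounit_neq0.
all: apply: pidealMr; last exact/Ounit_Oint/OunitV.
all: rewrite e; apply/pidealN; apply: pideal_sum => k kj.
all: have [jk|kj'] := ltnP j k; first by apply: pidealMl => //; exact: lr.
all: have {kj'}kj' : (k < j)%N by rewrite ltn_neqAle kj' andbT; exact: kj.
  by move: kj'; rewrite ltnNge (leq_trans jd).
by apply: pidealMr => //; apply: IH; [rewrite -ltnS (leq_trans kj')|exact: ltn_trans ji].
Qed.

Lemma iwahori_congr n (r s : 'M[F]_n) : Mcongr 1 r s -> iwahori r -> iwahori s.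
Proof.
move=> h ir; have [h1 h2] := GLO_congr h (iwahori_GLO ir).
split=> // i j ji; case: ir => _ _ /(_ i j ji) hl.
by rewrite -(subKr (r i j) (s i j)); exact: pidealB hl (h i j).
Qed.

Lemma iwahori1 n : iwahori (1%:M : 'M[F]_n).
Proof.
have [h1 h2] := GLO1 n; split=> // i j ji; rewrite mxE.
by case: eqP => [e|_]; [rewrite e ltnn in ji|exact: pideal0].
Qed.

Lemma iwahori_mulrE n (r s : 'M[F]_n) : iwahori s -> iwahori (r *m s) <-> iwahori r.
Proof.
move=> hs; split=> [h|h]; last exact: iwahoriM.
rewrite -(mulmxK (GLO_unitmx (iwahori_GLO hs)) r).
by apply: iwahoriM => //; exact: iwahoriV.
Qed.

Lemma iwahori_diag_mx n (d : 'rV[F]_n) : (forall i, Ounit (d 0 i)) -> iwahori (diag_mx d).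
Proof.
move=> hd; split.
- move=> i j; rewrite mxE; case: eqP => _; last exact: pideal0.
  by rewrite mulr1n; exact: Ounit_Oint.
- by rewrite det_diag; exact: Ounit_prod.
- move=> i j ji; rewrite mxE; case: eqP => [e|_]; last exact: pideal0.
  by rewrite e ltnn in ji.
Qed.

Lemma Mint_block m n (A : 'M[F]_m) (B : 'M[F]_(m, n)) (D : 'M[F]_(n, m)) (E : 'M[F]_n) :
  Mint (block_mx A B D E) <-> [/\ Mint A, Mint B, Mint D & Mint E].
Proof.
split=> [h|[hA hB hD hE] i j].
  split=> i j.
  - by have := h (lshift n i) (lshift n j); rewrite block_mxEul.
  - by have := h (lshift n i) (rshift m j); rewrite block_mxEur.
  - by have := h (rshift m i) (lshift n j); rewrite block_mxEdl.
  - by have := h (rshift m i) (rshift m j); rewrite block_mxEdr.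
by rewrite -(fintype.splitK i) -(fintype.splitK j);
  case: (fintype.split i) => i'; case: (fintype.split j) => j' /=;
  rewrite (block_mxEul, block_mxEur, block_mxEdl, block_mxEdr).
Qed.

Lemma Mint_col_mx m1 m2 n (A : 'M[F]_(m1, n)) (B : 'M[F]_(m2, n)) :
  Mint A -> Mint B -> Mint (col_mx A B).
Proof.
move=> hA hB i j; rewrite -(fintype.splitK i); case: (fintype.split i) => k /=.
  by rewrite col_mxEu; exact: hA.
by rewrite col_mxEd; exact: hB.
Qed.

Lemma Mcongr_col_mx l m1 m2 n (A A' : 'M[F]_(m1, n)) (B : 'M[F]_(m2, n)) :
  Mcongr l A A' -> Mcongr l (col_mx A B) (col_mx A' B).
Proof.
move=> h i j; rewrite -(fintype.splitK i); case: (fintype.split i) => k /=.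
  by rewrite !col_mxEu; exact: h.
by rewrite !col_mxEd; exact: congr_mod_refl.
Qed.

Lemma iwahori_ublock m n (A : 'M[F]_m) (B : 'M[F]_(m, n)) (E : 'M[F]_n) :
  iwahori (block_mx A B 0 E) <-> [/\ iwahori A, Mint B & iwahori E].
Proof.
have h0 : Mint (0 : 'M[F]_(n, m)) by move=> i j; rewrite mxE; exact: pideal0.
split=> [[/Mint_block[hA hB _ hE] hd hl]|[[hA dA lA] hB [hE dE lE]]].
  rewrite det_ublock in hd; have [dA dE] := OunitMP (Mint_det hA) (Mint_det hE) hd.
  split=> //; split=> // i j ij.
    by have := hl (lshift n i) (lshift n j) ij; rewrite block_mxEul.
  have := hl (rshift m i) (rshift m j); rewrite block_mxEdr; apply.
  by rewrite /= ltn_add2l.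
split; first exact/Mint_block.
  by rewrite det_ublock; exact: OunitM.
move=> i j; rewrite -(fintype.splitK i) -(fintype.splitK j).
case: (fintype.split i) => i'; case: (fintype.split j) => j' /= ij.
- by rewrite block_mxEul; exact: lA.
- by move: ij; rewrite ltnNge (leq_trans (ltnW (ltn_ord i'))) ?leq_addr.
- by rewrite block_mxEdl mxE; exact: pideal0.
- by rewrite block_mxEdr; apply: lE; rewrite ltn_add2l in ij.
Qed.

End IntegralMatrices.

(** For [r] in the Iwahori subgroup, the coset of [r] modulo the principal
    congruence subgroup of level [l] is the set of matrices congruent to [r]
    modulo [p^l].  So an invariant function is additively periodic, and its sum
    over cosets becomes a sum over independent matrix entries. *)
Lemma respects_iwahori (F : localField) (V : nmodType) (l n : nat) (B : 'M[F]_n -> V) :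
  (0 < l)%N ->
  (forall r k, iwahori r -> Mcongr l k 1%:M -> B (r *m k) = B r) ->
  respects (@Mint F n n) (Mcongr l (n := n))
    (fun r => if `[< iwahori r >] then B r else 0).
Proof.
move=> l0 hB r r' _ _ h.
have h1 : Mcongr 1 r r' by apply: le_Mcongr h; lia.
case: asboolP => ir; case: asboolP => ir' //; last 2 first.
- by case: ir'; exact: iwahori_congr h1 ir.
- by case: ir; exact: iwahori_congr (Mcongr_sym h1) ir'.
have ur := iwahori_GLO ir; have uR := GLO_unitmx ur.
have -> : r' = r *m (invmx r *m r') by rewrite mulKVmx.
rewrite hB //.
have [hV _] := GLOV ur.
by have := Mcongr_mull hV h; rewrite mulVmx // => /Mcongr_sym.
Qed.

Section MatrixSums.
Context {F : localField} {l : nat} (T : residues F l) {V : nmodType}.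
Implicit Types (m n : nat).

Notation mlift := (map_mx (rlift T)).

Definition mx_approx m n : approx (@Mint F m n) (Mcongr l (n := n)).
Proof.
apply: (@Approx _ _ _ 'M[T]_(m, n) (map_mx (rlift T)) (map_mx (red T))).
- by move=> A i j; rewrite mxE; exact: rlift_int.
- by move=> A hA i j; rewrite !mxE; exact: redK.
- move=> A B h; apply/matrixP => i j; apply: (@rlift_inj _ _ _ T).
  by have := h i j; rewrite !mxE.
Defined.

Lemma mlift_int m n (M : 'M[T]_(m, n)) : Mint (mlift M).
Proof. exact: (@rlift_int _ _ _ (mx_approx m n)). Qed.

Lemma sum_mulr m n (g : 'M[F]_n) (phi : 'M[F]_(m, n) -> V) : GLO g ->
  respects (@Mint F m n) (Mcongr l (n := n)) phi ->
  \sum_(M : 'M[T]_(m, n)) phi (mlift M *m g) = \sum_(M : 'M[T]_(m, n)) phi (mlift M).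
Proof.
move=> hg hphi; have hV := GLOV hg.
apply: (@sum_reindex _ _ _ _ (mx_approx m n) (fun A => A *m g) phi) => //.
- by move=> *; exact: Mcongr_sym.
- by move=> *; apply: Mcongr_trans; eassumption.
- by move=> A hA; apply: MintM => //; case: hg.
- move=> A B hA hB h; rewrite -(mulmxK (GLO_unitmx hg) A) -(mulmxK (GLO_unitmx hg) B).
  by apply: Mcongr_mulr => //; case: hV.
Qed.

Lemma sum_col_mx (U : finType) m1 m2 n (h : 'M[U]_(m1 + m2, n) -> V) :
  \sum_(M : 'M[U]_(m1 + m2, n)) h M =
  \sum_(B : 'M[U]_(m2, n)) \sum_(A : 'M[U]_(m1, n)) h (col_mx A B).
Proof.
rewrite pair_bigA /= (reindex (fun p : 'M[U]_(m2, n) * 'M[U]_(m1, n) => col_mx p.2 p.1)) //=.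
exists (fun M => (dsubmx M, usubmx M)) => [[A B]|M] _ /=.
  by rewrite col_mxKu col_mxKd.
by rewrite vsubmxK.
Qed.

Lemma sum_row_mx (U : finType) m n1 n2 (h : 'M[U]_(m, n1 + n2) -> V) :
  \sum_(M : 'M[U]_(m, n1 + n2)) h M =
  \sum_(B : 'M[U]_(m, n2)) \sum_(A : 'M[U]_(m, n1)) h (row_mx A B).
Proof.
rewrite pair_bigA /= (reindex (fun p : 'M[U]_(m, n2) * 'M[U]_(m, n1) => row_mx p.2 p.1)) //=.
exists (fun M => (rsubmx M, lsubmx M)) => [[A B]|M] _ /=.
  by rewrite row_mxKl row_mxKr.
by rewrite hsubmxK.
Qed.

End MatrixSums.

Lemma sum_rV_prod (U : finType) (K : comNzRingType) n (h : 'I_n -> U -> K) :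
  \sum_(r : 'rV[U]_n) \prod_i h i (r 0 i) = \prod_i \sum_(t : U) h i t.
Proof.
rewrite bigA_distr_bigA (reindex (fun t : {ffun 'I_n -> U} => \row_i t i)) /=.
  by apply: eq_bigr => t _; apply: eq_bigr => i _; rewrite mxE.
exists (fun r : 'rV[U]_n => [ffun i => r 0 i]) => [t _|r _].
  by apply/ffunP => i; rewrite ffunE mxE.
by apply/matrixP => i j; rewrite mxE ffunE ord1.
Qed.

(** * The matrices of the Birch lemma *)

Section PidealMatrices.
Context {F : localField}.

Definition Mideal (k : int) m n (A : 'M[F]_(m, n)) : Prop :=
  forall i j, pideal k (A i j).

Lemma MidealM k l m n p (A : 'M[F]_(m, n)) (B : 'M[F]_(n, p)) :
  Mideal k A -> Mideal l B -> Mideal (k + l) (A *m B).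
Proof. by move=> hA hB i j; rewrite mxE; apply: pideal_sum => h _; exact: pidealM. Qed.

Lemma Mideal_congr k m n (A B : 'M[F]_(m, n)) : Mcongr k A B <-> Mideal k (A - B).
Proof. by split=> h i j; have := h i j; rewrite /congr_mod !mxE. Qed.

End PidealMatrices.

Section BirchMatrices.
Context {F : localField}.
Variable f : F.
Hypothesis f0 : f != 0.

(** The conjugate by [diag (1, f, f^2, ...)] of the lower triangular matrix whose
    entries on and below the diagonal are all 1. *)
Definition Kmx n : 'M[F]_n := \matrix_(i, j) (if (j <= i)%N then f ^+ (i - j) else 0).
Definition rhovec n : 'rV[F]_n := \row_j f ^+ (n - j).
(** The product [D_n w_n], see [Dmx_wmx]; it is given by its entries so that
    rewriting does not split it. *)
Definition DWmx n : 'M[F]_n :=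
  \matrix_(i, j) if (i + j).+1 == n then f ^ ((i.*2.+1)%:Z - n%:Z) else 0.

Lemma Dmx_wmx n : Dmx n f *m wmx F n = DWmx n.
Proof.
apply/matrixP => i j; rewrite mxE (bigD1 i) //= big1 => [|k ki]; last first.
  by rewrite !mxE eq_sym (negbTE ki) mulr0n mul0r.
by rewrite !mxE eqxx mulr1n addr0; case: eqP => _; rewrite ?mulr1 ?mulr0.
Qed.

Lemma DWmxE n i j :
  DWmx n i j = if (i + j).+1 == n then f ^ ((i.*2.+1)%:Z - n%:Z) else 0.
Proof. by rewrite mxE. Qed.

Lemma mulmx_DW m n (A : 'M[F]_(m, n)) i j :
  (A *m DWmx n) i j = A i (rev_ord j) * f ^ (n%:Z - (j.*2.+1)%:Z).
Proof.
rewrite mxE (bigD1 (rev_ord j)) //= big1 => [|k kj].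
  rewrite DWmxE /= (_ : (n - j.+1 + j).+1 == n) ?addr0; last by have := ltn_ord j; lia.
  by congr (_ * _ ^ _); have := ltn_ord j; lia.
rewrite DWmxE ifF ?mulr0 //; apply: contraNF kj => /eqP e.
by apply/eqP/val_inj => /=; lia.
Qed.

Lemma DW_mulmx n p (A : 'M[F]_(n, p)) i j :
  (DWmx n *m A) i j = f ^ ((i.*2.+1)%:Z - n%:Z) * A (rev_ord i) j.
Proof.
rewrite mxE (bigD1 (rev_ord i)) //= big1 => [|k kj].
  by rewrite DWmxE /= ifT ?addr0 //; have := ltn_ord i; lia.
rewrite DWmxE ifF ?mul0r //; apply: contraNF kj => /eqP e.
by apply/eqP/val_inj => /=; lia.
Qed.

Lemma DWmx_unit n : DWmx n \in unitmx.
Proof.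
pose B : 'M[F]_n := \matrix_(i, j) if (i + j).+1 == n then f ^ (n%:Z - (j.*2.+1)%:Z) else 0.
suff e : DWmx n *m B = 1%:M by case/mulmx1_unit: e.
apply/matrixP => i j; rewrite DW_mulmx !mxE /=.
have -> : ((n - i.+1 + j).+1 == n) = (i == j).
  apply/eqP/eqP => [e|<-]; last by have := ltn_ord i; lia.
  by apply/val_inj => /=; have := ltn_ord i; lia.
by case: eqP => [<-|_]; rewrite ?mulr0 // -expfzDr //;
  rewrite (_ : _ + _ = 0) ?expr0z //; lia.
Qed.

Lemma invDW_mulmx n p (A : 'M[F]_(n, p)) i j :
  (invmx (DWmx n) *m A) i j = f ^ (n%:Z - ((rev_ord i).*2.+1)%:Z) * A (rev_ord i) j.
Proof.
have e := DW_mulmx (invmx (DWmx n) *m A) (rev_ord i) j.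
rewrite mulmxA mulmxV ?DWmx_unit // mul1mx rev_ordK in e.
rewrite e mulrA -expfzDr // (_ : _ + _ = 0) ?expr0z ?mul1r //; lia.
Qed.

Lemma Kmx_block n : Kmx (n + 1) = block_mx (Kmx n) 0 (rhovec n) 1%:M.
Proof.
apply/matrixP => i j; rewrite -(fintype.splitK i) -(fintype.splitK j).
case: (fintype.split i) => i'; case: (fintype.split j) => j' /=;
  rewrite (block_mxEul, block_mxEur, block_mxEdl, block_mxEdr) !mxE //=.
- by rewrite ifF //; have := ltn_ord i'; lia.
- by rewrite ifT ?(ord1 i') ?addn0 //; have := ltn_ord j'; lia.
- by rewrite (ord1 i') (ord1 j') leqnn subnn eqxx.
Qed.

(** The induction step in [n].  The entries on the left are [f^(i-j)] for
    [n <= i + j] and 0 otherwise, indices starting at 0.  The upper left block on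
    the right is [f^(i-j)], from [phivec n f *m rhovec n], minus the same for
    [i + j < n], from [DWmx n *m Kmx n]. *)
Lemma Kmx_DW n :
  Kmx (n + 1) *m DWmx (n + 1) =
  block_mx 1%:M (phivec n f) 0 1%:M *m block_mx (- (DWmx n *m Kmx n)) 0 0 1%:M
  *m block_mx 1%:M 0 (rhovec n) 1%:M.
Proof.
rewrite !mulmx_block !(mulmx1, mul1mx, mulmx0, mul0mx, addr0, add0r).
apply/matrixP => i j; rewrite mulmx_DW mxE /=.
rewrite -(fintype.splitK i) -(fintype.splitK j).
case: (fintype.split i) => i'; case: (fintype.split j) => j' /=;
  rewrite (block_mxEul, block_mxEur, block_mxEdl, block_mxEdr).
- have hK : (DWmx n *m Kmx n) i' j' = f ^ ((i'.*2.+1)%:Z - n%:Z) *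
      (if (j' <= rev_ord i')%N then f ^+ (rev_ord i' - j') else 0).
    by rewrite DW_mulmx mxE.
  rewrite [RHS]mxE [X in _ = X + _]mxE hK [X in _ = _ + X]mxE big_ord1 !mxE /=.
  have hi := ltn_ord i'; have hj := ltn_ord j'.
  have -> : f ^- (n - i') * f ^+ (n - j') = f ^ (i'%:Z - j'%:Z).
    by rewrite exprnN exprnP -expfzDr //; congr (_ ^ _); lia.
  case: ifP => h1; case: ifP => h2; try by exfalso; lia.
    by rewrite mulr0 oppr0 add0r exprnP -expfzDr //; congr (_ ^ _); lia.
  rewrite mul0r exprnP -expfzDr // (_ : _ + _ = i'%:Z - j'%:Z); last by lia.
  by rewrite addNr.
- have hi := ltn_ord i'; rewrite mxE (ord1 j') /= ifT; last by lia.
  by rewrite exprnP exprnN -expfzDr //; congr (_ ^ _); lia.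
- have hj := ltn_ord j'; rewrite mxE (ord1 i') /= ifT; last by lia.
  by rewrite !exprnP -expfzDr //; congr (_ ^ _); lia.
- rewrite (ord1 i') (ord1 j') mxE /= ifT; last by lia.
  by rewrite exprnP -expfzDr //= (_ : _ + _ = 0) ?expr0z //; lia.
Qed.

Lemma Kmx_iwahori n : pideal 1 f -> iwahori (Kmx n).
Proof.
move=> hf; have fO : Oint f by apply: le_pideal hf.
split.
- by move=> i j; rewrite mxE; case: ifP => _; [exact: OintX|exact: pideal0].
- rewrite det_trig; last by apply/is_trig_mxP => i j ij; rewrite mxE leqNgt ij.
  by apply: Ounit_prod => i _; rewrite mxE leqnn subnn; exact: Ounit1.
- move=> i j ji; rewrite mxE (ltnW ji).
  have -> : (i - j = (i - j).-1.+1)%N by lia.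
  by rewrite exprS; apply: pidealMr => //; exact: OintX.
Qed.

Lemma det_Kmx n : \det (Kmx n) = 1.
Proof.
rewrite det_trig; last by apply/is_trig_mxP => i j ij; rewrite mxE leqNgt ij.
by apply: big1 => i _; rewrite mxE leqnn subnn.
Qed.

Lemma diag_DW n (d : 'rV[F]_n) :
  diag_mx d *m DWmx n = DWmx n *m diag_mx (\row_j d 0 (rev_ord j)).
Proof.
apply/matrixP => i j; rewrite mulmx_DW DW_mulmx !mxE.
have -> : (rev_ord i == j) = (i == rev_ord j) by rewrite -(inj_eq rev_ord_inj) rev_ordK.
case: eqP => [->|_]; rewrite ?mul0r ?mulr0 // !mulr1n !rev_ordK mulrC; congr (_ ^ _ * _).
by have := ltn_ord j; rewrite /=; lia.
Qed.

Lemma lambdaE n (g : 'M[F]_(n + 1)) :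
  lambda f g = \sum_i g (rshift n 0) i * f ^- (n + 1 - i).
Proof.
rewrite /lambda mxE; apply: eq_bigr => j _; rewrite !mxE; congr (_ * _).
rewrite (bigD1 (rshift n 0)) //= !mxE /=
  (_ : ((n + 0).+1 == n + 1)%N = true) ?mul1r ?big1 ?addr0 //; last by lia.
move=> i hi; rewrite !mxE (_ : (i.+1 == n + 1)%N = false) ?mul0r //.
apply: contraNF hi => /eqP h; apply/eqP/val_inj => /=; lia.
Qed.

Lemma Mideal_phivec n a : val_ f = a%:Z -> Mideal (- (n * a)%N%:Z) (phivec n f).
Proof.
move=> vf i j; rewrite mxE; right.
rewrite valV ?expf_neq0 // exprnP valX // vf; have := ltn_ord i; nia.
Qed.

Lemma Mideal_DW n a : val_ f = a%:Z -> Mideal (- (n * a)%N%:Z) (DWmx n).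
Proof.
move=> vf i j; rewrite DWmxE; case: ifP => _; last exact: pideal0.
by right; rewrite valX // vf; have := ltn_ord i; nia.
Qed.

Lemma Mideal_invDW n a : val_ f = a%:Z -> Mideal (- (n * a)%N%:Z) (invmx (DWmx n)).
Proof.
move=> vf i j; rewrite -[invmx _]mulmx1 invDW_mulmx mxE.
case: eqP => _; rewrite ?mulr0 ?mulr1; last exact: pideal0.
by right; rewrite valX // vf /=; have := ltn_ord i; nia.
Qed.

End BirchMatrices.

(** * Whittaker functions and the integrand *)

Section Whittaker.
Context {R : realType} {F : localField}.
Local Notation C := R[i].
Variables (psi : F -> C).
Hypothesis (psi_add : additive_character psi) (psiO : has_conductor_O psi).

Definition emb k n (g : 'M[F]_n) : 'M[F]_(n + k) := block_mx g 0 0 1%:M.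

Lemma emb_mul k n (g h : 'M[F]_n) : emb k (g *m h) = emb k g *m emb k h.
Proof.
by rewrite /emb mulmx_block !(mulmx0, mul0mx, mulmx1, addr0, add0r).
Qed.

Lemma emb1 k n : emb k (1%:M : 'M[F]_n) = 1%:M.
Proof. by rewrite /emb -scalar_mx_block. Qed.

Lemma emb_unitmx k n (g : 'M[F]_n) : (emb k g \in unitmx) = (g \in unitmx).
Proof. by rewrite !unitmxE det_ublock det1 mulr1. Qed.

Lemma emb_iwahori k n (g : 'M[F]_n) : iwahori g -> iwahori (emb k g).
Proof.
move=> h; apply/iwahori_ublock; split=> //; last exact: iwahori1.
by move=> i j; rewrite mxE; exact: pideal0.
Qed.

Lemma unipotent_ublock k n (u : 'M[F]_n) (x : 'M[F]_(n, k)) : u \in @unipotent F n ->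
  block_mx u x 0 1%:M \in @unipotent F (n + k).
Proof.
move=> /unipotentP hu; apply/unipotentP => i j.
rewrite -(fintype.splitK i) -(fintype.splitK j).
case: (fintype.split i) => i'; case: (fintype.split j) => j' /= ij;
  rewrite (block_mxEul, block_mxEur, block_mxEdl, block_mxEdr).
- by rewrite hu // (inj_eq (@lshift_inj _ _)).
- by exfalso; have := ltn_ord i'; lia.
- by rewrite mxE eq_rlshift.
- by rewrite mxE (inj_eq (@rshift_inj _ _)).
Qed.

Lemma psiU_emb k n (u : 'M[F]_n) : psiU psi (emb k u) = psiU psi u.
Proof.
rewrite /psiU big_split_ord /= [X in _ * X]big1 ?mulr1 => [|i _].
  apply: eq_bigr => i _; rewrite big_split_ord /= [X in _ * X]big1 ?mulr1.
    by apply: eq_bigr => j _; rewrite block_mxEul.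
  by move=> j _; rewrite block_mxEur mxE (psi_Oint psiO) //; exact: pideal0.
apply: big1 => j /eqP e; rewrite /emb -(fintype.splitK j).
rewrite -(fintype.splitK j) in e; case: (fintype.split j) e => j' /= e.
  by rewrite block_mxEdl mxE (psi_Oint psiO) //; exact: pideal0.
rewrite block_mxEdr mxE; case: eqP => [ij|_]; first by rewrite ij in e; lia.
by rewrite (psi_Oint psiO) //; exact: pideal0.
Qed.

(** For [n = 0] both sides are 1: there is no superdiagonal entry, and [bvec] is
    empty. *)
Lemma psiU_col n (x : 'cV[F]_n) :
  psiU psi (block_mx 1%:M x 0 1%:M : 'M[F]_(n + 1)) = psi (((bvec F n)^T *m x) 0 0).
Proof.
have psi0 : psi 0 = 1 by rewrite (psi_Oint psiO) //; exact: pideal0.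
rewrite mxE (big_morph psi (psiD psi_add) psi0) /psiU big_split_ord /=.
rewrite [X in _ * X]big1 ?mulr1 => [|i _]; last first.
  apply: big1 => j /eqP; rewrite (ord1 i) /= => e.
  by exfalso; have := ltn_ord j; lia.
apply: eq_bigr => i _; rewrite big_split_ord /= [X in X * _]big1 ?mul1r => [|j /eqP e].
  rewrite big_mkcond big_ord1 /= block_mxEur !mxE addn0 eq_sym.
  by case: eqP => _; rewrite ?mul1r ?mul0r.
rewrite block_mxEul mxE; case: eqP => [ij|_]; first by rewrite ij in e; lia.
exact: psi0.
Qed.

Lemma psiU_neq0 n (u : 'M[F]_n) : psiU psi u != 0.
Proof.
apply/prodf_neq0 => i _; apply/prodf_neq0 => j _.
exact: (psi_neq0 psi_add).
Qed.

Section Restriction.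
Variables (n k : nat) (w : 'M[F]_(n + k) -> C).

Lemma whittaker_emb : whittaker psi w -> whittaker psi (fun g => w (emb k g)).
Proof.
move=> hw u g hu hg; rewrite emb_mul hw ?emb_unitmx ?psiU_emb //.
exact: unipotent_ublock.
Qed.

Lemma whittaker_inv_emb :
  whittaker_inv psi w -> whittaker_inv psi (fun g => w (emb k g)).
Proof.
move=> hw u g hu hg; rewrite emb_mul hw ?emb_unitmx ?psiU_emb //.
exact: unipotent_ublock.
Qed.

Lemma iwahori_invariant_emb :
  iwahori_invariant w -> iwahori_invariant (fun g => w (emb k g)).
Proof.
move=> hw g r hg hr; rewrite emb_mul hw ?emb_unitmx //; exact: emb_iwahori.
Qed.

End Restriction.

Variables (f : F) (a : nat).
Hypotheses (f0 : f != 0) (vf : val_ f = a).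
Variable X : F -> C.
Hypotheses (XM : forall x y : F, x != 0 -> y != 0 -> X (x * y) = X x * X y).
Hypothesis (Xtriv : trivial_mod X (pideal a)).

(** The integrand without its additive factor; [X] stands for the product of
    [chi] and the power of the absolute value. *)
Definition whittaker_part n (W V : 'M[F]_n -> C) (g : 'M[F]_n) : C :=
  W (g *m DWmx f n) * V g * X (\det g).

Definition birch_fun n (W V : 'M[F]_n -> C) (g : 'M[F]_n) : C :=
  psi (lambda f g) * whittaker_part W V g.

Lemma det_unipotent n (u : 'M[F]_n) : u \in @unipotent F n -> \det u = 1.
Proof.
move=> /unipotentP hu; rewrite -det_tr det_trig.
  by apply: big1 => i _; rewrite mxE hu ?eqxx.
by apply/is_trig_mxP => i j ij; rewrite mxE hu ?(ltnW ij) // gt_eqF.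
Qed.

Lemma bvec_unipotent n (u : 'M[F]_n) : u \in @unipotent F n ->
  (bvec F n)^T *m u = (bvec F n)^T.
Proof.
case: n u => [|N] u /unipotentP hu; first by rewrite !thinmx0.
apply/matrixP => i j; rewrite mxE (bigD1 ord_max) //= big1 => [|k hk]; last first.
  rewrite !mxE (_ : (k.+1 == N.+1)%N = false) ?mul0r //.
  by apply: contraNF hk => /eqP [e]; apply/eqP/val_inj.
by rewrite !mxE eqxx mul1r addr0 hu -1?ltnS // -val_eqE /= eqSS eq_sym.
Qed.

Section Fixed.
Variables (n : nat) (W V : 'M[F]_n -> C).
Hypotheses (Wwh : whittaker psi W) (Wiw : iwahori_invariant W)
  (Vwh : whittaker_inv psi V) (Viw : iwahori_invariant V).

Lemma birch_fun_unipotent (u g : 'M[F]_n) : u \in @unipotent F n -> g \in unitmx ->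
  birch_fun W V (u *m g) = birch_fun W V g.
Proof.
move=> hu hg; rewrite /birch_fun /whittaker_part -mulmxA Wwh //; last first.
  by rewrite unitmx_mul hg DWmx_unit.
rewrite Vwh //.
have -> : lambda f (u *m g) = lambda f g.
  by rewrite /lambda mulmxA bvec_unipotent.
rewrite det_mulmx (det_unipotent hu) mul1r.
have := psiU_neq0 u; set p := psiU psi u => p0.
by field.
Qed.

(** The level must exceed [2 n a] because conjugation by [D_n w_n] may lower the
    valuation of the entries of [k - 1] by that much. *)
Lemma whittaker_part_congr (l : nat) (g k : 'M[F]_n) : (0 < a)%N ->
  ((2 * n * a).+1 <= l)%N -> (a <= l)%N -> g \in unitmx ->
  Mcongr l k 1%:M -> whittaker_part W V (g *m k) = whittaker_part W V g.
Proof.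
move=> a0 hl al hg hk; rewrite /whittaker_part.
have hk1 : Mcongr 1 1%:M k by apply: Mcongr_sym; apply: le_Mcongr hk; lia.
have ik : iwahori k by apply: iwahori_congr hk1 (iwahori1 _).
have uk := iwahori_GLO ik; have uK := GLO_unitmx uk.
rewrite Viw //.
have -> : W (g *m k *m DWmx f n) = W (g *m DWmx f n).
  have uD := DWmx_unit f0 n.
  have -> : g *m k *m DWmx f n =
     g *m DWmx f n *m (invmx (DWmx f n) *m k *m DWmx f n).
    by rewrite !mulmxA mulmxK.
  rewrite Wiw ?unitmx_mul ?hg ?uD //.
  apply: (iwahori_congr _ (iwahori1 n)); apply: Mcongr_sym; apply/Mideal_congr.
  have -> : invmx (DWmx f n) *m k *m DWmx f n - 1%:M =
     invmx (DWmx f n) *m (k - 1%:M) *m DWmx f n.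
    by rewrite mulmxBr mulmxBl mulmx1 mulVmx.
  have hM : Mideal (- (n * a)%N%:Z + l%:Z + (- (n * a)%N%:Z))
      (invmx (DWmx f n) *m (k - 1%:M) *m DWmx f n).
    apply: MidealM; last exact: (Mideal_DW f0 vf).
    apply: MidealM; first exact: (Mideal_invDW f0 vf).
    exact/Mideal_congr.
  by move=> i j; apply: le_pideal (hM i j); nia.
congr (_ * _); rewrite det_mulmx XM; last 2 first.
- by move: hg; rewrite unitmxE unitfE.
- by move: uK; rewrite unitmxE unitfE.
rewrite (Xtriv (x := \det k)) ?mulr1 //; first by case: uk.
have e : congr_mod l (\det k) 1.
  by rewrite -(det1 F n); apply: Mcongr_det => //; [case: uk|exact: Mint1].
by apply: le_pideal e; lia.
Qed.

Lemma birch_fun_congr (l : nat) (g k : 'M[F]_n) : (0 < a)%N ->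
  ((2 * n * a).+1 <= l)%N -> (a <= l)%N -> g \in unitmx ->
  Mideal ((n * a)%N%:Z - l%:Z) g ->
  Mcongr l k 1%:M -> birch_fun W V (g *m k) = birch_fun W V g.
Proof.
move=> a0 hl al hg hgl hk; rewrite /birch_fun (whittaker_part_congr a0 hl al hg hk).
congr (_ * _); apply: (psi_congr psi_add psiO).
have -> : g *m k = g + g *m (k - 1%:M) by rewrite mulmxBr mulmx1 addrCA subrr addr0.
rewrite /congr_mod /lambda mulmxDr mulmxDl [X in X - _]mxE addrAC subrr add0r mulmxA.
rewrite (_ : 0 = ((n * a)%N%:Z - l%:Z) + l%:Z + (- (n * a)%N%:Z)); last by lia.
apply: MidealM; last exact: (Mideal_phivec f0 vf).
apply: MidealM; last exact/Mideal_congr.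
rewrite -[_ - _]add0r; apply: MidealM => // i j; rewrite !mxE.
by case: eqP => _; [exact: Oint1|exact: pideal0].
Qed.

End Fixed.
End Whittaker.

(** * Splitting off the last row *)

Section Recursion.
Context {R : realType} {F : localField}.
Local Notation C := R[i].
Variables (psi X : F -> C) (f : F) (a : nat).
Hypotheses (psi_add : additive_character psi) (psiO : has_conductor_O psi).
Hypotheses (f0 : f != 0) (vf : val_ f = a) (a_gt0 : (0 < a)%N).
Hypotheses (Xneq0 : forall x : F, x != 0 -> X x != 0)
  (XM : forall x y : F, x != 0 -> y != 0 -> X (x * y) = X x * X y)
  (Xcond : is_conductor X (principal f)).

Lemma pideal_f : pideal 1 f. Proof. by right; rewrite vf; lia. Qed.

Lemma rhovec_iwahori n : iwahori (block_mx 1%:M 0 (rhovec f n) 1%:M : 'M[F]_(n + 1)).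
Proof.
have fO : Oint f by apply: le_pideal pideal_f.
split.
- apply/Mint_block; split; try exact: Mint1.
    by move=> i j; rewrite mxE; exact: pideal0.
  by move=> i j; rewrite mxE; exact: OintX.
- by rewrite det_lblock !det1 mulr1; exact: Ounit1.
- move=> i j; rewrite -(fintype.splitK i) -(fintype.splitK j).
  case: (fintype.split i) => i'; case: (fintype.split j) => j' /=;
    rewrite (block_mxEul, block_mxEur, block_mxEdl, block_mxEdr) mxE => ij.
  + by case: eqP => [e|_]; [rewrite e ltnn in ij|exact: pideal0].
  + exact: pideal0.
  + have -> : (n - j' = (n - j').-1.+1)%N by have := ltn_ord j'; lia.
    by rewrite exprS; apply: pidealMr; [exact: pideal_f|exact: OintX].
  + by case: eqP => [e|_]; [rewrite e ltnn in ij|exact: pideal0].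
Qed.

Lemma iwahoriN n (r : 'M[F]_n) : iwahori r -> iwahori (- r).
Proof.
move=> [hr dr lr]; split.
- by move=> i j; rewrite mxE; apply/pidealN; exact: hr.
- rewrite -scaleN1r detZ; apply: OunitM => //.
  rewrite -[X in _ ^+ X]card_ord -prodr_const; apply: Ounit_prod => i _.
  by apply: OunitN; exact: Ounit1.
- by move=> i j ij; rewrite mxE; apply/pidealN; exact: lr.
Qed.

Lemma X1 : X 1 = 1.
Proof.
have := XM (oner_neq0 F) (oner_neq0 F); rewrite mulr1 => /eqP.
rewrite eq_sym -subr_eq0 -{3}(mulr1 (X 1)) -mulrBr mulf_eq0 subr_eq0.
by rewrite (negbTE (Xneq0 (oner_neq0 _))) => /eqP.
Qed.

Lemma X_prod (I : Type) (s : seq I) (P : pred I) (h : I -> F) :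
  (forall i, P i -> h i != 0) ->
  X (\prod_(i <- s | P i) h i) = \prod_(i <- s | P i) X (h i).
Proof.
move=> h0.
suff [] : X (\prod_(i <- s | P i) h i) = \prod_(i <- s | P i) X (h i) /\
    \prod_(i <- s | P i) h i != 0 by [].
elim/big_ind2 : _ => [|x y z t [h1 h2] [h3 h4]|i Pi].
- by rewrite X1 oner_eq0.
- by rewrite mulf_neq0 // XM // h1 h3.
- by rewrite h0.
Qed.

Section Step.
Variables (N : nat) (W V : 'M[F]_(N + 1) -> C).
Hypotheses (Wwh : whittaker psi W) (Wiw : iwahori_invariant W)
  (Vwh : whittaker_inv psi V) (Viw : iwahori_invariant V).

(** The unipotent factor with column [x] cancels between [W] and [V].  In [W], the
    torus element moves through [DWmx] and is absorbed, and [Kmx_DW] leaves the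
    unipotent matrix with column [phivec] to the left of an embedded matrix;
    carried past [emb 1 g], it contributes [psi (lambda f g)]. *)
Lemma whittaker_part_step (g : 'M[F]_N) (x : 'cV[F]_N) (d : 'rV[F]_(N + 1)) :
  g \in unitmx -> (forall i, Ounit (d 0 i)) ->
  whittaker_part f X W V (block_mx g x 0 1%:M *m (Kmx f (N + 1) *m diag_mx d)) =
  (\prod_i X (d 0 i)) *
    birch_fun psi f X (fun g => W (emb 1 g)) (fun g => V (emb 1 g)) g.
Proof.
move=> hg hd.
have iK n : iwahori (Kmx f n) := Kmx_iwahori f0 n pideal_f.
have id : iwahori (diag_mx d) := iwahori_diag_mx hd.
pose u : 'M[F]_(N + 1) := block_mx 1%:M x 0 1%:M.
have hu : u \in @unipotent F (N + 1) by apply: unipotent_ublock; exact: unipotent1.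
have ug : emb 1 g \in unitmx by rewrite emb_unitmx.
have eg : block_mx g x 0 1%:M = u *m emb 1 g.
  by rewrite /u /emb mulmx_block !(mulmx0, mul0mx, mulmx1, mul1mx, addr0, add0r).
have uK n : Kmx f n \in unitmx := GLO_unitmx (iwahori_GLO (iK n)).
have udiag : diag_mx d \in unitmx := GLO_unitmx (iwahori_GLO id).
rewrite /birch_fun /whittaker_part eg.
have -> : V (u *m emb 1 g *m (Kmx f (N + 1) *m diag_mx d)) =
    (psiU psi u)^-1 * V (emb 1 g).
  by rewrite -mulmxA Vwh ?unitmx_mul ?ug ?uK ?udiag // Viw //; exact: iwahoriM.
pose d' := \row_j d 0 (rev_ord j).
have id' : iwahori (diag_mx d') by apply: iwahori_diag_mx => i; rewrite mxE.
have uD n : DWmx f n \in unitmx := DWmx_unit f0 n.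
have ir := rhovec_iwahori N.
have -> : W (u *m emb 1 g *m (Kmx f (N + 1) *m diag_mx d) *m DWmx f (N + 1)) =
    psiU psi u * (psi (lambda f g) * W (emb 1 (g *m DWmx f N))).
  have -> : u *m emb 1 g *m (Kmx f (N + 1) *m diag_mx d) *m DWmx f (N + 1) =
     u *m (emb 1 g *m (Kmx f (N + 1) *m DWmx f (N + 1))) *m diag_mx d'.
    by rewrite -!mulmxA (diag_DW f0).
  rewrite Wiw ?unitmx_mul ?ug ?uK ?uD ?andbT ?unipotent_unit // Wwh; last 2 first.
  - by [].
  - by rewrite !unitmx_mul ug uK uD.
  congr (_ * _); rewrite Kmx_DW // mulmxA Wiw //; last first.
    rewrite !unitmx_mul ug !unitmxE !det_ublock !det1 ?mulr1 ?mul1r ?unitr1 /=.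
    rewrite -unitmxE -mulmxN unitmx_mul uD.
    by apply: GLO_unitmx; apply: iwahori_GLO; exact: iwahoriN.
  pose u' : 'M[F]_(N + 1) := block_mx 1%:M (g *m phivec N f) 0 1%:M.
  have hu' : u' \in @unipotent F (N + 1) by apply: unipotent_ublock; exact: unipotent1.
  have -> : emb 1 g *m (block_mx 1%:M (phivec N f) 0 1%:M *m
       block_mx (- (DWmx f N *m Kmx f N)) 0 0 1%:M) =
     u' *m (emb 1 (g *m DWmx f N) *m emb 1 (- Kmx f N)).
    rewrite /u' /emb !mulmx_block !(mulmx0, mul0mx, mulmx1, mul1mx, addr0, add0r).
    by rewrite !mulmxN mulmxA.
  have iN : iwahori (- Kmx f N) by exact: iwahoriN.
  rewrite Wwh //; last first.
    by rewrite unitmx_mul !emb_unitmx unitmx_mul hg uD (GLO_unitmx (iwahori_GLO iN)).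
  rewrite Wiw ?emb_unitmx ?unitmx_mul ?hg ?uD //; last exact: emb_iwahori.
  by rewrite psiU_col // /lambda mulmxA.
have -> : X (\det (u *m emb 1 g *m (Kmx f (N + 1) *m diag_mx d))) =
    X (\det g) * \prod_i X (d 0 i).
  rewrite !det_mulmx det_ublock !det1 det_ublock det1 det_Kmx det_diag.
  rewrite !mul1r mulr1 XM ?X_prod //.
  - by move=> i _; apply: Ounit_neq0.
  - by rewrite -unitfE -unitmxE.
  - by apply/prodf_neq0 => i _; apply: Ounit_neq0.
have p0 := psiU_neq0 psi_add u; set p := psiU psi u in p0 *.
by field.
Qed.

End Step.
End Recursion.

(** * Averaging over the diagonal torus *)

Section TorusAverage.
Context {R : realType} {F : localField}.
Local Notation C := R[i].
Variables (psi X : F -> C) (f : F) (a : nat).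
Hypotheses (psi_add : additive_character psi) (psiO : has_conductor_O psi).
Hypotheses (f0 : f != 0) (vf : val_ f = a) (a_gt0 : (0 < a)%N).
Hypotheses (Xneq0 : forall x : F, x != 0 -> X x != 0)
  (XM : forall x y : F, x != 0 -> y != 0 -> X (x * y) = X x * X y)
  (Xcond : is_conductor X (principal f)).
Variables (varpi : F) (varpi_prime : prime_elt varpi).
Variables (l : nat) (T : residues F l).

Local Notation q := ((resnorm F)%:R : C).
Local Notation G := (gauss_sum psi X f).
Local Notation mlift := (map_mx (rlift T)).

Definition num_units : nat := #|[pred t : T | `[< Ounit (rlift T t) >]]|.

Lemma trivial_X : trivial_mod X (pideal a).
Proof. by case: Xcond => _; rewrite principalE // vf. Qed.

Section Step.
Variables (N : nat) (W V : 'M[F]_(N + 1) -> C).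
Hypotheses (Wwh : whittaker psi W) (Wiw : iwahori_invariant W)
  (Vwh : whittaker_inv psi V) (Viw : iwahori_invariant V).
Hypothesis (large : ((2 * (N + 1) * a).+1 <= l)%N).

Let al : (a <= l)%N. Proof. nia. Qed.

(** The scaling makes the [i]-th entry of the last row contribute
    [lastrow g i / f] to [lambda f g]. *)
Definition lastrow (g : 'M[F]_(N + 1)) (i : 'I_(N + 1)) : F :=
  g (rshift N 0) i * f ^- (N - i).

(** What averaging over the torus leaves of the integrand, up to Gauss sums. *)
Definition torus_part (g0 r : 'M[F]_(N + 1)) : C :=
  if `[< iwahori r /\ forall i, Ounit (lastrow (g0 *m r) i) >]
  then whittaker_part f X W V (g0 *m r) * \prod_i (X (lastrow (g0 *m r) i))^-1 else 0.

Lemma lambda_diag (g : 'M[F]_(N + 1)) (d : 'rV[F]_(N + 1)) :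
  lambda f (g *m diag_mx d) = \sum_i lastrow g i * d 0 i / f.
Proof.
rewrite (lambdaE f0).
apply: eq_bigr => i _; rewrite /lastrow mul_mx_diag mxE.
rewrite (_ : (N + 1 - i = (N - i).+1)%N); last by have := ltn_ord i; lia.
by rewrite exprS invfM; ring.
Qed.

Lemma whittaker_part_diag (g : 'M[F]_(N + 1)) (d : 'rV[F]_(N + 1)) :
  g \in unitmx -> (forall i, Ounit (d 0 i)) ->
  whittaker_part f X W V (g *m diag_mx d) = whittaker_part f X W V g * \prod_i X (d 0 i).
Proof.
move=> hg hd; have id := iwahori_diag_mx hd; rewrite /whittaker_part Viw //.
rewrite -mulmxA (diag_DW f0) mulmxA Wiw ?unitmx_mul ?hg ?DWmx_unit //; last first.
  by apply: iwahori_diag_mx => i; rewrite mxE.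
rewrite det_mulmx det_diag XM; last 2 first.
- by rewrite -unitfE -unitmxE.
- by apply/prodf_neq0 => i _; apply: Ounit_neq0.
rewrite mulrA; congr (_ * _); apply: (X_prod Xneq0 XM) => i _.
exact: Ounit_neq0.
Qed.

Lemma psi_sum (I : finType) (h : I -> F) : psi (\sum_i h i) = \prod_i psi (h i).
Proof.
apply: big_morph; first exact: psiD.
by rewrite (psi_Oint psiO) //; exact: pideal0.
Qed.

(** Both sides compute the sum, over diagonal unit matrices [t] and over [r], of
    the integrand at [g0 r t]: on the left [r t] replaces [r]; on the right
    the sum over [t] is carried out first and factors into one variable sums. *)
Lemma torus_average (g0 : 'M[F]_(N + 1)) : g0 \in unitmx ->
  Mideal (((N + 1) * a)%N%:Z - l%:Z) g0 ->
  num_units%:R ^+ (N + 1) * (\sum_(M : 'M[T]_(N + 1))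
     if `[< iwahori (mlift M) >] then birch_fun psi f X W V (g0 *m mlift M) else 0) =
  (q ^+ (l - a) * G) ^+ (N + 1) * \sum_(M : 'M[T]_(N + 1)) torus_part g0 (mlift M).
Proof.
move=> ug0 hg0.
pose phi r := if `[< iwahori r >] then birch_fun psi f X W V (g0 *m r) else 0.
have g0int r : Mint r -> Mideal (((N + 1) * a)%N%:Z - l%:Z) (g0 *m r).
  by move=> hr; rewrite -[_ - _]addr0; exact: MidealM.
have phiR : respects (@Mint F _ _) (Mcongr l (n := N + 1)) phi.
  apply: respects_iwahori; first by apply: leq_trans a_gt0 al.
  move=> r k ir hk; rewrite mulmxA.
  have ur := GLO_unitmx (iwahori_GLO ir).
  apply: (birch_fun_congr psi_add psiO f0 vf XM trivial_X Wiw Viw a_gt0 large al _ _ hk).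
    by rewrite unitmx_mul ug0.
  by apply: g0int; case: ir.
pose B r := if `[< iwahori r >] then whittaker_part f X W V (g0 *m r) else 0.
pose un (t : T) : C := if `[< Ounit (rlift T t) >] then 1 else 0.
pose dg (t : {ffun 'I_(N + 1) -> T}) : 'rV[F]_(N + 1) := \row_i rlift T (t i).
have step (t : {ffun 'I_(N + 1) -> T}) :
    (\prod_i un (t i)) * (\sum_(M : 'M[T]_(N + 1)) phi (mlift M)) =
    \sum_(M : 'M[T]_(N + 1)) B (mlift M) *
       \prod_i gauss_term psi X f (lastrow (g0 *m mlift M) i) (rlift T (t i)).
  have [ut|/existsNP[i ni]] := pselect (forall i, Ounit (rlift T (t i))); last first.
    rewrite (bigD1 i) //= {1}/un asboolF // !mul0r big1 // => M _.
    by rewrite (bigD1 i) //= {1}/gauss_term asboolF // mul0r mulr0.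
  rewrite big1 ?mul1r => [|i _]; last by rewrite /un asboolT.
  have hd i : Ounit (dg t 0 i) by rewrite mxE.
  have id := iwahori_diag_mx hd.
  rewrite -(sum_mulr T (iwahori_GLO id) phiR); apply: eq_bigr => M _.
  set r := mlift M; rewrite /phi /B.
  have -> : `[< iwahori (r *m diag_mx (dg t)) >] = `[< iwahori r >].
    by apply: asbool_equiv_eq; exact: iwahori_mulrE.
  case: asboolP => ir; last by rewrite mul0r.
  have ur := GLO_unitmx (iwahori_GLO ir).
  rewrite /birch_fun mulmxA lambda_diag psi_sum whittaker_part_diag ?unitmx_mul ?ug0 //.
  rewrite mulrCA -big_split /=; congr (_ * _); apply: eq_bigr => i _.
  by rewrite /gauss_term asboolT // !mxE mulrC.
have eU : \sum_(t : T) un t = num_units%:R.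
  by rewrite -big_mkcond sumr_const.
rewrite -[X in _ ^+ X * _]card_ord -prodr_const -eU bigA_distr_bigA mulr_suml.
under eq_bigr => t _ do rewrite step.
rewrite exchange_big mulr_sumr; apply: eq_bigr => M _ /=.
rewrite -mulr_sumr -(bigA_distr_bigA (fun i t =>
   gauss_term psi X f (lastrow (g0 *m mlift M) i) (rlift T t))).
set r := mlift M; rewrite /B /torus_part.
case: asboolP => ir; last by rewrite mul0r asboolF ?mulr0 // => -[].
have hy i : pideal (a%:Z - l%:Z) (lastrow (g0 *m r) i).
  have hr : Mint r by case: ir.
  have h := g0int _ r hr (rshift N 0) i.
  apply: (@le_pideal _ _ ((((N + 1) * a)%N%:Z - l%:Z) + - ((N - i) * a)%N%:Z)).
    by have := ltn_ord i; nia.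
  apply: pidealM => //; right.
  by rewrite valV ?expf_neq0 // exprnP valX // vf; lia.
have [gd|ngd] := pselect (forall i, Ounit (lastrow (g0 *m r) i)); last first.
  rewrite [in RHS]asboolF ?mulr0; last by move=> [].
  move/existsNP: ngd => [i ni]; rewrite (bigD1 i) //=.
  by rewrite (gauss_term_sum0 psi_add psiO f0 vf a_gt0 XM Xcond) ?mul0r ?mulr0.
rewrite [in RHS]asboolT //.
rewrite (eq_bigr (fun i => (X (lastrow (g0 *m r) i))^-1 * (q ^+ (l - a) * G))).
  by rewrite big_split /= prodr_const card_ord; ring.
have [S _] := residues_exist varpi_prime a.
move=> i _; rewrite -natrX.
by apply: (gauss_term_sum_unit psi_add psiO f0 vf a_gt0 Xneq0 XM Xcond T S).
Qed.

End Step.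
End TorusAverage.

(** * Summing over the last row *)

Section LastRow.
Context {R : realType} {F : localField}.
Local Notation C := R[i].
Variables (psi X : F -> C) (f : F) (a : nat).
Hypotheses (psi_add : additive_character psi) (psiO : has_conductor_O psi).
Hypotheses (f0 : f != 0) (vf : val_ f = a) (a_gt0 : (0 < a)%N).
Hypotheses (Xneq0 : forall x : F, x != 0 -> X x != 0)
  (XM : forall x y : F, x != 0 -> y != 0 -> X (x * y) = X x * X y)
  (Xcond : is_conductor X (principal f)).
Variables (varpi : F) (varpi_prime : prime_elt varpi).
Variables (l : nat) (T : residues F l).

Local Notation q := ((resnorm F)%:R : C).
Local Notation G := (gauss_sum psi X f).
Local Notation mlift := (map_mx (rlift T)).

Definition dilated_units (k : nat) : C :=
  \sum_(t : T) if `[< Ounit (rlift T t * f ^- k) >] then 1 else 0.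

Lemma dilated_unitsE k : ((k * a).+1 <= l)%N ->
  dilated_units k * q ^+ (k * a) = (num_units T)%:R.
Proof.
have [S _] := residues_exist varpi_prime 1.
pose un (x : F) : C := if `[< Ounit x >] then 1 else 0.
have unR : respects (@Oint F) (congr_mod 1) un.
  move=> x y _ _ h; rewrite /un (_ : `[< Ounit x >] = `[< Ounit y >]) //.
  exact/asbool_equiv_eq/Ounit_congr.
have H j : ((j * a).+1 <= l)%N ->
    dilated_units j = (\sum_(s : S) un (rlift S s)) *+ (resnorm F ^ (l - (j * a + 1))).
  move=> hj.
  have fj : f ^+ j != 0 by rewrite expf_neq0.
  have vj : val_ (f ^+ j) = (j * a)%N by rewrite exprnP valX // vf; lia.
  rewrite -(sum_dilate varpi_prime T S fj vj _ unR); last by lia.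
  rewrite [RHS]big_mkcond; apply: eq_bigr => t _.
  case: asboolP => [ut|nut]; case: asboolP => ht //.
  - by rewrite /un asboolT.
  - case: ht; have : pideal 0 (rlift T t * f ^- j) by exact: Ounit_Oint.
    move=> /(pidealM_eq _ _ fj); rewrite vj mulrCA divff // mulr1 add0r.
    done.
  - by rewrite /un asboolF.
move=> hk; rewrite H // -natrX -[_ *+ (resnorm F ^ (l - _))]mulr_natr -mulrA -natrM.
have -> : (num_units T)%:R = dilated_units 0.
  rewrite /dilated_units -big_mkcond sumr_const; congr (_%:R).
  apply: eq_card => t; rewrite !inE.
  by rewrite unfold_in expr0 divr1.
rewrite H; last by lia.
rewrite -[RHS]mulr_natr; congr (_ * _%:R); rewrite -expnD; congr (_ ^ _)%N; lia.
Qed.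

Lemma num_units_neq0 : (0 < l)%N -> (num_units T)%:R != 0 :> C.
Proof.
move=> l0; rewrite pnatr_eq0 -lt0n; apply/card_gt0P; exists (red T 1).
rewrite inE; apply/asboolP.
have h : congr_mod 1 (rlift T (red T 1)) 1.
  by apply: (le_pideal (l := l)) (redK T Oint1); lia.
by apply/asboolP; apply/(Ounit_congr h); exact: Ounit1.
Qed.

Section Step.
Variables (N : nat) (W V : 'M[F]_(N + 1) -> C).
Hypotheses (Wwh : whittaker psi W) (Wiw : iwahori_invariant W)
  (Vwh : whittaker_inv psi V) (Viw : iwahori_invariant V).
Hypothesis (large : ((2 * (N + 1) * a).+1 <= l)%N).

Let al : (a <= l)%N. Proof. nia. Qed.

Local Notation W' := (fun g : 'M[F]_N => W (emb 1 g)).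
Local Notation V' := (fun g : 'M[F]_N => V (emb 1 g)).

Lemma lastrow_emb (g : 'M[F]_N) (A : 'M[F]_(N, N + 1)) (r : 'rV[F]_(N + 1)) i :
  lastrow f (emb 1 g *m col_mx A r) i = r 0 i * f ^- (N - i).
Proof.
by rewrite /lastrow /emb mul_block_col !mul0mx add0r addr0 mul1mx col_mxEd.
Qed.

Lemma iwahori_Kd (d : 'rV[F]_(N + 1)) : (forall i, Ounit (d 0 i)) ->
  iwahori (Kmx f (N + 1) *m diag_mx d).
Proof.
move=> hd; apply: iwahoriM; last exact: iwahori_diag_mx.
by apply: Kmx_iwahori => //; exact: pideal_f vf a_gt0.
Qed.

Lemma lastrow_Kd (r : 'rV[F]_(N + 1)) :
  row_mx 0 1%:M *m (Kmx f (N + 1) *m diag_mx (\row_i (r 0 i * f ^- (N - i)))) = r.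
Proof.
rewrite mulmxA (Kmx_block f0) mul_row_block !mul0mx !mul1mx !add0r.
apply/matrixP => i j; rewrite ord1 mul_mx_diag mxE [(\row_i _) _ _]mxE.
rewrite -(fintype.splitK j); case: (fintype.split j) => j' /=.
  by rewrite row_mxEl mxE mulrCA divff ?mulr1 // expf_neq0.
by rewrite row_mxEr mxE (ord1 j') eqxx mul1r addn0 subnn expr0 invr1 mulr1.
Qed.

(** The last row [r] is fixed first.  When it is admissible, it is the last row of
    the Iwahori matrix [P = Kmx *m diag_mx d], and multiplying the other rows on
    the right by [P] permutes their residues; this replaces the last row by that
    of the identity, so that [whittaker_part_step] applies. *)
Lemma torus_part_sum (g0 : 'M[F]_N) : g0 \in unitmx ->
  \sum_(M : 'M[T]_(N + 1)) torus_part X f W V (emb 1 g0) (mlift M) =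
  (\prod_(i < N + 1) dilated_units (N - i)) * (q ^+ l) ^+ N *
  \sum_(M : 'M[T]_N)
     if `[< iwahori (mlift M) >] then birch_fun psi f X W' V' (g0 *m mlift M) else 0.
Proof.
move=> ug0; have ue : emb 1 g0 \in unitmx by rewrite emb_unitmx.
rewrite sum_col_mx; set Z := (X in _ = _ * X).
pose good (r : 'rV[T]_(N + 1)) (i : 'I_(N + 1)) : C :=
  if `[< Ounit (rlift T (r 0 i) * f ^- (N - i)) >] then 1 else 0.
rewrite -mulrA.
have -> : \prod_(i < N + 1) dilated_units (N - i) = \sum_(r : 'rV[T]_(N + 1)) \prod_i good r i.
  exact: (esym (sum_rV_prod (fun (i : 'I_(N + 1)) t =>
    if `[< Ounit (rlift T t * f ^- (N - i)) >] then 1 else 0 : C))).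
rewrite mulr_suml; apply: eq_bigr => r _.
under [LHS]eq_bigr => A _ do rewrite map_col_mx.
have [gd|/existsNP[i ni]] :=
  pselect (forall i, Ounit (rlift T (r 0 i) * f ^- (N - i))); last first.
  rewrite (bigD1 i) //= {1}/good asboolF // !mul0r big1 // => A _.
  rewrite /torus_part asboolF // => -[_ /(_ i)].
  by rewrite lastrow_emb mxE.
rewrite [X in _ = X * _]big1 ?mul1r => [|i _]; last by rewrite /good asboolT.
(* The diagonal matrix for which [P] has last row [r]. *)
pose d : 'rV[F]_(N + 1) := \row_i ((mlift r) 0 i * f ^- (N - i)).
have hd i : Ounit (d 0 i) by rewrite !mxE.
have iP := iwahori_Kd hd; set P := Kmx f (N + 1) *m diag_mx d in iP.
pose part A := torus_part X f W V (emb 1 g0) (col_mx A (mlift r)).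
pose B (s : 'M[F]_(N + 1)) :=
  if `[< iwahori s >] then whittaker_part f X W V (emb 1 g0 *m s) else 0.
have BR : respects (@Mint F _ _) (Mcongr l (n := N + 1)) B.
  apply: respects_iwahori; first by apply: leq_trans a_gt0 al.
  move=> s k ir hk; rewrite mulmxA.
  apply: (whittaker_part_congr f0 vf XM (trivial_X f0 vf Xcond) Wiw Viw a_gt0 large al _ hk).
  by rewrite unitmx_mul ue; apply: GLO_unitmx; exact: iwahori_GLO.
have partE A : part A = B (col_mx A (mlift r)) * \prod_i (X (d 0 i))^-1.
  rewrite /part /torus_part /B.
  have hl : forall i, lastrow f (emb 1 g0 *m col_mx A (mlift r)) i = d 0 i.
    by move=> i; rewrite lastrow_emb !mxE.
  rewrite (eq_bigr (fun i => (X (d 0 i))^-1)) => [|i _]; last by rewrite hl.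
  case: (asboolP (iwahori _)) => h.
    by rewrite asboolT //; split=> // i; rewrite hl.
  by rewrite mul0r asboolF // => -[].
have partR : respects (@Mint F _ _) (Mcongr l (n := N + 1)) part.
  move=> A A' hA hA' h; rewrite !partE; congr (_ * _).
  apply: BR; [| |exact: Mcongr_col_mx].
    by apply: Mint_col_mx => //; exact: mlift_int.
  by apply: Mint_col_mx => //; exact: mlift_int.
rewrite -/(part _) -(sum_mulr T (iwahori_GLO iP) partR) sum_row_mx.
rewrite (eq_bigr (fun=> Z)) => [|x _].
  rewrite sumr_const -[in LHS]mulr_natl; congr (_ * _).
  by rewrite card_mx muln1 (card_residues varpi_prime T) -!natrX.
apply: eq_bigr => A _; rewrite map_row_mx; set A' := mlift A; set x' := mlift x.
have eP : col_mx (row_mx A' x' *m P) (mlift r) = block_mx A' x' 0 1%:M *m P.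
  rewrite -[in LHS](lastrow_Kd (mlift r)) -/P -mul_col_mx.
  by rewrite block_mxEv.
rewrite partE eP /B.
have -> : `[< iwahori (block_mx A' x' 0 1%:M *m P) >] = `[< iwahori A' >].
  apply: asbool_equiv_eq; split.
    by move/(iwahori_mulrE _ iP)/iwahori_ublock => [].
  move=> h; apply/(iwahori_mulrE _ iP)/iwahori_ublock; split=> //.
    exact: mlift_int.
  exact: iwahori1.
case: asboolP => iA; last by rewrite mul0r.
rewrite mulmxA /emb mulmx_block !(mulmx0, mul0mx, addr0, add0r, mul1mx).
rewrite (whittaker_part_step psi_add psiO f0 vf a_gt0 Xneq0 XM Wwh Wiw Vwh Viw) //; last first.
  by rewrite unitmx_mul ug0; apply: GLO_unitmx; exact: iwahori_GLO.
rewrite mulrAC -big_split /= big1 ?mul1r // => i _.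
by rewrite mulfV // Xneq0 // Ounit_neq0.
Qed.

Lemma birch_fun_sum_emb (g0 : 'M[F]_N) : g0 \in unitmx ->
  Mideal (((N + 1) * a)%N%:Z - l%:Z) (emb 1 g0) ->
  \sum_(M : 'M[T]_(N + 1)) (if `[< iwahori (mlift M) >]
     then birch_fun psi f X W V (emb 1 g0 *m mlift M) else 0) =
  (q ^+ (l - a) * G) ^+ (N + 1) * (\prod_(i < N + 1) q ^- ((N - i) * a)) * (q ^+ l) ^+ N *
  \sum_(M : 'M[T]_N)
     if `[< iwahori (mlift M) >] then birch_fun psi f X W' V' (g0 *m mlift M) else 0.
Proof.
move=> ug0 hg0; have ue : emb 1 g0 \in unitmx by rewrite emb_unitmx.
have := torus_average psi_add psiO f0 vf a_gt0 Xneq0 XM Xcond varpi_prime T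
  Wiw Viw large ue hg0.
rewrite torus_part_sum // => e.
have l0 : (0 < l)%N by lia.
have U0 : (num_units T)%:R ^+ (N + 1) != 0 :> C by rewrite expf_neq0 // num_units_neq0.
apply: (mulfI U0); rewrite e.
have q0 : q != 0 by rewrite pnatr_eq0 -lt0n (ltn_trans _ (@resnorm_gt1 F)).
have -> : (num_units T)%:R ^+ (N + 1) =
    (\prod_(i < N + 1) dilated_units (N - i)) * \prod_(i < N + 1) q ^+ ((N - i) * a).
  rewrite -[X in _ ^+ X]card_ord -prodr_const -big_split /=; apply: eq_bigr => i _.
  by rewrite dilated_unitsE //; have := ltn_ord i; nia.
rewrite prodfV; set p := \prod_(i < N + 1) q ^+ _.
have p0 : p != 0 by apply/prodf_neq0 => i _; rewrite expf_neq0.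
by field.
Qed.

Lemma birch_fun_sum0 (g0 : 'M[F]_(N + 1)) : g0 \in unitmx ->
  Mideal (((N + 1) * a)%N%:Z - l%:Z) g0 ->
  (forall r, iwahori r -> ~ (forall i, Ounit (lastrow f (g0 *m r) i))) ->
  \sum_(M : 'M[T]_(N + 1)) (if `[< iwahori (mlift M) >]
     then birch_fun psi f X W V (g0 *m mlift M) else 0) = 0.
Proof.
move=> ug0 hg0 hn.
have := torus_average psi_add psiO f0 vf a_gt0 Xneq0 XM Xcond varpi_prime T
  Wiw Viw large ug0 hg0.
rewrite [X in _ = _ * X]big1 => [|M _]; last first.
  by rewrite /torus_part asboolF // => -[/hn].
have l0 : (0 < l)%N by lia.
move=> /eqP; rewrite mulr0 mulf_eq0 expf_eq0 (negbTE (num_units_neq0 l0)) andbF.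
by move=> /eqP.
Qed.

End Step.
End LastRow.

(** * The sum over one cell *)

Section CellSum.
Context {R : realType} {F : localField}.
Local Notation C := R[i].
Variables (psi X : F -> C) (f : F) (a : nat).
Hypotheses (psi_add : additive_character psi) (psiO : has_conductor_O psi).
Hypotheses (f0 : f != 0) (vf : val_ f = a) (a_gt0 : (0 < a)%N).
Hypotheses (Xneq0 : forall x : F, x != 0 -> X x != 0)
  (XM : forall x y : F, x != 0 -> y != 0 -> X (x * y) = X x * X y)
  (Xcond : is_conductor X (principal f)).
Variables (varpi : F) (varpi_prime : prime_elt varpi).
Variables (l : nat) (T : residues F l).

Local Notation q := ((resnorm F)%:R : C).
Local Notation G := (gauss_sum psi X f).
Local Notation mlift := (map_mx (rlift T)).

Definition monomial_mx n (g : 'M[F]_n) : Prop :=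
  exists (e : 'I_n -> int) (s : 'I_n -> 'I_n),
    injective s /\ forall i j, g i j = varpi ^ e i *+ (s i == j).

(** The last row of [g0 r] is [varpi^e] times row [k] of [r].  Its [i]-th entry has
    valuation [(N - i) a] by hypothesis.  The unit [r k k] gives [e = (N - k) a],
    and the last entry of row [k], being integral, gives [e <= 0]; hence [k = N]
    and [e = 0]. *)
Lemma monomial_lastrow N (g0 : 'M[F]_(N + 1)) (r : 'M[F]_(N + 1)) :
  monomial_mx g0 -> iwahori r ->
  (forall i, Ounit (lastrow f (g0 *m r) i)) ->
  exists2 g0' : 'M[F]_N, g0 = emb 1 g0' & monomial_mx g0'.
Proof.
move=> [e [s [s_inj hg]]] ir hu; have [w0 vw] := varpi_prime.
set z : 'I_(N + 1) := rshift N 0.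
have hrow i : (g0 *m r) z i = varpi ^ e z * r (s z) i.
  rewrite mxE (bigD1 (s z)) //= hg eqxx mulr1n big1 ?addr0 // => k hk.
  by rewrite hg eq_sym (negbTE hk) mulr0n mul0r.
have rneq i : r (s z) i != 0.
  have := Ounit_neq0 (hu i); rewrite /lastrow -/z hrow.
  by rewrite !mulf_eq0 !negb_or => /andP[/andP[_ ->]].
have hval i : e z + val_ (r (s z) i) = ((N - i) * a)%N.
  have := hu i; rewrite /lastrow -/z hrow => -[_].
  have w1 : varpi ^ e z != 0 by rewrite expfz_neq0.
  rewrite val_M ?mulf_neq0 ?invr_eq0 ?expf_neq0 // val_M //.
  rewrite valV ?expf_neq0 // exprnP !valX // vf vw; lia.
have h1 : e z = ((N - s z) * a)%N.
  by rewrite -hval; case: (iwahori_diag (s z) ir) => _ ->; rewrite addr0.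
have h2 : e z <= 0.
  have := hval z; have : 0 <= val_ (r (s z) z).
    by apply: pidealE => //; case: ir => + _ _; apply.
  by rewrite /= addn0 subnn mul0n; lia.
have oz : s z = z.
  apply/val_inj => /=; have := ltn_ord (s z); nia.
have ez : e z = 0 by rewrite h1 oz /= addn0 subnn mul0n.
have ol (i : 'I_N) : exists j, s (lshift 1 i) = lshift 1 j.
  rewrite -(fintype.splitK (s (lshift 1 i))).
  case: (fintype.split _) (fintype.splitK (s (lshift 1 i))) => j /= ej; first by exists j.
  have : lshift 1 i = z by apply: s_inj; rewrite oz -ej /z (ord1 j).
  by move/eqP; rewrite eq_lrshift.
exists (ulsubmx g0).
  apply/matrixP => i j; rewrite -(fintype.splitK i) -(fintype.splitK j).
  case: (fintype.split i) => i'; case: (fintype.split j) => j' /=;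
    rewrite /emb (block_mxEul, block_mxEur, block_mxEdl, block_mxEdr) ?mxE //.
  - by rewrite hg; have [k ->] := ol i'; rewrite eq_lrshift mulr0n.
  - by rewrite (ord1 i') -/z hg oz eq_rlshift.
  - by rewrite (ord1 i') (ord1 j') -/z hg oz ez eqxx expr0z.
have [s' ho'] := choice ol.
exists (fun i => e (lshift 1 i)), s'; split=> [i j eij|i j].
  have : lshift 1 i = lshift 1 j by apply: s_inj; rewrite !ho' eij.
  exact: lshift_inj.
by rewrite !mxE hg ho' (inj_eq (@lshift_inj _ _)).
Qed.

Definition cell_coef (n : nat) : C :=
  \prod_(N < n) ((q ^+ (l - a) * G) ^+ N.+1 *
     (\prod_(i < N.+1) q ^- ((N - i) * a)) * (q ^+ l) ^+ N).

Lemma emb_eq1 n (g : 'M[F]_n) : (emb 1 g == 1%:M) = (g == 1%:M).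
Proof.
apply/eqP/eqP => [e|->]; last by rewrite emb1.
have := congr1 (@ulsubmx F n 1 n 1) e.
by rewrite /emb -[1%:M in RHS]emb1 /emb !block_mxKul.
Qed.

Definition birch_fun_sum_formula n : Prop := forall (W V : 'M[F]_n -> C) (g0 : 'M[F]_n),
  whittaker psi W -> iwahori_invariant W ->
  whittaker_inv psi V -> iwahori_invariant V ->
  g0 \in unitmx -> monomial_mx g0 ->
  ((2 * n * a).+1 <= l)%N -> Mideal ((n * a)%N%:Z - l%:Z) g0 ->
  \sum_(M : 'M[T]_n) (if `[< iwahori (mlift M) >]
     then birch_fun psi f X W V (g0 *m mlift M) else 0) =
  if g0 == 1%:M then cell_coef n * W 1%:M * V 1%:M else 0.

Lemma birch_fun_sum_step N : birch_fun_sum_formula N -> birch_fun_sum_formula (N + 1).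
Proof.
move=> IH W V g0 Wwh Wiw Vwh Viw ug0 mg0 large hg0.
have [[r [ir hr]]|hn] := pselect (exists r, iwahori r /\
    forall i, Ounit (lastrow f (g0 *m r) i)); last first.
  have hn' r : iwahori r -> ~ (forall i, Ounit (lastrow f (g0 *m r) i)).
    by move=> ir hr; apply: hn; exists r.
  rewrite (birch_fun_sum0 psi_add psiO f0 vf a_gt0 Xneq0 XM Xcond varpi_prime T
    Wiw Viw large ug0 hg0 hn').
  case: eqP => // e; exfalso; apply: (hn' (Kmx f (N + 1))).
    by apply: Kmx_iwahori => //; exact: pideal_f vf a_gt0.
  move=> i; rewrite e mul1mx /lastrow mxE ifT; last by have := ltn_ord i; rewrite /=; lia.
  rewrite /= addn0 mulfV ?expf_neq0 //; exact: Ounit1.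
have [g0' e mg0'] := monomial_lastrow mg0 ir hr.
rewrite e emb_unitmx in ug0 hg0 *.
rewrite (birch_fun_sum_emb psi_add psiO f0 vf a_gt0 Xneq0 XM Xcond varpi_prime T
  Wwh Wiw Vwh Viw large ug0 hg0).
rewrite (IH _ _ g0' (whittaker_emb psiO Wwh) (iwahori_invariant_emb Wiw)
  (whittaker_inv_emb psiO Vwh) (iwahori_invariant_emb Viw) ug0 mg0'); last 2 first.
- by nia.
- move=> i j; have := hg0 (lshift 1 i) (lshift 1 j); rewrite /emb block_mxEul.
  by apply: le_pideal; nia.
rewrite emb_eq1; case: eqP => _; last by rewrite mulr0.
have -> : cell_coef (N + 1) = cell_coef N * ((q ^+ (l - a) * G) ^+ (N + 1) *
     (\prod_(i < N + 1) q ^- ((N - i) * a)) * (q ^+ l) ^+ N).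
  by rewrite addn1 /cell_coef big_ord_recr.
by rewrite !emb1; ring.
Qed.

Lemma birch_fun_sum n : birch_fun_sum_formula n.
Proof.
elim: n => [|N IH]; last by rewrite -addn1; exact: birch_fun_sum_step.
move=> W V g0 Wwh Wiw Vwh Viw ug0 mg0 large hg0.
have e0 (A : 'M[F]_0) : A = 1%:M by rewrite [LHS]flatmx0 [RHS]flatmx0.
rewrite (e0 g0) eqxx /cell_coef big_ord0 mul1r.
rewrite (eq_bigr (fun=> W 1%:M * V 1%:M)) => [|M _].
  by rewrite sumr_const card_mx muln0 expn0 mulr1n.
rewrite asboolT; last by rewrite (e0 (mlift M)); exact: iwahori1.
rewrite /birch_fun /whittaker_part; set A := _ *m mlift M; rewrite (e0 (A *m _)) (e0 A) det1.
rewrite (X1 Xneq0 XM) mulr1 /lambda [phivec 0 f]flatmx0 mulmx0 mxE.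
by rewrite (psi_Oint psiO) ?mul1r //; exact: pideal0.
Qed.

End CellSum.

(** * Counting invertible matrices *)

Section Count.
Context {F : localField} (K : numFieldType).
Variables (varpi : F) (varpi_prime : prime_elt varpi).
Variables (l : nat) (T : residues F l) (l_gt0 : (0 < l)%N).
Local Notation q := ((resnorm F)%:R : K).
Local Notation mlift := (map_mx (rlift T)).

Definition gl_count n : nat := #|[pred M : 'M[T]_n | `[< GLO (mlift M) >]]|.

(** Put the row in place of row [i] of the identity matrix, whose inverse is then
    explicit and integral, and move row [i] to the end. *)
Lemma GLO_lastrow N (r : 'rV[F]_(N + 1)) (i : 'I_(N + 1)) : Mint r -> Ounit (r 0 i) ->
  exists2 g : 'M[F]_(N + 1), GLO g & row_mx 0 1%:M *m g = r.
Proof.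
move=> hr ui; have ri0 := Ounit_neq0 ui.
pose h : 'M[F]_(N + 1) := \matrix_(k, j) if k == i then r 0 j else (k == j)%:R.
pose h' : 'M[F]_(N + 1) := \matrix_(k, j) if k == i then
   (if j == i then (r 0 i)^-1 else - r 0 j / r 0 i) else (k == j)%:R.
have bI (b : bool) : Oint (b%:R : F) by case: b; [exact: Oint1|exact: pideal0].
have vI : Oint (r 0 i)^-1 by exact/Ounit_Oint/OunitV.
have hI : Mint h by move=> k j; rewrite mxE; case: eqP => _; [exact: hr|exact: bI].
have hI' : Mint h'.
  move=> k j; rewrite mxE; case: eqP => _ //; case: eqP => _ //.
  by apply: OintM => //; apply/pidealN; exact: hr.
have hh : h *m h' = 1%:M.
  apply/matrixP => k j; rewrite !mxE; have [->|ki] := eqVneq k i.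
    rewrite (bigD1 i) //= !mxE eqxx.
    rewrite (eq_bigr (fun m => r 0 m * (m == j)%:R)) => [|m mi]; last first.
      by rewrite !mxE eqxx (negbTE mi).
    rewrite [(j == i)]eq_sym; case: eqVneq => [<-|ij].
      rewrite mulfV // big1 ?addr0 // => m mi.
      by rewrite (negbTE mi) mulr0.
    rewrite (bigD1 j) 1?eq_sym //= eqxx mulr1 big1 ?addr0 => [|m /andP[_ mj]].
      by rewrite mulrCA mulfV // mulr1 addNr.
    by rewrite (negbTE mj) mulr0.
  rewrite (bigD1 k) //= !mxE (negbTE ki) eqxx mul1r big1 ?addr0 // => m mk.
  by rewrite !mxE (negbTE ki) eq_sym (negbTE mk) mul0r.
have gh : GLO h.
  split=> //; have := congr1 determinant hh; rewrite det_mulmx det1 => e.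
  have [] // := @OunitMP _ (\det h) (\det h'); try exact: Mint_det.
  by rewrite e; exact: Ounit1.
exists (tperm_mx i (rshift N 0) *m h).
  apply: GLOM => //; split.
    by move=> k j; rewrite !mxE; exact: bI.
  by rewrite det_perm; case: (odd_perm _); [apply: OunitN|]; exact: Ounit1.
apply/matrixP => k j; rewrite (ord1 k) mxE (bigD1 (rshift N 0)) //=.
rewrite row_mxEr mxE eqxx mul1r big1 ?addr0 => [|m].
  rewrite -row_permE !mxE tpermR eqxx; done.
rewrite -(fintype.splitK m); case: (fintype.split m) => m' /=.
  by rewrite row_mxEl mxE mul0r.
by rewrite (ord1 m') eqxx.
Qed.

Lemma GLO_mulrE n (A g : 'M[F]_n) : GLO g -> GLO (A *m g) <-> GLO A.
Proof.
move=> hg; split=> h; last exact: GLOM.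
by rewrite -(mulmxK (GLO_unitmx hg) A); apply: GLOM => //; exact: GLOV.
Qed.

Lemma GLO_ublock N (A : 'M[F]_N) (x : 'cV[F]_N) : Mint x ->
  GLO (block_mx A x 0 (1%:M : 'M[F]_1)) <-> GLO A.
Proof.
move=> hx; rewrite /GLO det_ublock det1 mulr1 Mint_block.
split=> [[[]]|[hA dA]] //; split=> //; split=> //; last exact: Mint1.
by move=> i j; rewrite mxE; exact: pideal0.
Qed.

(** An integral row can be completed to an invertible matrix exactly if it is not
    divisible by [p], which excludes [q^((l-1) (N+1))] of the [q^(l (N+1))] rows.
    Multiplying the other rows by the completing matrix moves a given such row
    to the last basis vector; the remaining matrix is then block triangular. *)
Lemma gl_count_step N :
  (gl_count (N + 1))%:R = q ^+ (l * (N + 1)) * (1 - q ^- (N + 1)) * q ^+ (l * N) *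
     (gl_count N)%:R :> K.
Proof.
pose Phi n (A : 'M[F]_n) : K := if `[< GLO A >] then 1 else 0.
have PhiR n : respects (@Mint F n n) (Mcongr l (n := n)) (@Phi n).
  move=> A B _ _ h; rewrite /Phi (_ : `[< GLO A >] = `[< GLO B >]) //.
  have h1 : Mcongr 1 A B by apply: le_Mcongr h; lia.
  apply: asbool_equiv_eq; split; apply: GLO_congr => //; exact: Mcongr_sym.
have cE n : (gl_count n)%:R = \sum_(M : 'M[T]_n) Phi n (mlift M).
  by rewrite /Phi -big_mkcond sumr_const.
rewrite cE sum_col_mx.
pose inp (t : T) : K := if `[< pideal 1 (rlift T t) >] then 1 else 0.
have inpE : \sum_(t : T) inp t = q ^+ (l - 1).
  rewrite /inp -big_mkcond sumr_const -natrX -(card_congr varpi_prime T (z := 0) l_gt0).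
    congr (_%:R); apply: eq_card => t; rewrite !inE unfold_in.
    by rewrite /congr_mod subr0.
  exact: pideal0.
pose allp (r : 'rV[T]_(N + 1)) : K := \prod_i inp (r 0 i).
have allpE : \sum_(r : 'rV[T]_(N + 1)) allp r = q ^+ (l - 1) ^+ (N + 1).
  by rewrite -inpE -[X in _ = _ ^+ X]card_ord -prodr_const -sum_rV_prod.
rewrite (eq_bigr (fun r => (1 - allp r) * (q ^+ (l * N) * (gl_count N)%:R))).
  rewrite -mulr_suml sumrB allpE sumr_const card_mx mul1n (card_residues varpi_prime T).
  rewrite mulrA; congr (_ * _); congr (_ * _).
  have q0 : q != 0 by rewrite pnatr_eq0 -lt0n (ltn_trans _ (@resnorm_gt1 F)).
  rewrite mulrBr mulr1 !natrX -!exprM; congr (_ - _).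
  apply: (@mulIf _ (q ^+ (N + 1))); first by rewrite expf_neq0.
  by rewrite mulfVK ?expf_neq0 // -exprD; congr (_ ^+ _); nia.
move=> r _.
have [hp|/existsNP[i ni]] := pselect (forall i, pideal 1 (rlift T (r 0 i))).
  rewrite {1}/allp [X in 1 - X]big1 => [|i _]; last by rewrite /inp asboolT.
  rewrite subrr mul0r big1 // => A _; rewrite map_col_mx /Phi asboolF //.
  move=> [hI /OunitP[_]]; apply.
  rewrite (expand_det_row _ (rshift N 0)); apply: pideal_sum => j _.
  apply: pidealMr; first by rewrite col_mxEd mxE; exact: hp.
  rewrite /cofactor; apply: OintM; first by apply: OintX; apply/pidealN; exact: Oint1.
  by apply: Mint_det => k m; rewrite 2!mxE; exact: hI.
rewrite (_ : allp r = 0); last by rewrite /allp (bigD1 i) //= /inp asboolF ?mul0r.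
have ui : Ounit ((mlift r) 0 i) by apply/OunitP; rewrite mxE; split=> //; exact: rlift_int.
have rI : Mint (mlift r) by exact: mlift_int.
have [g hg eg] := GLO_lastrow rI ui.
rewrite subr0 mul1r.
under eq_bigr => A _ do rewrite map_col_mx.
pose part A := Phi (N + 1) (col_mx A (mlift r)).
have partR : respects (@Mint F _ _) (Mcongr l (n := N + 1)) part.
  by move=> A A' hA hA' h; apply: PhiR; [exact: Mint_col_mx|exact: Mint_col_mx|
    exact: Mcongr_col_mx].
rewrite -/(part _) -(sum_mulr T hg partR) sum_row_mx.
rewrite (eq_bigr (fun=> (gl_count N)%:R)) => [|x _].
  rewrite sumr_const -[LHS]mulr_natl; congr (_ * _).
  by rewrite card_mx muln1 (card_residues varpi_prime T) -!natrX expnM.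
rewrite cE; apply: eq_bigr => A _; rewrite /part map_row_mx -eg -mul_col_mx.
rewrite -block_mxEv /Phi; congr (if _ then _ else _); apply: asbool_equiv_eq.
split=> [/(GLO_mulrE _ hg)/GLO_ublock|h]; first by apply; exact: mlift_int.
by apply/(GLO_mulrE _ hg)/GLO_ublock => //; exact: mlift_int.
Qed.

Lemma gl_countE n :
  (gl_count n)%:R =
  \prod_(N < n) (q ^+ (l * N.+1) * (1 - q ^- N.+1) * q ^+ (l * N)) :> K.
Proof.
elim: n => [|N IH].
  rewrite big_ord0 /gl_count (_ : #|_| = 1%N) //.
  rewrite -[RHS](_ : #|'M[T]_0| = 1%N); last by rewrite card_mx muln0 expn0.
  apply: eq_card => M; rewrite !inE; apply/asboolP.
  by split; [case|rewrite det_mx00; exact: Ounit1].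
by rewrite -[in LHS]addn1 gl_count_step IH big_ord_recr /= addn1 mulrC.
Qed.

End Count.

(** * Integration over the cells *)

Section FiniteValued.
Context d (T : measurableType d) (R : realType) (mu : {measure set T -> \bar R}).
Variables (D : set T) (h : T -> R) (s : seq R).
Hypotheses (mD : measurable D) (finD : (mu D < +oo)%E) (us : uniq s)
  (hs : forall x, D x -> h x \in s)
  (mh : forall y, measurable (D `&` h @^-1` [set y])).

Let B y := D `&` h @^-1` [set y].

Let finB y : mu (B y) \is a fin_num.
Proof.
rewrite ge0_fin_numE //; apply: le_lt_trans finD.
by apply: le_measure; rewrite ?inE //; [exact: mh|move=> x []].
Qed.

Let int_indic y : mu.-integrable D (EFin \o (\1_(B y) : T -> R)).
Proof.
apply: measurable_bounded_integrable => //.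
  by apply: measurable_funTS; apply: measurable_indic; exact: mh.
exists 1; split; first exact: num_real.
by move=> x x1 z _ /=; rewrite ger0_norm // (le_trans _ (ltW x1)) // indicE; case: (_ \in _).
Qed.

Let decomp : {in D, (fun x => (\sum_(y <- s) (y%:E * (\1_(B y) x)%:E))%E) =1 EFin \o h}.
Proof.
move=> x /set_mem Dx; rewrite (bigD1_seq (h x)) ?hs //= big1 ?adde0.
  by rewrite indicE mem_set ?mule1.
move=> y yx; rewrite indicE memNset ?mule0 // => -[_ /= e].
by rewrite e eqxx in yx.
Qed.

Lemma integrable_finite_valued : mu.-integrable D (EFin \o h).
Proof.
apply: (eq_integrable mD _ _ decomp); apply: integrable_sum => // y _.
by apply: integrableZl => //; exact: int_indic.
Qed.

Lemma Rintegral_finite_valued :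
  Rintegral mu D h = \sum_(y <- s) y * fine (mu (D `&` h @^-1` [set y])).
Proof.
rewrite /Rintegral -(eq_integral _ _ decomp) integral_sum //; last first.
  by move=> y; apply: integrableZl => //; exact: int_indic.
rewrite (eq_bigr (fun y => (y * fine (mu (B y)))%:E)) ?sumEFin // => y _.
rewrite integralZl //; last exact: int_indic.
rewrite integral_indic //; last exact: mh.
by rewrite (_ : B y `&` D = B y) ?EFinM ?fineK //; apply/setIidPl => x [].
Qed.

End FiniteValued.

Section Haar.
Context {R : realType} {F : localField} {n : nat}.
Implicit Types (g h : GL F n).

Lemma Mideal_bound m p (A : 'M[F]_(m, p)) : exists b : int, Mideal b A.
Proof.
exists (- \sum_i \sum_j (`|val_ (A i j)|%N : int)) => i j; right.
rewrite (bigD1 i) //= (bigD1 j) //=.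
have h1 : 0 <= \sum_(k | k != j) (`|val_ (A i k)|%N : int) by apply: sumr_ge0.
have h2 : 0 <= \sum_(k | k != i) \sum_j (`|val_ (A k j)|%N : int).
  by apply: sumr_ge0 => k _; apply: sumr_ge0.
rewrite lerNl; apply: (@le_trans _ _ (`|val_ (A i j)|%N : int)); first by lia.
by rewrite -addrA lerDl addr_ge0.
Qed.

Lemma GL_open_invariant (l : int) (A : set (GL F n)) :
  (forall g h, A g -> Mcongr l (invmx g *m h) 1%:M -> A h) -> GL_open A.
Proof.
move=> hA g Ag; have [b hb] := Mideal_bound (invmx g).
exists (l - b) => h hh; apply: hA Ag _; apply/Mideal_congr.
rewrite -(mulVmx (Defs.GL_unit g)) -mulmxBr (_ : l = b + (l - b)); last by lia.
by apply: MidealM => // i j; rewrite !mxE; exact: hh.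
Qed.

Lemma Uni_open_conj (k : int) (g h : 'M[F]_n) (P : set 'M[F]_n) :
  (forall x y, P x -> Mcongr k y x -> P y) ->
  Uni_open [set u : Uni F n | P (g *m u *m h)].
Proof.
move=> hP u Pu; have [b hb] := Mideal_bound g; have [c hc] := Mideal_bound h.
exists (k - b - c) => v hv; apply: hP Pu _; apply/Mideal_congr.
rewrite -mulmxBl -mulmxBr (_ : k = b + (k - b - c) + c); last by lia.
apply: MidealM => //; apply: MidealM => // i j; rewrite !mxE; exact: hv.
Qed.

Lemma GL_open_measurable (A : set (GL F n)) : GL_open A ->
  (@GL_open F n).-sigma.-measurable A.
Proof. exact: sub_sigma_algebra. Qed.

Lemma Uni_open_measurable (A : set (Uni F n)) : Uni_open A ->
  (@Uni_open F n).-sigma.-measurable A.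
Proof. exact: sub_sigma_algebra. Qed.

Lemma UGL_open_measurable (A : set (UGL F n)) : UGL_open A ->
  (@UGL_open F n).-sigma.-measurable A.
Proof. exact: sub_sigma_algebra. Qed.

Definition congruence_subgroup (l : nat) : set (GL F n) :=
  [set g : GL F n | Mcongr l g 1%:M].

Variables (muG : {measure set (GL_borel F n) -> \bar R}).
Hypothesis haarG : haar_measure (@GL_O F n) muG.
Variables (l : nat) (T : residues F l) (l_gt0 : (0 < l)%N).
Local Notation mlift := (map_mx (rlift T)).

(** The set is a disjoint union of translates of the principal congruence
    subgroup, one for each residue matrix in [P]. *)
Lemma haar_count (P : set 'M[F]_n) (g0 : GL F n) :
  (forall A, P A -> GLO A) -> (forall A B, P A -> Mcongr l A B -> P B) ->
  muG [set g : GL F n | P (invmx g0 *m g)] =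
  ((#|[pred M : 'M[T]_n | `[< P (mlift M) >]]|)%:R%:E * muG (congruence_subgroup l))%E.
Proof.
move=> PG Pc; case: haarG => haarL _ _.
have oA : GL_open [set g : GL F n | P g].
  apply: (@GL_open_invariant l) => g h Pg hk; apply: (Pc g) => //.
  have [gI _] := PG _ Pg.
  have := Mcongr_mull gI hk; rewrite mulKVmx ?Defs.GL_unit // mulmx1.
  exact: Mcongr_sym.
have -> : [set g : GL F n | P (invmx g0 *m g)] =
    [set x | [set g : GL F n | P g] (g0^-1 * x)%g] by [].
rewrite haarL; last exact: GL_open_measurable.
pose D := [set M : 'M[T]_n | P (mlift M)].
pose Bset (M : 'M[T]_n) := [set x : GL F n | Mcongr l x (mlift M)].
have oB M : GL_open (Bset M).
  move=> g gM; exists l => h hh; apply: Mcongr_trans gM.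
  by move=> i j; exact: hh.
have -> : [set g : GL F n | P g] = \bigcup_(M in D) Bset M.
  apply/seteqP; split=> g /=.
    move=> Pg; have [gI _] := PG _ Pg.
    have hr : Mcongr l (mlift (red (mx_approx T n n) g)) g.
      exact: (redK (mx_approx T n n) gI).
    exists (red (mx_approx T n n) g); last exact: Mcongr_sym.
    by apply: Pc Pg _; exact: Mcongr_sym.
  by move=> [M PM gM]; apply: Pc PM _; exact: Mcongr_sym.
have muB M : D M -> muG (Bset M) = muG (congruence_subgroup l).
  move=> PM; have gM := PG _ PM; have uM := GLO_unitmx gM.
  have [VI _] := GLOV gM; have [MI _] := gM.
  rewrite -[RHS](haarL (MkGL uM)^-1%g); last first.
    apply: GL_open_measurable; apply: (@GL_open_invariant l) => g h gK hk.
    have gK1 : Mcongr l g 1%:M := gK.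
    have gG : GLO g.
      by apply: GLO_congr (GLO1 n); apply: Mcongr_sym; apply: le_Mcongr gK1; lia.
    apply: Mcongr_trans gK; have [gI _] := gG.
    by have := Mcongr_mull gI hk; rewrite mulKVmx ?Defs.GL_unit // mulmx1.
  congr (muG _); apply/seteqP; split=> x; rewrite /Bset /congruence_subgroup /= => h.
    by have := Mcongr_mull VI h; rewrite mulVmx.
  by have := Mcongr_mull MI h; rewrite mulKVmx // mulmx1.
rewrite measure_fin_bigcup.
- rewrite (eq_fsbigr (fun=> muG (congruence_subgroup l))) => [|M /set_mem]; last exact: muB.
  have -> : D = [set` [seq M <- enum 'M[T]_n | `[< P (mlift M) >]]].
    apply/seteqP; split=> M /=; rewrite mem_filter mem_enum inE andbT.
      by move=> h; apply/asboolP.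
    by move/asboolP.
  rewrite -fsbig_seq; last by apply: filter_uniq; exact: enum_uniq.
  by rewrite big_filter big_enum_cond /= sumr_const mule_natl.
- exact: finite_finset.
- apply/trivIsetP => M M' _ _ /eqP MM'; apply/seteqP; split=> // x [h1 h2].
  apply: MM'; apply: (@rlift_inj _ _ _ (mx_approx T n n)).
  by apply: Mcongr_trans h2; exact: Mcongr_sym.
- by move=> M _; apply: GL_open_measurable; exact: oB.
Qed.

Lemma haar_congruence_subgroup :
  muG (congruence_subgroup l) = ((gl_count T n)%:R^-1)%:E /\ (0 < gl_count T n)%N.
Proof.
have [_ _ h1] := haarG.
have e : (1 = (gl_count T n)%:R%:E * muG (congruence_subgroup l))%E.
  rewrite -(@haar_count (@GLO F n) (GL_one F n)) //.
    rewrite -h1; congr (muG _); apply/seteqP; split=> g /=;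
    by rewrite invmx1 mul1mx.
  by move=> A B hA hB; apply: GLO_congr hA; apply: le_Mcongr hB; lia.
have N0 : gl_count T n != 0%N.
  by apply/eqP => N0; move: e; rewrite N0 mul0e => /eqP; rewrite onee_eq0.
split; last by rewrite lt0n.
have Nr : (gl_count T n)%:R != 0 :> R by rewrite pnatr_eq0.
case: (muG _) e => [x [e]| |] //.
- by congr (_%:E); apply: (mulfI Nr); rewrite -e mulfV.
- by rewrite gt0_muley // lte_fin ltr0n lt0n.
- by rewrite gt0_muleNy // lte_fin ltr0n lt0n.
Qed.

Lemma repr_pi (g : GL F n) :
  exists2 u : 'M[F]_n, u \in @unipotent F n &
    (repr (\pi_(UGL F n) g)%qT : GL F n) = u *m g :> 'M[F]_n.
Proof.
have : Uorbit g (repr (\pi_(UGL F n) g)%qT).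
  by apply/eqmodP; rewrite reprK.
by move=> /asboolP[u ->]; exists u => //; exact: Uni_prop.
Qed.

Lemma pi_unipotent (u : Uni F n) (g h : GL F n) : (h : 'M[F]_n) = u *m g ->
  (\pi_(UGL F n) g)%qT = (\pi_(UGL F n) h)%qT.
Proof. by move=> e; apply/eqmodP/asboolP; exists u; exact: val_inj. Qed.

Variables (muU : {measure set (Uni_borel F n) -> \bar R})
  (mu : {measure set (UGL_borel F n) -> \bar R}).
Hypotheses (haarU : haar_measure (@Uni_O F n) muU)
  (weil : quotient_measure muG muU mu).
Variable g0 : GL F n.

Definition iwahori_cell : set (UGL_borel F n) :=
  [set x | exists2 g : GL F n, (x : UGL F n) = (\pi_(UGL F n) g)%qT &
     exists2 r : 'M[F]_n, iwahori r & (g : 'M[F]_n) = g0 *m r].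

(** The intersection of [U_n] with the conjugate by [g0] of the Iwahori subgroup;
    its volume is the factor between the measure of a subset of the cell and the
    measure of its preimage in [g0 I]. *)
Definition cell_stab : set (Uni_borel F n) :=
  [set u : Uni F n | iwahori (invmx g0 *m u *m g0)].

Section Level.
Variables (V : Type) (Phi : 'M[F]_n -> V).
Hypotheses (PhiU : forall u g : 'M[F]_n, u \in @unipotent F n -> g \in unitmx ->
    Phi (u *m g) = Phi g)
  (PhiK : forall r k : 'M[F]_n, iwahori r -> Mcongr l k 1%:M ->
    Phi (g0 *m r *m k) = Phi (g0 *m r)).

Definition level (Y : set V) : set (UGL_borel F n) :=
  [set x | iwahori_cell x /\ Y (Phi (repr (x : UGL F n) : GL F n))].

Lemma Phi_repr (g : GL F n) : Phi (repr (\pi_(UGL F n) g)%qT : GL F n) = Phi g.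
Proof. by have [u hu ->] := repr_pi g; rewrite PhiU // Defs.GL_unit. Qed.

Lemma iwahori_cell_pi (g : GL F n) : iwahori_cell (\pi_(UGL F n) g)%qT <->
  exists u r : 'M[F]_n, [/\ u \in @unipotent F n, iwahori r &
     (g : 'M[F]_n) = u *m (g0 *m r)].
Proof.
split=> [[h e [r ir hr]]|[u [r [hu ir e]]]].
  have /eqmodP/asboolP[u hu] : (\pi_(UGL F n) h = \pi_(UGL F n) g)%qT by [].
  by exists u, r; split=> //; [exact: Uni_prop|rewrite hu /= hr].
have uh : g0 *m r \in unitmx.
  by rewrite unitmx_mul Defs.GL_unit GLO_unitmx //; exact: iwahori_GLO.
exists (MkGL uh); last by exists r.
by apply/esym/(@pi_unipotent (MkUni hu)).
Qed.

Lemma level_measurable Y : measurable (level Y).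
Proof.
apply: UGL_open_measurable; apply: (@GL_open_invariant l) => g h [cg Yg] hk.
have eh : (h : 'M[F]_n) = g *m (invmx g *m h) by rewrite mulKVmx // Defs.GL_unit.
set k := invmx g *m h in hk eh.
have hk1 : Mcongr 1 1%:M k by apply: Mcongr_sym; apply: le_Mcongr hk; lia.
have ik : iwahori k by apply: iwahori_congr hk1 (iwahori1 _).
have /iwahori_cell_pi[u [r [hu ir eg]]] := cg.
have ug r' : iwahori r' -> g0 *m r' \in unitmx.
  by move=> h'; rewrite unitmx_mul Defs.GL_unit GLO_unitmx //; exact: iwahori_GLO.
split.
  apply/iwahori_cell_pi; exists u, (r *m k); split=> //; first exact: iwahoriM.
  by rewrite eh eg !mulmxA.
rewrite Phi_repr in Yg; rewrite Phi_repr eh eg -mulmxA.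
rewrite PhiU //; last by rewrite -mulmxA; apply: ug; exact: iwahoriM.
by rewrite PhiK // -(PhiU hu) -?eg // ug.
Qed.

(** Weil's formula for the set of [g] in [g0 I] with [Phi g] in [Y].  For [x] in
    the level set, the [u] that move the representative of [x] into this set form
    a right translate of [cell_stab]; for other [x] there are none. *)
Lemma level_measure Y :
  ((#|[pred M : 'M[T]_n | `[< iwahori (mlift M) /\ Y (Phi (g0 *m mlift M)) >]]|)%:R%:E
     * muG (congruence_subgroup l) = muU cell_stab * mu (level Y))%E.
Proof.
pose P (A : 'M[F]_n) := iwahori A /\ Y (Phi (g0 *m A)).
have quot (A B : 'M[F]_n) : iwahori A -> Mcongr l A B -> exists2 k, B = A *m k & Mcongr l k 1%:M.
  move=> iA AB; have [VI _] := GLOV (iwahori_GLO iA); have uA := GLO_unitmx (iwahori_GLO iA).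
  exists (invmx A *m B); first by rewrite mulKVmx.
  by have := Mcongr_mull VI (Mcongr_sym AB); rewrite mulVmx.
have Pc (A B : 'M[F]_n) : P A -> Mcongr l A B -> P B.
  move=> [iA YA] AB; split.
    by apply: iwahori_congr iA; apply: le_Mcongr AB; lia.
  by have [k -> hk] := quot A B iA AB; rewrite mulmxA PhiK.
rewrite -(@haar_count P g0) //; last by move=> A [/iwahori_GLO].
have oS : Uni_open cell_stab.
  apply: (@Uni_open_conj 1) => x y ix hxy.
  by apply: iwahori_congr ix; exact: Mcongr_sym.
rewrite (weil (A := [set g : GL F n | P (invmx g0 *m g)])); last first.
  apply: GL_open_measurable; apply: (@GL_open_invariant l) => g h Pg hk.
  have [iA _] := Pg; apply: Pc Pg _; apply: Mcongr_sym.
  have [gI _] := iwahori_GLO iA.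
  have := Mcongr_mull gI hk.
  by rewrite -[X in Mcongr _ X]mulmxA mulKVmx ?Defs.GL_unit // mulmx1.
have -> : (\int[mu]_(x in [set: UGL_borel F n])
    muU [set u | [set g : GL F n | P (invmx g0 *m g)] (GL_of_Uni u * repr (x : UGL F n))%g])%E =
   (\int[mu]_(x in [set: UGL_borel F n]) ((fun=> muU cell_stab) \_ (level Y)) x)%E.
  apply: eq_integral => x _; rewrite /patch; case: ifPn => [/set_mem|/negP xn].
    move=> [cx Yx].
    have : iwahori_cell (\pi_(UGL F n) (repr (x : UGL F n)))%qT by rewrite reprK.
    move=> /iwahori_cell_pi[u1 [r1 [hu1 ir1 e1]]].
    have [_ haarR _] := haarU.
    rewrite -(haarR (MkUni hu1) cell_stab); last exact: Uni_open_measurable.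
    congr (muU _); apply/seteqP; split=> u /=; rewrite /cell_stab /P /= e1.
      by rewrite !mulmxA => -[/(iwahori_mulrE _ ir1)].
    move=> h; split; first by rewrite !mulmxA in h *; apply/(iwahori_mulrE _ ir1).
    rewrite mulKVmx ?Defs.GL_unit // -e1 PhiU ?Uni_prop ?Defs.GL_unit //.
  rewrite [X in muU X](_ : _ = set0) ?measure0 //; apply/seteqP; split=> // u /=.
  move=> [iA YA]; apply: xn; apply/mem_set.
  rewrite /= mulKVmx ?Defs.GL_unit // PhiU ?Uni_prop ?Defs.GL_unit // in YA.
  split=> //; rewrite -[x]reprK; apply/iwahori_cell_pi.
  exists (invmx u), (invmx g0 *m (u *m (repr (x : UGL F n) : GL F n))); split=> //.
    by apply: unipotentV; exact: Uni_prop.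
  by rewrite mulKVmx ?Defs.GL_unit // mulKmx // unipotent_unit ?Uni_prop.
rewrite -integral_mkcond integral_cst //; exact: level_measurable.
Qed.

End Level.

(** The product of the measures of [cell_stab] and of the cell is the volume of the
    Iwahori subgroup, which is positive and finite; as a product of 0 and infinity
    is 0 in the extended reals, both factors are positive and finite. *)
Lemma cell_stab_fin : exists2 c : R, 0 < c & muU cell_stab = c%:E.
Proof.
have := @level_measure unit (fun=> tt) (fun _ _ _ _ => erefl) (fun _ _ _ _ => erefl) setT.
have [-> N0] := haar_congruence_subgroup.
set N := #|_|; have Npos : (0 < N)%N.
  apply/card_gt0P; exists (red (mx_approx T n n) 1%:M); rewrite inE.
  split=> //; apply: (iwahori_congr _ (iwahori1 n)); apply: Mcongr_sym.
  apply: (@le_Mcongr _ 1 l); first by lia.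
  by apply: (redK (mx_approx T n n)); exact: Mint1.
have pos : 0 < N%:R * (gl_count T n)%:R^-1 :> R.
  by rewrite mulr_gt0 ?invr_gt0 ?ltr0n.
rewrite -EFinM; have : (0 <= muU cell_stab)%E := measure_ge0 muU _.
case: (muU cell_stab) => [c| |] //.
  rewrite lee_fin le_eqVlt => /orP[/eqP<-|c0 _]; last by exists c.
  by rewrite mul0e => -[e]; rewrite e ltxx in pos.
move=> _; have : (0 <= mu (level (fun=> tt) setT))%E := measure_ge0 mu _.
rewrite le_eqVlt => /orP[/eqP<-|h]; last by rewrite gt0_mulye.
by rewrite mule0 => -[e]; rewrite e ltxx in pos.
Qed.

(** [Phi] takes finitely many values on the cell, and [level_measure] gives the
    measure of the set where it takes a given one. *)
Lemma cell_integral (c : R) (Phi : 'M[F]_n -> R) : muU cell_stab = c%:E -> 0 < c ->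
  (forall u g : 'M[F]_n, u \in @unipotent F n -> g \in unitmx ->
    Phi (u *m g) = Phi g) ->
  (forall r k : 'M[F]_n, iwahori r -> Mcongr l k 1%:M ->
    Phi (g0 *m r *m k) = Phi (g0 *m r)) ->
  let h := fun x : UGL_borel F n => Phi (repr (x : UGL F n) : GL F n) in
  mu.-integrable iwahori_cell (EFin \o h) /\
  Rintegral mu iwahori_cell h = (c * (gl_count T n)%:R)^-1 *
    \sum_(M : 'M[T]_n) (if `[< iwahori (mlift M) >] then Phi (g0 *m mlift M) else 0).
Proof.
move=> ec c0 PhiU PhiK h.
pose value M := Phi (g0 *m mlift M).
pose s := undup [seq value M | M <- enum 'M[T]_n].
have [eK N0] := haar_congruence_subgroup.
have eC : iwahori_cell = level Phi setT.
  by apply/seteqP; split=> x // [].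
have mC : measurable iwahori_cell by rewrite eC; exact: level_measurable.
have lev Y : mu (level Phi Y) = (c^-1 * (gl_count T n)%:R^-1 *
    (#|[pred M : 'M[T]_n | `[< iwahori (mlift M) /\ Y (Phi (g0 *m mlift M)) >]]|)%:R)%:E.
  have := level_measure PhiU PhiK Y; rewrite eK ec -EFinM.
  have cn : c != 0 by rewrite gt_eqF.
  case: (mu _) => [x [e]| |].
  - congr (_%:E); apply: (mulfI cn); rewrite -e; rewrite -mulrA mulVKf //; exact: mulrC.
  - by rewrite gt0_muley.
  - by rewrite gt0_muleNy.
have finC : (mu iwahori_cell < +oo)%E by rewrite eC lev ltry.
have levE y : iwahori_cell `&` h @^-1` [set y] = level Phi [set y] by [].
have hs x : iwahori_cell x -> h x \in s.
  move=> cx; have : iwahori_cell (\pi_(UGL F n) (repr (x : UGL F n)))%qT by rewrite reprK.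
  move=> /iwahori_cell_pi[u [r [hu ir e]]].
  have [rI _ _] := ir; have uh : g0 *m r \in unitmx.
    by rewrite unitmx_mul Defs.GL_unit GLO_unitmx //; exact: iwahori_GLO.
  rewrite /s mem_undup.
  apply/mapP; exists (red (mx_approx T n n) r).
    by rewrite mem_enum.
  have hr : Mcongr l (mlift (red (mx_approx T n n) r)) r.
    exact: (redK (mx_approx T n n) rI).
  rewrite /h /value e PhiU //; have ur := GLO_unitmx (iwahori_GLO ir).
  have [VI _] := GLOV (iwahori_GLO ir).
  rewrite -(PhiK r (invmx r *m mlift (red (mx_approx T n n) r))) //.
    by rewrite -mulmxA mulKVmx.
  by have := Mcongr_mull VI hr; rewrite mulVmx.
have mh y : measurable (iwahori_cell `&` h @^-1` [set y]).
  by rewrite levE; exact: level_measurable.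
split; first exact: integrable_finite_valued (undup_uniq _) hs mh.
rewrite (Rintegral_finite_valued mC finC (undup_uniq _) hs mh).
rewrite (eq_bigr (fun y => (c * (gl_count T n)%:R)^-1 *
   \sum_(M | `[< iwahori (mlift M) /\ value M = y >]) value M)).
  rewrite -mulr_sumr; congr (_ * _); rewrite (exchange_big_dep xpredT) //=.
  apply: eq_bigr => M _; case: asboolP => iM; last first.
    by rewrite big1 // => y /asboolP[].
  rewrite (big_rem (value M)) /=; last by rewrite mem_undup map_f ?mem_enum.
  rewrite asboolT // big_seq_cond big1 ?addr0 // => y.
  by rewrite mem_rem_uniq ?undup_uniq // inE => /andP[/andP[yM _] /asboolP[_ e]];
    rewrite e eqxx in yM.
move=> y _; rewrite levE lev /= invfM.
rewrite (eq_bigr (fun=> y)) => [|M /asboolP[] //].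
by rewrite sumr_const -[y *+ _]mulr_natr; ring.
Qed.

End Haar.

(** * Embeddings, complex powers and the constant *)

Section Embedding.
Context {R : realType} {F : localField}.
Variables (psi : F -> R[i]) (psiO : has_conductor_O psi).

Lemma whittaker_jmx m n (le_nm : (n <= m)%N) (w : 'M[F]_m -> R[i]) :
  whittaker psi w -> iwahori_invariant w ->
  whittaker psi (fun g => w (jmx le_nm g)) /\
  iwahori_invariant (fun g => w (jmx le_nm g)).
Proof.
rewrite /jmx; move: (m - n)%N (subnKC le_nm) => k E.
case: _ / E w => w hw iw; split.
  move=> u g hu hg; rewrite !castmx_id; exact: (whittaker_emb psiO hw hu hg).
move=> g r hg hr; rewrite !castmx_id; exact: (iwahori_invariant_emb iw hg hr).
Qed.

Lemma jmx1 m n (le_nm : (n <= m)%N) : jmx le_nm (1%:M : 'M[F]_n) = 1%:M.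
Proof.
rewrite /jmx; move: (m - n)%N (subnKC le_nm) => k E.
by case: _ / E; rewrite castmx_id -/(emb _ _) emb1.
Qed.

End Embedding.

Section ComplexPower.
Context {R : realType} {F : localField}.
Local Notation C := R[i].

Lemma cpowM (x y : R) (z : C) : 0 < x -> 0 < y -> cpow (x * y) z = cpow x z * cpow y z.
Proof.
move=> x0 y0; rewrite /cpow lnM ?posrE // !mulrDr expRD cosD sinD.
rewrite rmorphM /= mulrACA; congr (_ * _).
by apply/eqP; rewrite eq_complex /= eqxx /=; apply/eqP; ring.
Qed.

Lemma cpow1 (z : C) : cpow 1 z = 1.
Proof.
by rewrite /cpow ln1 !mulr0 expR0 cos0 sin0 mul1r.
Qed.

Lemma absF_gt0 (x : F) : x != 0 -> 0 < absF R x.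
Proof.
move=> x0; rewrite /absF (negbTE x0) exprz_gt0 // ltr0n.
exact: ltn_trans (@resnorm_gt1 F).
Qed.

Lemma absFM (x y : F) : x != 0 -> y != 0 -> absF R (x * y) = absF R x * absF R y.
Proof.
move=> x0 y0; rewrite /absF mulf_eq0 (negbTE x0) (negbTE y0) /= val_M // opprD.
rewrite expfzDr // pnatr_eq0 -lt0n; exact: ltn_trans (@resnorm_gt1 F).
Qed.

Lemma absF_unit (x : F) : Ounit x -> absF R x = 1.
Proof. by move=> [x0 e]; rewrite /absF (negbTE x0) e oppr0 expr0z. Qed.

Lemma cpow_neq0 (x : R) (z : C) : 0 < x -> cpow x z != 0.
Proof.
move=> x0; have xi : 0 < x^-1 by rewrite invr_gt0.
have xx : x * x^-1 = 1 by rewrite mulfV // gt_eqF.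
have := cpowM z x0 xi; rewrite xx cpow1 => e.
by apply/eqP => e0; move: e; rewrite e0 mul0r => /eqP; rewrite oner_eq0.
Qed.

End ComplexPower.

Section Constant.
Variables (K : numFieldType) (q G : K) (l a : nat).
Hypotheses (q1 : 1 < q) (al : (a <= l)%N).

(** Raising [n] by one raises the second factor of each term by one, so the
    increment is [1 + ... + (n + 1)]. *)
Lemma sum_exponents n :
  (\sum_(1 <= k < n.+2) k * (n.+2 - k) =
   (\sum_(1 <= k < n.+1) k * (n.+1 - k)) + ((\sum_(i < n.+1) (n - i)) + n.+1))%N.
Proof.
rewrite big_nat_recr //= subSnn muln1.
have -> : (\sum_(i < n.+1) (n - i) = \sum_(1 <= k < n.+1) k)%N.
  rewrite (reindex_inj rev_ord_inj) /= -(big_mkord xpredT (fun i => n - (n.+1 - i.+1))%N).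
  rewrite big_ltn // subSS subn0 subnn add0n.
  by apply: eq_big_nat => i /andP[_ hi]; lia.
rewrite addnA -big_split /=; congr (_ + _)%N.
by apply: eq_big_nat => i /andP[_ hi]; nia.
Qed.

(** The left-hand side is the value of the finite sum at [g0 = 1], divided by the
    number of invertible matrices modulo [p^l]; all powers of [q^l] cancel. *)
Lemma constantE n :
  (\prod_(N < n) (q ^+ (l * N.+1) * (1 - q ^- N.+1) * q ^+ (l * N)))^-1 *
  (\prod_(N < n) ((q ^+ (l - a) * G) ^+ N.+1 *
     (\prod_(i < N.+1) q ^- ((N - i) * a)) * (q ^+ l) ^+ N)) =
  (\prod_(1 <= nu < n.+1) (1 - q ^- nu)^-1) *
  (q ^+ a) ^- (\sum_(1 <= k < n.+1) k * (n.+1 - k))%N * G ^+ ((n * n.+1) %/ 2)%N.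
Proof.
have q0 : q != 0 by rewrite gt_eqF // (lt_trans _ q1).
elim: n => [|n IH].
  rewrite !big_ord0 !big_geq // ?invr1 ?mulr1.
  done.
rewrite sum_exponents [X in X^-1 * _]big_ord_recr [X in _ * X = _]big_ord_recr /=.
rewrite [\prod_(1 <= nu < n.+2) _]big_nat_recr //= invfM mulrACA IH.
have -> : ((n.+1 * n.+2) %/ 2 = (n * n.+1) %/ 2 + n.+1)%N.
  by rewrite (_ : n.+1 * n.+2 = n.+1 * 2 + n * n.+1)%N ?divnMDl //; nia.
have -> : \prod_(i < n.+1) q ^- ((n - i) * a) = (q ^+ a) ^- (\sum_(i < n.+1) (n - i))%N.
  rewrite prodfV; congr (_^-1).
  elim/big_ind2 : _ => // [x y z t -> ->|i _]; first by rewrite exprD.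
  by rewrite -exprM mulnC.
rewrite !exprD !exprMn.
have -> : q ^+ (l * n.+1) = (q ^+ (l - a)) ^+ n.+1 * (q ^+ a) ^+ n.+1.
  by rewrite -exprMn -exprD subnK // exprM.
rewrite [q ^+ (l * n)]exprM.
have h1 : 1 - q ^- n.+1 != 0.
  by rewrite subr_eq0 eq_sym lt_eqF // invf_lt1 ?exprn_gt0 ?exprn_egt1 // (lt_trans _ q1).
move: (q ^+ (l - a)) (q ^+ a) (q ^+ l) (expf_neq0 (l - a) q0) (expf_neq0 a q0) (expf_neq0 l q0).
move=> A B D A0 B0 D0.
move: (A ^+ n.+1) (D ^+ n) (B ^+ n.+1) (B ^+ (\sum_(i < n.+1) (n - i)))
  (B ^+ (\sum_(1 <= k < n.+1) k * (n.+1 - k))) (1 - q ^- n.+1) h1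
  (expf_neq0 n.+1 A0) (expf_neq0 n D0) (expf_neq0 n.+1 B0)
  (expf_neq0 (\sum_(i < n.+1) (n - i)) B0)
  (expf_neq0 (\sum_(1 <= k < n.+1) k * (n.+1 - k)) B0).
move=> A1 D1 B1 B2 B3 q2 q20 A10 D10 B10 B20 B30.
by field; rewrite ?q20 ?A10 ?D10 ?B10 ?B20 ?B30.
Qed.

End Constant.

(** * The local Birch lemma *)

Section Twist.
Context {R : realType} {F : localField}.
Local Notation C := R[i].
Variables (psi chi X : F -> C) (f : F) (a : nat).
Hypotheses (f0 : f != 0) (vf : val_ f = a) (a_gt0 : (0 < a)%N).
Hypothesis (Xchi : forall x, Ounit x -> X x = chi x).

Lemma is_conductor_twist (J : set F) : is_conductor chi J -> is_conductor X J.
Proof.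
have H J' : trivial_mod X J' <-> trivial_mod chi J'.
  by split=> h x ux hx; have := h x ux hx; rewrite Xchi.
by move=> [h1 h2 h3]; split=> // [|J' i' /H]; [exact/H|exact: h3].
Qed.

Lemma gauss_sum_twist : gauss_sum psi X f = gauss_sum psi chi f.
Proof.
apply: eq_fsbigr => Y /set_mem[x ux <-]; rewrite Xchi //.
have e : congr_mod 1 (xget 0 (coset_mod f x)) x.
  by apply: le_pideal (xget_coset f0 vf x); lia.
by apply/(Ounit_congr e).
Qed.

End Twist.

Lemma complex_scale_sum (R : realType) (I : finType) (P : pred I) (k : R) (h : I -> R[i]) :
  real_complex R k * \sum_i (if P i then h i else 0) =
  Complex (k * \sum_i (if P i then complex.Re (h i) else 0))
          (k * \sum_i (if P i then complex.Im (h i) else 0)).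
Proof.
have -> : \sum_i (if P i then h i else 0) =
    Complex (\sum_i (if P i then complex.Re (h i) else 0))
            (\sum_i (if P i then complex.Im (h i) else 0)).
  elim/big_ind3 : _ => // [x1 y1 z1 x2 y2 z2 -> -> //|i _].
  by case: (P i) => //; case: (h i).
by apply/eqP; rewrite eq_complex /= !mul0r subr0 addr0 !eqxx.
Qed.

Section CellValue.
Context {R : realType} {F : localField} {n : nat}.
Local Notation C := R[i].
Variables (psi X : F -> C) (f : F) (a : nat).
Hypotheses (psi_add : additive_character psi) (psiO : has_conductor_O psi).
Hypotheses (f0 : f != 0) (vf : val_ f = a) (a_gt0 : (0 < a)%N).
Hypotheses (Xneq0 : forall x : F, x != 0 -> X x != 0)
  (XM : forall x y : F, x != 0 -> y != 0 -> X (x * y) = X x * X y)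
  (Xcond : is_conductor X (principal f)).
Variables (varpi : F) (varpi_prime : prime_elt varpi).
Variables (muG : {measure set (GL_borel F n) -> \bar R})
  (muU : {measure set (Uni_borel F n) -> \bar R})
  (mu : {measure set (UGL_borel F n) -> \bar R}).
Hypotheses (haarG : haar_measure (@GL_O F n) muG)
  (haarU : haar_measure (@Uni_O F n) muU)
  (weil : quotient_measure muG muU mu).
Variables (W V : 'M[F]_n -> C).
Hypotheses (Wwh : whittaker psi W) (Wiw : iwahori_invariant W)
  (Vwh : whittaker_inv psi V) (Viw : iwahori_invariant V).

Local Notation q := ((resnorm F)%:R : C).
Local Notation G := (gauss_sum psi X f).

Definition birch_fun_quot (x : UGL_borel F n) : C :=
  birch_fun psi f X W V (repr (x : UGL F n) : GL F n).

Lemma cell_value (g0 : GL F n) : monomial_mx varpi (g0 : 'M[F]_n) ->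
  cintegrable mu (iwahori_cell g0) birch_fun_quot /\
  cintegral mu (iwahori_cell g0) birch_fun_quot =
  if (g0 : 'M[F]_n) == 1%:M then
    (\prod_(1 <= nu < n.+1) (1 - q ^- nu)^-1) *
    (q ^+ a) ^- (\sum_(1 <= k < n.+1) k * (n.+1 - k))%N *
    G ^+ ((n * n.+1) %/ 2)%N * W 1%:M * V 1%:M
  else 0.
Proof.
move=> mg0; have [b hb] := Mideal_bound (g0 : 'M[F]_n).
(* The last summand bounds the denominators of [g0]. *)
pose l := ((2 * n * a).+1 + a + `|b|%N)%N.
have large : ((2 * n * a).+1 <= l)%N by rewrite /l; lia.
have al : (a <= l)%N by rewrite /l; lia.
have l_gt0 : (0 < l)%N by rewrite /l; lia.
have [T _] := residues_exist varpi_prime l.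
have hg0 : Mideal ((n * a)%N%:Z - l%:Z) g0.
  by move=> i j; apply: le_pideal (hb i j); rewrite /l; nia.
have [c c0 ec] := cell_stab_fin haarG T l_gt0 haarU weil g0.
have HU (u g : 'M[F]_n) : u \in @unipotent F n -> g \in unitmx ->
    birch_fun psi f X W V (u *m g) = birch_fun psi f X W V g.
  exact: (birch_fun_unipotent psi_add f0 X Wwh Vwh).
have HK (r k : 'M[F]_n) : iwahori r -> Mcongr l k 1%:M ->
    birch_fun psi f X W V (g0 *m r *m k) = birch_fun psi f X W V (g0 *m r).
  move=> ir hk; apply: (birch_fun_congr psi_add psiO f0 vf XM (trivial_X f0 vf Xcond)
    Wiw Viw a_gt0 large al _ _ hk).
    by rewrite unitmx_mul Defs.GL_unit GLO_unitmx //; exact: iwahori_GLO.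
  by rewrite -[_ - _]addr0; apply: MidealM => //; case: ir.
have [iRe eRe] := cell_integral haarG T l_gt0 haarU weil ec c0
  (Phi := fun g => complex.Re (birch_fun psi f X W V g))
  (fun u g hu hg => congr1 (@complex.Re R) (HU u g hu hg))
  (fun r k hr hk => congr1 (@complex.Re R) (HK r k hr hk)).
have [iIm eIm] := cell_integral haarG T l_gt0 haarU weil ec c0
  (Phi := fun g => complex.Im (birch_fun psi f X W V g))
  (fun u g hu hg => congr1 (@complex.Im R) (HU u g hu hg))
  (fun r k hr hk => congr1 (@complex.Im R) (HK r k hr hk)).
split; first by split.
have -> : cintegral mu (iwahori_cell g0) birch_fun_quot =
    real_complex R (c * (gl_count T n)%:R)^-1 *
    \sum_(M : 'M[T]_n) (if `[< iwahori (map_mx (rlift T) M) >]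
      then birch_fun psi f X W V (g0 *m map_mx (rlift T) M) else 0).
  by rewrite complex_scale_sum /cintegral eRe eIm.
rewrite (birch_fun_sum psi_add psiO f0 vf a_gt0 Xneq0 XM Xcond varpi_prime T
  Wwh Wiw Vwh Viw (Defs.GL_unit g0) mg0 large hg0).
case: eqP => [e1|_]; last by rewrite mulr0.
have c1 : c = 1.
  have [_ _ hO] := haarU; apply: EFin_inj; rewrite -ec -hO; congr (muU _).
  apply/seteqP; split=> u; rewrite /cell_stab /= e1 invmx1 mul1mx mulmx1.
    by case.
  move=> hu; have pu := Uni_prop u; split=> //.
    by rewrite det_unipotent //; exact: Ounit1.
  move=> i j ij; move/unipotentP: pu => ->; last exact: ltnW.
  by rewrite gt_eqF //; exact: pideal0.
rewrite c1 mul1r !mulrA; congr (_ * _ * _).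
rewrite -(constantE G _ al); last by rewrite ltr1n; exact: resnorm_gt1.
congr (_ * _).
rewrite fmorphV rmorph_nat; congr (_^-1); exact: (gl_countE _ varpi_prime T l_gt0).
Qed.

End CellValue.

Theorem theorem2p1 (R : realType) (F : localField) (varpi : F)
    (psi : F -> R[i]) (m n : nat) (le_nm : (n <= m)%N)
    (w : 'M[F]_m -> R[i]) (v : 'M[F]_n -> R[i])
    (chi : F -> R[i]) (f : F) (s : R[i])
    (muG : {measure set (GL_borel F n) -> \bar R})
    (muU : {measure set (Uni_borel F n) -> \bar R})
    (mu : {measure set (UGL_borel F n) -> \bar R}) :
  prime_elt varpi ->
  additive_character psi -> has_conductor_O psi ->
  haar_measure (@GL_O F n) muG ->
  haar_measure (@Uni_O F n) muU ->
  quotient_measure muG muU mu ->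
  whittaker psi w -> iwahori_invariant w ->
  whittaker_inv psi v -> iwahori_invariant v ->
  quasi_character chi ->
  f != 0 -> Oint f -> ~ Ounit f -> is_conductor chi (principal f) ->
  has_cellwise_integral mu varpi
    (birch_integrand psi chi f s le_nm w v)
    ((\prod_(1 <= nu < n.+1) (1 - (absnorm (pideal 1 : set F))%:R ^- nu)^-1) *
     (absnorm (principal f))%:R ^- (\sum_(1 <= k < n.+1) k * (n.+1 - k))%N *
     gauss_sum psi chi f ^+ ((n * n.+1) %/ 2)%N *
     w 1%:M * v 1%:M).
Proof.
move=> wpi psi_add psiO haarG haarU weil wwh wiw vwh viw [chi0 chiM _] f0 fO fU cond.
have [a vf] : exists a : nat, val_ f = a.
  by have := pidealE f0 fO; case: (val_ f) => // a _; exists a.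
have a_gt0 : (0 < a)%N.
  by rewrite lt0n; apply/eqP => a0; apply: fU; split=> //; rewrite vf a0.
pose z := s - (m - n)%:R / 2%:R.
pose X (x : F) := chi x * cpow (absF R x) z.
have Xneq0 (x : F) : x != 0 -> X x != 0.
  by move=> x0; rewrite mulf_neq0 ?chi0 // cpow_neq0 // absF_gt0.
have XM (x y : F) : x != 0 -> y != 0 -> X (x * y) = X x * X y.
  by move=> x0 y0; rewrite /X chiM // absFM // cpowM ?absF_gt0 // mulrACA.
have Xchi (x : F) : Ounit x -> X x = chi x.
  by move=> ux; rewrite /X absF_unit // cpow1 mulr1.
have Xcond := is_conductor_twist Xchi cond.
pose W := fun g : 'M[F]_n => w (jmx le_nm g).
have [Wwh Wiw] := whittaker_jmx psiO le_nm wwh wiw.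
have hE : birch_integrand psi chi f s le_nm w v = birch_fun psi f X W v.
  apply/funext => g; rewrite /birch_integrand /birch_fun /whittaker_part /X /W -mulmxA Dmx_wmx.
  by rewrite !mulrA.
pose g0 (eo : {ffun 'I_n -> int} * 'S_n) : 'M[F]_n :=
  diag_mx (\row_i varpi ^ eo.1 i) *m perm_mx eo.2.
have g0E eo i j : g0 eo i j = varpi ^ eo.1 i *+ (eo.2 i == j).
  by rewrite /g0 mul_diag_mx !mxE mulr_natr.
have w0 : varpi != 0 by case: wpi.
have ug0 eo : g0 eo \in unitmx.
  rewrite unitmx_mul unitmx_perm andbT unitmxE det_diag unitfE.
  by apply/prodf_neq0 => i _; rewrite mxE expfz_neq0.
pose gl0 eo := MkGL (ug0 eo).
have mono eo : monomial_mx varpi (gl0 eo : 'M[F]_n).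
  by exists eo.1, eo.2; split; [exact: perm_inj|exact: g0E].
have cellE eo : cell varpi eo.1 eo.2 = iwahori_cell (gl0 eo) by [].
pose e0 : {ffun 'I_n -> int} * 'S_n := ([ffun=> 0], 1%g).
have g01 eo : (g0 eo == 1%:M) = (eo == e0).
  apply/eqP/eqP => [e|->]; last first.
    by apply/matrixP => i j; rewrite g0E mxE /= ffunE perm1 expr0z.
  have h i : eo.2 i = i /\ eo.1 i = 0.
    have := congr1 (fun A : 'M[F]_n => A i i) e; rewrite /= g0E mxE eqxx.
    case: eqP => [-> |_] /=; last by move/eqP; rewrite mulr0n eq_sym oner_eq0.
    move=> /(congr1 (@val_ F)); rewrite mulr1n valX // val_1.
    by case: wpi => _ ->; rewrite mulr1.
  case: eo {e} h => e o /= h; congr (_, _).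
    by apply/ffunP => i; rewrite ffunE; case: (h i).
  by apply/permP => i; rewrite perm1; case: (h i).
have cellv eo := cell_value psi_add psiO f0 vf a_gt0 Xneq0 XM Xcond wpi haarG haarU weil
  Wwh Wiw vwh viw (mono eo).
rewrite /has_cellwise_integral hE; split.
  by move=> e o; have [] := cellv (e, o).
have [S0 cS0] := residues_exist wpi a.
rewrite (absnorm_principal f0 vf S0) cS0 natrX.
rewrite -(gauss_sum_twist psi f0 vf a_gt0 Xchi) -(jmx1 le_nm).
set S := _ * v 1%:M.
have vale eo : cintegral mu (cell varpi eo.1 eo.2)
    (fun x => birch_fun psi f X W v (repr (x : UGL F n) : GL F n)) =
    if eo == e0 then S else 0.
  by rewrite cellE -g01; have [_] := cellv eo.
move=> eps eps0; exists [fset e0]%fset => J /fsubsetP hJ.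
have e0J : e0 \in J by apply: hJ; rewrite in_fset1.
rewrite (big_fsetD1 e0) // [X in _ + X - _]big_seq_cond [X in _ + X - _]big1 => [|eo].
  by rewrite vale eqxx addr0 subrr normr0.
by rewrite in_fsetD1 andbT => /andP[ne _]; rewrite vale (negbTE ne).
Qed.
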